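(* Let $M$ be a closed surface endowed with an area form $\omega$. (a) If $\zeta$ is a simple quasi-state on $M$, then for any $F,G\in C^1(M)$, $$|\zeta(F+G)-\zeta(F)-\zeta(G)|^2\ \le\ \mathrm{area}(M)\,\|\{F,G\}\|,$$ where $\mathrm{area}(M)=\int_M\omega$ and $\|\cdot\|$ is the supremum norm. (b) If $\zeta$ is a representable quasi-state on $M$, then $\zeta(F+G)=\zeta(F)+\zeta(G)$ for any $F,G\in C^1(M)$ with $\{F,G\}\equiv 0$.
   Context: A closed surface is a compact smooth two-dimensional manifold without boundary, oriented by the area form $\omega$. The Poisson bracket of $F,G\in C^1(M)$ is the continuous function $\{F,G\}$ determined by $-dF\wedge dG=\{F,G\}\,\omega$. For a compact Hausdorff space $X$, $C(X)$ is the algebra of real-valued continuous functions on $X$, and for $F\in C(X)$, $C(F)=\{\varphi\circ F \mid \varphi\in C(F(X))\}$. A quasi-state on $X$ is a (not necessarily linear) functional $\zeta: C(X)\to\mathbb{R}$ such that (i) $\zeta(F)\ge 0$ whenever $F\ge 0$; (ii) $\zeta$ is linear on $C(F)$ for every $F\in C(X)$; (iii) $\zeta(1)=1$. A quasi-state is simple if it is multiplicative on $C(F)$ for every $F\in C(X)$. The set of quasi-states on $X$ is convex and carries the topology of pointwise convergence: $\zeta_\nu\to\zeta$ iff $\zeta_\nu(H)\to\zeta(H)$ for every $H\in C(X)$. A quasi-state is representable if it lies in the closed convex hull of the set of simple quasi-states. *)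

(* Defs.v *)
From HB Require Import structures.
From mathcomp Require Import all_boot all_order all_algebra.
From mathcomp Require Import all_classical all_reals all_analysis.
From mathcomp Require Import ring.

Set Implicit Arguments.
Unset Strict Implicit.
Unset Printing Implicit Defensive.
Import Order.TTheory GRing.Theory Num.Theory.
Import numFieldNormedType.Exports.

Local Open Scope classical_set_scope.
Local Open Scope ring_scope.

(** * The algebra C(X) *)

Section continuous_functions.
Context {X : topologicalType} {R : realType}.
Implicit Types f g h : continuousType X R.

Let cts f : continuous f. Proof. exact: cts_fun. Qed.

Definition cfun_of (u : X -> R) (cu : continuous u) : continuousType X R :=
  mkcts cu.

Lemma add_continuous_fun f g : continuous (fun x => f x + g x).
Proof. by move=> x; apply: continuousD; exact: cts. Qed.
Lemma opp_continuous_fun f : continuous (fun x => - f x).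
Proof. by move=> x; apply: continuousN; exact: cts. Qed.
Lemma mul_continuous_fun f g : continuous (fun x => f x * g x).
Proof. by move=> x; apply: continuousM; exact: cts. Qed.
Lemma const_continuous_fun (a : R) : continuous (fun _ : X => a).
Proof. by move=> x; exact: cvg_cst. Qed.

Definition cfun_zero := cfun_of (@const_continuous_fun 0).
Definition cfun_one := cfun_of (@const_continuous_fun 1).
Definition cfun_add f g := cfun_of (@add_continuous_fun f g).
Definition cfun_opp f := cfun_of (@opp_continuous_fun f).
Definition cfun_mul f g := cfun_of (@mul_continuous_fun f g).
Definition cfun_scale (a : R) f := cfun_mul (cfun_of (@const_continuous_fun a)) f.

Fact cfun_addA : associative cfun_add.
Proof. by move=> f g h; apply/continuousEP => x; exact: addrA. Qed.
Fact cfun_addC : commutative cfun_add.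
Proof. by move=> f g; apply/continuousEP => x; exact: addrC. Qed.
Fact cfun_add0 : left_id cfun_zero cfun_add.
Proof. by move=> f; apply/continuousEP => x; exact: add0r. Qed.
Fact cfun_addN : left_inverse cfun_zero cfun_opp cfun_add.
Proof. by move=> f; apply/continuousEP => x; exact: addNr. Qed.

HB.instance Definition _ := GRing.isZmodule.Build (continuousType X R)
  cfun_addA cfun_addC cfun_add0 cfun_addN.

Fact cfun_mulA : associative cfun_mul.
Proof. by move=> f g h; apply/continuousEP => x; exact: mulrA. Qed.
Fact cfun_mulC : commutative cfun_mul.
Proof. by move=> f g; apply/continuousEP => x; exact: mulrC. Qed.
Fact cfun_mul1 : left_id cfun_one cfun_mul.
Proof. by move=> f; apply/continuousEP => x; exact: mul1r. Qed.
Fact cfun_mulDl : left_distributive cfun_mul +%R.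
Proof. by move=> f g h; apply/continuousEP => x; exact: mulrDl. Qed.

HB.instance Definition _ := GRing.Zmodule_isComPzRing.Build (continuousType X R)
  cfun_mulA cfun_mulC cfun_mul1 cfun_mulDl.

Fact cfun_scaleA a b f : cfun_scale a (cfun_scale b f) = cfun_scale (a * b) f.
Proof. by apply/continuousEP => x; exact: mulrA. Qed.
Fact cfun_scale1 : left_id 1 cfun_scale.
Proof. by move=> f; apply/continuousEP => x; exact: mul1r. Qed.
Fact cfun_scaleDr : right_distributive cfun_scale +%R.
Proof. by move=> a f g; apply/continuousEP => x; exact: mulrDr. Qed.
Fact cfun_scaleDl f : {morph cfun_scale^~ f : a b / a + b}.
Proof. by move=> a b; apply/continuousEP => x; exact: mulrDl. Qed.

HB.instance Definition _ := GRing.Zmodule_isLmodule.Build R (continuousType X R)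
  cfun_scaleA cfun_scale1 cfun_scaleDr cfun_scaleDl.

End continuous_functions.

(** * Quasi-states *)

Section quasi_states.
Context {X : topologicalType} {R : realType}.
Implicit Types (F : continuousType X R) (zeta : continuousType X R -> R).

(* C(F): phi is only required to be continuous on the image of F. *)
Definition generated_by F : set (continuousType X R) :=
  [set H | exists phi : R -> R,
     {within range F, continuous phi} /\ forall x, H x = phi (F x)].

Record quasi_state zeta : Prop := {
  quasi_state_ge0 : forall F, (forall x, 0 <= F x) -> 0 <= zeta F ;
  quasi_state_linear : forall F A B (a b : R),
    generated_by F A -> generated_by F B ->
    zeta (a *: A + b *: B) = a * zeta A + b * zeta B ;
  quasi_state1 : zeta 1 = 1 }.

Record simple_quasi_state zeta : Prop := {
  simple_quasi_state_quasi_state : quasi_state zeta ;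
  simple_quasi_state_mul : forall F A B,
    generated_by F A -> generated_by F B -> zeta (A * B) = zeta A * zeta B }.

(* Smallest closed convex set containing S, for the topology of pointwise
   convergence.  Quasi-states form a closed convex set of functionals, so it
   makes no difference whether the hull is taken among quasi-states or among
   all functionals on C(X). *)
Definition closed_convex_hull (S : set (continuousType X R -> R)) :
    set (continuousType X R -> R) :=
  [set zeta | forall K : set (continuousType X R -> R),
    closed (K : set {ptws (continuousType X R) -> R}) ->
    convex_set (K : set (convex_lmodType (continuousType X R -> R))) ->
    S `<=` K -> K zeta].

Definition representable zeta : Prop :=
  quasi_state zeta /\ closed_convex_hull [set xi | simple_quasi_state xi] zeta.

End quasi_states.

(** * Calculus in the plane *)

Section plane.
Context {R : realType}.
Implicit Types (U : set (R * R)) (f g : R * R -> R).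

(* Meant for U open. *)
Fixpoint class_C (k : nat) U f : Prop :=
  if k is k'.+1 then
    (forall x, U x -> differentiable f x) /\ (forall v, class_C k' U ('D_v f))
  else {in U, continuous f}.

Definition smooth_on U f : Prop := forall k, class_C k U f.

(* df /\ dg = wedge f g dx /\ dy *)
Definition wedge f g (x : R * R) : R :=
  'D_(1, 0) f x * 'D_(0, 1) g x - 'D_(0, 1) f x * 'D_(1, 0) g x.

Lemma wedge_comp (f g : R * R -> R) (tau : R * R -> R * R) x :
  differentiable (fst \o tau) x -> differentiable (snd \o tau) x ->
  differentiable f (tau x) -> differentiable g (tau x) ->
  wedge (f \o tau) (g \o tau) x =
    wedge f g (tau x) * wedge (fst \o tau) (snd \o tau) x.
Proof.
move=> d1 d2 df dg.
have dtau : differentiable tau x.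
  rewrite (_ : tau = fun z => ((fst \o tau) z, (snd \o tau) z)).
    exact: differentiable_pair.
  by apply/funext => z /=; case: (tau z).
have E (h : R * R -> R) v : differentiable h (tau x) ->
    'D_v (h \o tau) x = 'D_v (fst \o tau) x * 'D_(1, 0) h (tau x) +
                        'D_v (snd \o tau) x * 'D_(0, 1) h (tau x).
  move=> dh.
  have dht : differentiable (h \o tau) x by exact: differentiable_comp.
  have -> : 'D_v (h \o tau) x = 'd h (tau x) ('d tau x v).
    by rewrite (deriveE _ dht); exact: (congr1 (@^~ v) (diff_comp dtau dh)).
  have -> : 'd tau x v = ('D_v (fst \o tau) x, 'D_v (snd \o tau) x).
    have tauE : tau = (fun z => ((fst \o tau) z, (snd \o tau) z)).
      by apply/funext => z /=; case: (tau z).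
    rewrite [in LHS]tauE (deriveE _ d1) (deriveE _ d2).
    exact: (congr1 (@^~ v) (diff_pair d1 d2)).
  rewrite (deriveE _ dh) (deriveE _ dh).
  move: ('D_v _ x) ('D_v _ x) => b a.
  have -> : (a, b) = a *: (1, 0) + b *: (0, 1) :> R * R.
    by congr pair; rewrite /= /GRing.scale /= ?mulr1 ?mulr0 ?addr0 ?add0r.
  by rewrite linearD !linearZ.
rewrite {1}/wedge !(E f _ df) !(E g _ dg) /wedge.
by move: ('D_(1, 0) f _) ('D_(0, 1) f _) ('D_(1, 0) g _) ('D_(0, 1) g _)
  ('D__ (fst \o tau) x) ('D__ (fst \o tau) x) ('D__ (snd \o tau) x)
  ('D__ (snd \o tau) x) => *; ring.
Qed.

Definition plane_measure := (@lebesgue_measure R \x @lebesgue_measure R)%E.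

End plane.

(** * Closed surfaces *)

Record chart (R : realType) (M : topologicalType) := Chart {
  chart_dom : set M ;
  chart_map :> M -> R * R ;
  chart_inv : R * R -> M ;
  chart_dom_open : open chart_dom ;
  chart_img_open : open (chart_map @` chart_dom) ;
  chart_mapK : {in chart_dom, cancel chart_map chart_inv} ;
  chart_map_continuous : {in chart_dom, continuous chart_map} ;
  chart_inv_continuous : {in chart_map @` chart_dom, continuous chart_inv} }.

Definition transition (R : realType) (M : topologicalType)
  (c d : chart R M) : R * R -> R * R := d \o chart_inv c.

(* A smooth structure is given by an atlas; it need not be maximal. *)
Record closedSurface (R : realType) := ClosedSurface {
  surface_space :> topologicalType ;
  surface_compact : compact [set: surface_space] ;
  surface_hausdorff : hausdorff_space surface_space ;
  surface_index : Type ;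
  surface_chart : surface_index -> chart R surface_space ;
  surface_cover : forall p, exists i, chart_dom (surface_chart i) p ;
  surface_smooth : forall i j,
    let c := surface_chart i in let d := surface_chart j in
    let U := c @` (chart_dom c `&` chart_dom d) in
    smooth_on U (fst \o transition c d) /\
    smooth_on U (snd \o transition c d) }.

Section surface.
Context {R : realType} (M : closedSurface R).
Local Notation chart_ := (@surface_chart R M).

Definition chart_image (i : surface_index M) : set (R * R) :=
  chart_ i @` chart_dom (chart_ i).

Definition in_chart (i : surface_index M) (F : M -> R) : R * R -> R :=
  F \o chart_inv (chart_ i).

Definition C1 (F : M -> R) : Prop :=
  forall i, class_C 1 (chart_image i) (in_chart i F).

(* The form is area_density i dx /\ dy in the chart i; area_density_change is
   the transformation rule of 2-forms. *)
Record areaForm := AreaForm {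
  area_density : surface_index M -> R * R -> R ;
  area_density_smooth : forall i, smooth_on (chart_image i) (area_density i) ;
  area_density_neq0 : forall i x, chart_image i x -> area_density i x != 0 ;
  area_density_change : forall i j x,
    (chart_ i @` (chart_dom (chart_ i) `&` chart_dom (chart_ j))) x ->
    let tau := transition (chart_ i) (chart_ j) in
    area_density i x =
      area_density j (tau x) * wedge (fst \o tau) (snd \o tau) x }.

Variable omega : areaForm.

Definition bracket_in_chart (F G : M -> R) (i : surface_index M) (p : M) : R :=
  - wedge (in_chart i F) (in_chart i G) (chart_ i p)
    / area_density omega i (chart_ i p).

Lemma bracket_in_chart_indep (F G : M -> R) i j p : C1 F -> C1 G ->
  chart_dom (chart_ i) p -> chart_dom (chart_ j) p ->
  bracket_in_chart F G i p = bracket_in_chart F G j p.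
Proof.
move=> dF dG pi pj; rewrite /bracket_in_chart.
set c := chart_ i; set d := chart_ j; pose tau := transition c d; pose x := c p.
have xp : chart_inv c x = p by apply: (chart_mapK (c := c)); rewrite inE.
have taux : tau x = d p by rewrite /tau/transition /= xp.
have Ux : (c @` (chart_dom c `&` chart_dom d)) x by exists p.
have xc : chart_image i x by exists p.
have yd : chart_image j (tau x) by rewrite taux; exists p.
have E (h : M -> R) : \forall z \near x, in_chart i h z = (in_chart j h \o tau) z.
  have : \forall z \near x, chart_dom d (chart_inv c z).
    apply: (chart_inv_continuous (c := c)); first by rewrite inE.
    by rewrite xp; apply: open_nbhs_nbhs; split => //; exact: chart_dom_open.
  apply: filterS => z hz; rewrite /in_chart /tau /transition /=.
  by congr h; rewrite (chart_mapK (c := d)) ?inE.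
have -> : wedge (in_chart i F) (in_chart i G) x =
          wedge (in_chart j F \o tau) (in_chart j G \o tau) x.
  by rewrite /wedge !(near_eq_derive _ (E _)).
have [s1 s2] := surface_smooth i j.
rewrite wedge_comp; first last.
- exact: (dG j).1.
- exact: (dF j).1.
- exact: (s2 1%N).1.
- exact: (s1 1%N).1.
have w0 := area_density_neq0 omega xc.
rewrite -/x; move: w0; rewrite (area_density_change omega Ux) -/tau taux.
rewrite mulf_eq0 negb_or => /andP[w1 w2].
by field; rewrite w1.
Qed.

(* Computed in some chart around p; by poissonE below, any chart will do. *)
Definition poisson (F G : M -> R) (p : M) : R :=
  bracket_in_chart F G (projT1 (cid (surface_cover p))) p.

Lemma poissonE (F G : M -> R) i p : C1 F -> C1 G -> chart_dom (chart_ i) p ->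
  - wedge (in_chart i F) (in_chart i G) (chart_ i p) =
    poisson F G p * area_density omega i (chart_ i p).
Proof.
move=> dF dG pi; rewrite /poisson; case: cid => j /= pj.
rewrite (bracket_in_chart_indep dF dG pj pi) /bracket_in_chart divfK //.
by apply: area_density_neq0; exists p.
Qed.

Definition sup_norm (b : M -> R) : R := sup (range (fun p => `|b p|)).

(* M is cut into finitely many Borel pieces, each inside a chart, and the
   densities are integrated over the pieces.  The absolute value is there
   because M is oriented by omega, whereas charts may reverse orientation.
   By the change of variables formula the sum is the same for all partitions,
   so the infimum is that of a constant. *)
Record chart_partition (n : nat) (i : 'I_n -> surface_index M)
    (A : 'I_n -> set M) : Prop := {
  partition_sub : forall k, A k `<=` chart_dom (chart_ (i k)) ;
  partition_measurable : forall k, measurable (chart_ (i k) @` A k) ;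
  partition_disjoint : trivIset setT A ;
  partition_cover : \bigcup_k A k = setT }.

Definition partition_area (n : nat) (i : 'I_n -> surface_index M)
    (A : 'I_n -> set M) : \bar R :=
  (\sum_(k < n) \int[plane_measure]_(x in chart_ (i k) @` A k)
     `|area_density omega (i k) x|%:E)%E.

Definition area : \bar R :=
  ereal_inf [set s | exists n (i : 'I_n -> surface_index M) A,
    chart_partition i A /\ s = partition_area i A].

End surface.

(* Main.v *)
(* Put a = zeta F, b = zeta G, c = zeta (F + G), and let zeta be simple.  If
   a + b < c, then (F, G) takes every value in the triangle
   T = {a < u, b < v, u + v < c}, whose area is (c - a - b)^2 / 2; the case
   c < a + b follows by replacing F, G, zeta F, ... by their opposites.
   Adding to F finitely many bump functions supported in chart squares moves
   the image of (F, G) off any given value, and each step preserves the parity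
   of the number of preimages of almost every value.  Hence almost every point
   of T is taken an even, so at least two, times, and the area inequality
   for C^1 maps gives 2 area(T) <= |dF /\ dG| (M) <= area(M) ||{F,G}||.
   For representable zeta: being additive on the pair (F, G) is a closed and
   convex condition. *)

From HB Require Import structures.
Require Import Defs.
From mathcomp Require Import all_boot all_order all_algebra.
From mathcomp Require Import all_classical all_reals all_analysis.
From mathcomp Require Import measurable_realfun.
From mathcomp Require Import ring lra.
Set Implicit Arguments.
Unset Strict Implicit.
Unset Printing Implicit Defensive.
Import Order.TTheory GRing.Theory Num.Theory.
Import numFieldNormedType.Exports.
Local Open Scope classical_set_scope.
Local Open Scope ring_scope.

(** * Simple quasi-states *)

(** The factor 2 of multiplicity turns the area of the triangle, half a square, into the constant 1.
    It reflects that a map from a closed surface to the plane has mod 2 degree zero. The degree is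
    built by hand, as the parity of crossings of a ray by polygons sampled at dyadic points of the
    boundary of a chart square, so no homotopy is involved. Two sets of values have to be discarded:
    the critical values, and the images of the dyadic lines along which squares are cut. Both are
    null by the same area inequality, applied where the Jacobian vanishes or on a null set. Images
    of Borel sets may fail to be Borel, so areas of images are always bounded through measurable
    supersets. The inequality by itself ignores multiplicity; the factor 2 is recovered by cutting
    the surface into ever smaller dyadic pieces, until two preimages of a value lie in different
    pieces. *)

Section evaluation.
Context {X : topologicalType} {R : realType}.
Implicit Types F G : continuousType X R.

Lemma cfunDE F G x : (F + G) x = F x + G x. Proof. by []. Qed.
Lemma cfunNE F x : (- F) x = - F x. Proof. by []. Qed.
Lemma cfunME F G x : (F * G) x = F x * G x. Proof. by []. Qed.
Lemma cfunZE a F x : (a *: F) x = a * F x. Proof. by []. Qed.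
Lemma cfun1E x : (1 : continuousType X R) x = 1. Proof. by []. Qed.

Definition cfunE := (cfunDE, cfunNE, cfunME, cfunZE, cfun1E).

End evaluation.

Section simple_quasi_states.
Context {X : topologicalType} {R : realType}.
Variable zeta : continuousType X R -> R.
Hypothesis zeta_simple : simple_quasi_state zeta.
Implicit Types A B F G H : continuousType X R.

Let zeta_linear := quasi_state_linear (simple_quasi_state_quasi_state zeta_simple).
Let zeta1 := quasi_state1 (simple_quasi_state_quasi_state zeta_simple).

Lemma generated_by_comp F H (phi : R -> R) : continuous phi ->
  (forall x, H x = phi (F x)) -> generated_by F H.
Proof. by move=> cphi HF; exists phi; split => //; exact: continuous_subspaceT. Qed.

Lemma generated_by_id F : generated_by F F.
Proof. by apply: (@generated_by_comp _ _ id) => // x; exact: cvg_id. Qed.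

Lemma generated_by_cst F (H : continuousType X R) (a : R) :
  (forall x, H x = a) -> generated_by F H.
Proof.
by move=> Ha; apply: (@generated_by_comp _ _ (fun=> a)) => // x; exact: cvg_cst.
Qed.

(** If [H] had no zero, its inverse would lie in C(F) too, and multiplicativity would make 1 a
    multiple of [zeta H], which is 0. *)
Lemma simple_quasi_state_zero F H : generated_by F H -> zeta H = 0 ->
  exists x, H x = 0.
Proof.
move=> [phi [cphi HE]] zH; apply: contrapT => /forallNP nz.
have cV : continuous (fun x => (H x)^-1).
  by move=> x; apply: continuousV; [exact/eqP/nz|exact: cts_fun].
have gV : generated_by F (cfun_of cV).
  exists (fun t => (phi t)^-1); split; last by move=> x; rewrite -HE.
  apply/subspace_continuousP => _ [x _ <-]; apply: cvgV.
    by rewrite -HE; exact/eqP/nz.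
  by move/subspace_continuousP : cphi; apply; exists x.
have gH : generated_by F H by exists phi.
have := simple_quasi_state_mul zeta_simple gH gV.
rewrite zH mul0r (_ : H * cfun_of cV = 1) ?zeta1; last first.
  by apply/continuousEP => x /=; rewrite [LHS]mulfV//; exact/eqP/nz.
by move/eqP; rewrite oner_eq0.
Qed.

Lemma quasi_state_cst (H : continuousType X R) (a : R) :
  (forall x, H x = a) -> zeta H = a.
Proof.
move=> Ha.
have -> : H = a *: (1 : continuousType X R) + 0 *: (1 : continuousType X R).
  by apply/continuousEP => x; rewrite !cfunE Ha mulr1 mul0r addr0.
rewrite (zeta_linear _ _ (generated_by_id 1) (generated_by_id 1)).
by rewrite zeta1; ring.
Qed.

(** The sum of squares (H - zeta H)^2 + (F - zeta F)^2 lies in C(F) and is sent to 0, so it has a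
    zero, where [F] and [H] take the values [zeta F] and [zeta H] simultaneously. *)
Lemma simple_quasi_state_comp F H (phi : R -> R) : continuous phi ->
  (forall x, H x = phi (F x)) -> zeta H = phi (zeta F).
Proof.
move=> cphi HF; set v := zeta H; set h := zeta F.
have c1 (a : R) : continuous (fun t : R => t - a).
  by move=> t; apply: cvgB; [exact: cvg_id|exact: cvg_cst].
pose K1 : continuousType X R := H - cfun_of (@const_continuous_fun X R v).
pose K2 : continuousType X R := F - cfun_of (@const_continuous_fun X R h).
have gF := generated_by_id F.
have gH : generated_by F H by exact: generated_by_comp HF.
have gK1 : generated_by F K1.
  apply: (@generated_by_comp _ _ (fun t => phi t - v)) => [t|x].
    by apply: cvgB; [exact: cphi|exact: cvg_cst].
  by rewrite -HF.
have gK2 : generated_by F K2 by exact: (@generated_by_comp _ _ (fun t => t - h)).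
have zc a : zeta (cfun_of (@const_continuous_fun X R a)) = a.
  exact: quasi_state_cst.
have zsub A a : generated_by F A ->
    zeta (A - cfun_of (@const_continuous_fun X R a)) = zeta A - a.
  move=> gA.
  have -> : A - cfun_of (@const_continuous_fun X R a) =
            1 *: A + (- 1) *: cfun_of (@const_continuous_fun X R a).
    by apply/continuousEP => x; rewrite !cfunE mul1r mulN1r.
  rewrite (zeta_linear _ _ gA (@generated_by_cst _ _ a _))//.
  by rewrite zc mul1r mulN1r.
have gS K : generated_by F K -> generated_by F (K * K).
  move=> [psi [cpsi KE]]; exists (fun t => psi t * psi t); split.
    move=> t; exact: (continuousM (cpsi t) (cpsi t)).
  by move=> x; rewrite -KE.
have zS : zeta (1 *: (K1 * K1) + 1 *: (K2 * K2)) = 0.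
  rewrite (zeta_linear _ _ (gS _ gK1) (gS _ gK2)).
  rewrite !(simple_quasi_state_mul zeta_simple (F := F))//.
  by rewrite /K1 /K2 !zsub// /v /h !subrr; ring.
have gT : generated_by F (1 *: (K1 * K1) + 1 *: (K2 * K2)).
  apply: (@generated_by_comp _ _ (fun t => (phi t - v) ^+ 2 + (t - h) ^+ 2)).
    move=> t; apply: cvgD; rewrite expr2; apply: cvgM.
    - by apply: cvgB; [exact: cphi|exact: cvg_cst].
    - by apply: cvgB; [exact: cphi|exact: cvg_cst].
    - exact: c1.
    - exact: c1.
  by move=> x; rewrite !cfunE !mul1r -HF -!expr2.
have [x Kx] := simple_quasi_state_zero gT zS.
have /eqP : (H x - v) ^+ 2 + (F x - h) ^+ 2 = 0.
  by rewrite -[RHS]Kx !cfunE !mul1r -!expr2.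
rewrite paddr_eq0 ?sqr_ge0// !sqrf_eq0 !subr_eq0 => /andP[/eqP HV /eqP Fh].
by rewrite -Fh -HF.
Qed.

Lemma simple_quasi_stateN F : zeta (- F) = - zeta F.
Proof.
apply: (@simple_quasi_state_comp F (- F) (fun t => - t)) => // t.
by apply: cvgN; exact: cvg_id.
Qed.

Lemma simple_quasi_state_range F : exists x, F x = zeta F.
Proof.
pose K : continuousType X R := F - cfun_of (@const_continuous_fun X R (zeta F)).
have ck : continuous (fun t : R => t - zeta F).
  by move=> t; apply: cvgB; [exact: cvg_id|exact: cvg_cst].
have gK : generated_by F K by exact: (generated_by_comp ck).
have [|x] := simple_quasi_state_zero gK.
  by rewrite (simple_quasi_state_comp (F := F) (H := K) ck)// subrr.
by move=> /eqP; rewrite /= subr_eq0 => /eqP ?; exists x.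
Qed.

Let pos (t : R) : R := (t + `|t|) / 2.
(** The factor [s] will be 1 or -1, giving the positive and the negative part. *)
Let cpos (s : R) : continuous (fun t => pos (s * t)).
Proof.
move=> t; apply: cvgMl; have st : s * y @[y --> t] --> s * t.
  by apply: cvgMr; exact: cvg_id.
by apply: cvgD => //; exact: cvg_norm.
Qed.

(* [A] and [B] are the positive and negative parts of [A - B], so only one of
   the two values is nonzero. *)
Lemma simple_quasi_state_disjoint A B : (forall x, 0 <= A x) ->
  (forall x, 0 <= B x) -> (forall x, A x * B x = 0) ->
  zeta A = 0 \/ zeta B = 0.
Proof.
move=> A0 B0 AB.
have S x : (A - B) x = A x - B x by [].
have pA : forall x, A x = pos (1 * (A - B) x).
  move=> x; rewrite mul1r; have /eqP := AB x; rewrite mulf_eq0.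
  rewrite /pos S => /orP[]/eqP E; rewrite E.
    by rewrite sub0r normrN ger0_norm// addNr mul0r.
  by rewrite subr0 ger0_norm//; field.
have pB : forall x, B x = pos (-1 * (A - B) x).
  move=> x; rewrite mulN1r; have /eqP := AB x; rewrite mulf_eq0.
  rewrite /pos S => /orP[]/eqP E; rewrite E.
    by rewrite sub0r opprK ger0_norm//; field.
  by rewrite subr0 normrN ger0_norm// addNr mul0r.
rewrite (simple_quasi_state_comp (@cpos 1) pA).
rewrite (simple_quasi_state_comp (@cpos (-1)) pB).
rewrite mul1r mulN1r /pos normrN; case: (leP 0 (zeta (A - B))) => h.
  by right; rewrite ger0_norm// addNr mul0r.
by left; rewrite ltr0_norm// subrr mul0r.
Qed.

(** Around a missed value (a, b), tents over [A] and [B] centred at [a] and [b] with a small radius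
    [d] have product zero, while [zeta] sends both to [d > 0]. The point depends on the pair; three
    functions need not have a common one. *)
Lemma simple_quasi_state_pair A B : compact [set: X] ->
  exists x, A x = zeta A /\ B x = zeta B.
Proof.
move=> cX; apply: contrapT => /forallNP nx.
set a := zeta A; set b := zeta B.
have cD (C : continuousType X R) (c : R) : continuous (fun x : X => `|C x - c| : R) /\
    forall d : R, continuous (fun t => pos (d - `|t - c|)) /\
    continuous (fun x => pos (d - `|C x - c|)).
  have cC : continuous (fun x : X => `|C x - c| : R).
    by move=> x; apply: cvg_norm; apply: cvgB; [exact: cts_fun|exact: cvg_cst].
  split => // d.
  have ct : continuous (fun t : R => pos (d - `|t - c|)).
    move=> t; have dt : d - `|y - c| @[y --> t] --> d - `|t - c|.
      apply: cvgB; first exact: cvg_cst.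
      by apply: cvg_norm; apply: cvgB; [exact: cvg_id|exact: cvg_cst].
    by apply: cvgMl; apply: cvgD => //; exact: cvg_norm.
  split => // x; apply: (@continuous_comp _ _ _ C (fun t => pos (d - `|t - c|))).
    exact: cts_fun.
  exact: ct.
pose D x : R := `|A x - a| + `|B x - b|.
have cDD : continuous D.
  by move=> x; apply: cvgD; [exact: (cD A a).1|exact: (cD B b).1].
have [x0 _] := simple_quasi_state_range A.
have [|m _ mD] := @compact_EVT_min _ R D setT _ cX (continuous_subspaceT cDD).
  by exists x0.
have Dm : 0 < D m.
  rewrite lt_neqAle addr_ge0// andbT eq_sym paddr_eq0// !normr_eq0 !subr_eq0.
  by apply/negP => /andP[/eqP ? /eqP ?]; exact: (nx m).
(* Half the minimum of [D]: at each point one of the two distances is at least [d], and the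
   corresponding tent vanishes. *)
pose d := D m / 2.
have d0 : 0 < d by rewrite divr_gt0.
pose A' := cfun_of ((cD A a).2 d).2.
pose B' := cfun_of ((cD B b).2 d).2.
have posd : pos d = d by rewrite /pos ger0_norm ?ltW//; field.
have pos0 t : 0 <= pos t.
  by rewrite divr_ge0//; have := ler_norm (- t); rewrite normrN; lra.
have neg0 t : t <= 0 -> pos t = 0.
  by move=> t0; rewrite /pos ler0_norm// subrr mul0r.
have zA : zeta A' = d.
  rewrite (simple_quasi_state_comp (F := A) (H := A') ((cD A a).2 d).1)//.
  by rewrite subrr normr0 subr0 posd.
have zB : zeta B' = d.
  rewrite (simple_quasi_state_comp (F := B) (H := B') ((cD B b).2 d).1)//.
  by rewrite subrr normr0 subr0 posd.
have [x|x|x||] := @simple_quasi_state_disjoint A' B'.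
- exact: pos0.
- exact: pos0.
- have dx : D m <= `|A x - a| + `|B x - b| by apply: mD; rewrite inE.
  have /orP[h|h] : (d <= `|A x - a|) || (d <= `|B x - b|).
    by apply/orP; case: (leP d `|A x - a|) => h; [by left|right]; move: h; rewrite /d; lra.
  + by rewrite (_ : A' x = 0) ?mul0r//; apply: neg0; rewrite subr_le0.
  + by rewrite (_ : B' x = 0) ?mulr0//; apply: neg0; rewrite subr_le0.
- by rewrite zA; lra.
- by rewrite zB; lra.
Qed.

End simple_quasi_states.

(** * Values taken by a pair of functions *)

Section triangle.
Context {X : topologicalType} {R : realType}.
Variable zeta : continuousType X R -> R.
Hypotheses (zeta_simple : simple_quasi_state zeta) (cX : compact [set: X]).
Implicit Types F G H : continuousType X R.

(* If (u, v) is missed by (F, G), the normalisation (f, g) of (F - u, G - v)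
   takes values in the unit circle, on which the three points found by
   [simple_quasi_state_pair] for (f, g), (f, f + g) and (g, f + g) cannot
   coexist. *)
Lemma simple_quasi_state_triangle F G (u v : R) :
  zeta F < u -> zeta G < v -> u + v < zeta (F + G) ->
  exists x, F x = u /\ G x = v.
Proof.
move=> Fu Gv uv; apply: contrapT => /forallNP nx.
pose r x : R := Num.sqrt ((F x - u) ^+ 2 + (G x - v) ^+ 2).
have r20 x : 0 < (F x - u) ^+ 2 + (G x - v) ^+ 2.
  rewrite lt_neqAle addr_ge0 ?sqr_ge0// andbT eq_sym paddr_eq0 ?sqr_ge0//.
  rewrite !sqrf_eq0 !subr_eq0; apply/negP => /andP[/eqP ? /eqP ?].
  exact: (nx x).
have r0 x : 0 < r x by rewrite sqrtr_gt0.
have cF : continuous (fun x => F x - u).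
  by move=> x; apply: cvgB; [exact: cts_fun|exact: cvg_cst].
have cG : continuous (fun x => G x - v).
  by move=> x; apply: cvgB; [exact: cts_fun|exact: cvg_cst].
have cr : continuous (fun x => (r x)^-1).
  move=> x; apply: cvgV; first by rewrite gt_eqF.
  apply: (@continuous_comp _ _ _ (fun x => (F x - u) ^+ 2 + (G x - v) ^+ 2)
    Num.sqrt); last exact: sqrt_continuous.
  by apply: cvgD; rewrite expr2; apply: cvgM;
    [exact: cF|exact: cF|exact: cG|exact: cG].
have cf : continuous (fun x => (F x - u) / r x).
  by move=> x; apply: cvgM; [exact: cF|exact: cr].
have cg : continuous (fun x => (G x - v) / r x).
  by move=> x; apply: cvgM; [exact: cG|exact: cr].
pose f := cfun_of cf; pose g := cfun_of cg.
have circ x : f x ^+ 2 + g x ^+ 2 = 1.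
  rewrite /f /g /= !exprMn -mulrDl exprVn sqr_sqrtr ?ltW// divff//.
  by rewrite gt_eqF.
(* [f] has the sign of [F - u] everywhere, and some point realises both [zeta F] and [zeta f]. *)
have fneg : zeta f < 0.
  have [x [Fx fx]] := simple_quasi_state_pair zeta_simple F f cX.
  by rewrite -fx /= pmulr_llt0 ?invr_gt0// Fx subr_lt0.
have gneg : zeta g < 0.
  have [x [Gx gx]] := simple_quasi_state_pair zeta_simple G g cX.
  by rewrite -gx /= pmulr_llt0 ?invr_gt0// Gx subr_lt0.
have fgpos : 0 < zeta (f + g).
  have [x [Sx sx]] := simple_quasi_state_pair zeta_simple (F + G) (f + g) cX.
  rewrite -sx (_ : (f + g) x = (F x - u + (G x - v)) / r x); last first.
    by rewrite mulrDl.
  by rewrite pmulr_lgt0 ?invr_gt0//; move: Sx; rewrite cfunDE; lra.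
have [x [fx gx]] := simple_quasi_state_pair zeta_simple f g cX.
have [y [fy sy]] := simple_quasi_state_pair zeta_simple f (f + g) cX.
have [z [gz sz]] := simple_quasi_state_pair zeta_simple g (f + g) cX.
move: (circ x) (circ y) (circ z); rewrite fx gx fy gz.
have -> : g y = zeta (f + g) - zeta f by rewrite -sy -fy cfunDE; ring.
have -> : f z = zeta (f + g) - zeta g by rewrite -sz -gz cfunDE; ring.
move: fneg gneg fgpos; move: (zeta f) (zeta g) (zeta (f + g)) => p q s.
move=> p0 q0 s0 e1 e2 e3.
(* The circle equations leave [s - p = q] or [s - p = - q]; the first contradicts the signs.
   Likewise [s - q = - p], and then [s = 0]. *)
have /eqP : (s - p + q) * (s - p - q) = 0.
  by apply: (@addrI _ (p ^+ 2 + q ^+ 2)); rewrite addr0 {2}e1 -e2; ring.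
rewrite mulf_eq0 => /orP[]/eqP h1; last lra.
have /eqP : (s - q + p) * (s - q - p) = 0.
  by apply: (@addrI _ (p ^+ 2 + q ^+ 2)); rewrite addr0 {2}e1 -e3; ring.
by rewrite mulf_eq0 => /orP[]/eqP h2; lra.
Qed.

End triangle.

(** * Parity of the number of zeros in a square *)

Section bisection.
Context {R : realType}.

Definition ccell (x y s : R) : set (R * R) :=
  [set z | x <= z.1 <= x + s /\ y <= z.2 <= y + s].

Lemma nested_segments (x l : R ^nat) :
  (forall n, x n <= x n.+1) -> (forall n, x n.+1 + l n.+1 <= x n + l n) ->
  (forall n, 0 <= l n) -> exists a, forall n, x n <= a <= x n + l n.
Proof.
move=> xS xlS l0.
have xD n m : x n <= x (n + m)%N.
  by elim: m => [|m IH]; rewrite ?addn0// addnS (le_trans IH).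
have xlD n m : x (n + m)%N + l (n + m)%N <= x n + l n.
  by elim: m => [|m IH]; rewrite ?addn0// addnS (le_trans _ IH).
have xub n m : x m <= x n + l n.
  apply: (@le_trans _ _ (x (maxn n m) + l (maxn n m))).
    apply: (@le_trans _ _ (x (maxn n m))); last by rewrite lerDl.
    by rewrite -(subnKC (leq_maxr n m)).
  by rewrite -(subnKC (leq_maxl n m)).
exists (sup (range x)) => n; apply/andP; split.
  apply: ub_le_sup; last by exists n.
  by exists (x 0%N + l 0%N) => _ [m _ <-].
apply: ge_sup; first by exists (x 0%N), 0%N.
by move=> _ [m _ <-].
Qed.

(** Compactness of the square as an induction principle. If [P] failed, some quarter would fail at
    every stage, and these quarters shrink to a point of the square, although [P] holds for all
    small squares containing that point. *)
Lemma bisection (P : R -> R -> R -> Prop) (x y s : R) : 0 < s ->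
  (forall x y s, 0 < s -> P x y (s / 2) -> P (x + s / 2) y (s / 2) ->
    P x (y + s / 2) (s / 2) -> P (x + s / 2) (y + s / 2) (s / 2) -> P x y s) ->
  (forall z, ccell x y s z -> exists2 d, 0 < d & forall x' y' s',
    0 < s' -> s' < d -> ccell x' y' s' z -> ccell x' y' s' `<=` ccell x y s ->
    P x' y' s') ->
  P x y s.
Proof.
move=> s0 Pstep Ploc; apply: contrapT => nP.
pose Q (c : R * R * R) := P c.1.1 c.1.2 c.2.
(* The conditions on [c] come after the existential so that [choice] gives a function on all
   triples; where they fail its value is irrelevant. *)
have next c : exists c', 0 < c.2 -> ~ Q c ->
    [/\ ~ Q c', c'.2 = c.2 / 2, c.1.1 <= c'.1.1 <= c.1.1 + c.2 / 2 &
      c.1.2 <= c'.1.2 <= c.1.2 + c.2 / 2].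
  case: c => -[a b] r /=; have [r0|r0] := ltP 0 r; last by exists (a, b, r).
  have [q|nq] := pselect (Q (a, b, r)); first by exists (a, b, r).
  have r2 : 0 <= r / 2 by rewrite divr_ge0// ltW.
  have [q1|q1] := pselect (Q (a, b, r / 2)); last first.
    by exists (a, b, r / 2) => _ _; split; rewrite //= lexx lerDl.
  have [q2|q2] := pselect (Q (a + r / 2, b, r / 2)); last first.
    by exists (a + r / 2, b, r / 2) => _ _; split; rewrite //= lexx lerDl ?r2.
  have [q3|q3] := pselect (Q (a, b + r / 2, r / 2)); last first.
    by exists (a, b + r / 2, r / 2) => _ _; split; rewrite //= lexx lerDl ?r2.
  have [q4|q4] := pselect (Q (a + r / 2, b + r / 2, r / 2)); last first.
    exists (a + r / 2, b + r / 2, r / 2) => _ _.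
    by split; rewrite //= lexx lerDl ?r2.
  by exfalso; apply: nq; exact: Pstep.
have [f fP] := choice next.
pose c n := iter n f (x, y, s).
have cE1 n : c n.+1 = f (c n) by [].
have c0 n : 0 < (c n).2 /\ ~ Q (c n).
  elim: n => [|n [IH1 IH2]]; first by split.
  by have [h1 h2 _ _] := fP _ IH1 IH2; rewrite cE1; split => //; rewrite h2 divr_gt0.
have cS n : [/\ (c n.+1).2 = (c n).2 / 2,
    (c n).1.1 <= (c n.+1).1.1 <= (c n).1.1 + (c n).2 / 2 &
    (c n).1.2 <= (c n.+1).1.2 <= (c n).1.2 + (c n).2 / 2].
  by have [h1 h2] := c0 n; have [] := fP _ h1 h2.
have [a aP] := @nested_segments (fun n => (c n).1.1) (fun n => (c n).2)
  (fun n => ltac:(by have [_ /andP[]] := cS n))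
  (fun n => ltac:(by have [-> /andP[] ] := cS n; lra))
  (fun n => ltW (c0 n).1).
have [b bP] := @nested_segments (fun n => (c n).1.2) (fun n => (c n).2)
  (fun n => ltac:(by have [_ _ /andP[]] := cS n))
  (fun n => ltac:(by have [-> _ /andP[] ] := cS n; lra))
  (fun n => ltW (c0 n).1).
have [|d d0 dP] := Ploc (a, b); first by split; [exact: (aP 0%N)|exact: (bP 0%N)].
have cE n : (c n).2 = s / 2 ^+ n.
  elim: n => [|n IH]; first by rewrite expr0 divr1.
  by have [-> _ _] := cS n; rewrite IH exprSr; field; rewrite expf_neq0.
have csub n : ccell (c n).1.1 (c n).1.2 (c n).2 `<=` ccell x y s.
  elim: n => [//|n IH]; apply: (subset_trans _ IH) => z [].
  have [-> ] := cS n; have := (c0 n).1.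
  by move=> ? /andP[? ?] /andP[? ?] /andP[? ?] /andP[? ?]; split; lra.
have [n nd] : exists n, (c n).2 < d.
  have /archi_boundP : 0 <= s / d by rewrite divr_ge0 ?ltW.
  set n := Num.bound _ => nP'; exists n; rewrite cE ltr_pdivrMr ?exprn_gt0//.
  rewrite mulrC -ltr_pdivrMr//; apply: (lt_trans nP').
  by rewrite -natrX ltr_nat ltn_expl.
apply: (c0 n).2; by apply: dP => //; exact: (c0 n).1.
Qed.

End bisection.

(** * Crossings of a ray by subdivided polygons *)

Section crossing_parity.
Context {R : realType}.
Implicit Types (a b c d p q u v w z : R * R) (f g : R * R -> R * R).

(* Does the segment [a, b] cross the ray {0} x ]0, +oo[ ? *)
Definition crosses a b : bool :=
  [&& a.1 < 0, 0 <= b.1 & 0 < a.2 * b.1 - a.1 * b.2] ||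
  [&& b.1 < 0, 0 <= a.1 & 0 < b.2 * a.1 - b.1 * a.2].

Lemma crossesC a b : crosses a b = crosses b a.
Proof. by rewrite /crosses orbC. Qed.

(** On the half-plane where the form [w] is positive, this function changes between the ends of a
    segment exactly when the segment crosses the ray. *)
Definition crossing_potential (w a : R * R) := (0 < w.2) && (a.1 < 0).

Lemma crosses_halfplane w a b :
  0 < w.1 * a.1 + w.2 * a.2 -> 0 < w.1 * b.1 + w.2 * b.2 ->
  crosses a b = crossing_potential w a (+) crossing_potential w b.
Proof.
move=> wa wb.
have key c d : c.1 < 0 -> 0 <= d.1 -> 0 < w.1 * c.1 + w.2 * c.2 ->
    0 < w.1 * d.1 + w.2 * d.2 -> (0 < c.2 * d.1 - c.1 * d.2) = (0 < w.2).
  move=> c0 d0 wc wd.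
  have : 0 < w.2 * (c.2 * d.1 - c.1 * d.2).
    rewrite (_ : _ * _ = d.1 * (w.1 * c.1 + w.2 * c.2) +
      - c.1 * (w.1 * d.1 + w.2 * d.2)); last by ring.
    by rewrite ltr_wpDl// ?mulr_ge0 ?mulr_gt0 ?oppr_gt0// ltW.
  case: (ltrgt0P w.2) => w2.
  - by rewrite pmulr_rgt0.
  - by rewrite nmulr_rgt0// => /ltW; rewrite leNgt => /negbTE.
  - by rewrite w2 mul0r ltxx.
rewrite /crosses /crossing_potential.
case: (ltP a.1 0) => a0; case: (ltP b.1 0) => b0 //=.
- by rewrite addbb.
- by rewrite andbT andbF orbF key// addbF.
- by rewrite key// andbT andbF.
- by rewrite andbF.
Qed.

(** [w] retains only the coordinate of [a] that is largest in absolute value; the norm being the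
    maximum norm, this coordinate keeps its sign on the ball. *)
Lemma ball_halfplane a : a != 0 -> exists w, forall b, `|b - a| < `|a| ->
  0 < w.1 * b.1 + w.2 * b.2.
Proof.
move=> a0.
have h (s t : R) : s != 0 -> `|t - s| < `|s| -> 0 < s * t.
  move=> s0; case: (ltrgt0P s) (s0) => // ss _.
    by rewrite ltr_norml => /andP[? _]; rewrite mulr_gt0//; lra.
  by rewrite ltr_norml => /andP[_ ?]; rewrite nmulr_rgt0//; lra.
have na : `|a| = Num.max `|a.1| `|a.2| by exact: prod_normE.
have nz : 0 < `|a| by rewrite normr_gt0.
have bnd b : `|b.1 - a.1| <= `|b - a| /\ `|b.2 - a.2| <= `|b - a|.
  by rewrite [X in _ <= X]prod_normE/=; split; rewrite le_max lexx ?orbT.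
case: (leP `|a.1| `|a.2|) => le12.
  have E : `|a| = `|a.2| by rewrite na; apply/max_idPr.
  exists (0, a.2) => b ba /=; rewrite mul0r add0r; apply: h.
    by rewrite -normr_gt0 -E.
  by rewrite -E; exact: le_lt_trans (bnd b).2 ba.
have E : `|a| = `|a.1| by rewrite na; apply/max_idPl; exact: ltW.
exists (a.1, 0) => b ba /=; rewrite mul0r addr0; apply: h.
  by rewrite -normr_gt0 -E.
by rewrite -E; exact: le_lt_trans (bnd b).1 ba.
Qed.

Definition midpoint p q : R * R := ((p.1 + q.1) / 2, (p.2 + q.2) / 2).

(** The polygon through the images of the dyadic division points of [p, q] is tested piece by piece.
    Around a square, for [f] continuous and without zeros on the boundary and for [n] large, the
    total is the mod 2 winding number about 0. *)
Fixpoint side_parity f n p q : bool :=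
  if n is n'.+1 then
    side_parity f n' p (midpoint p q) (+) side_parity f n' (midpoint p q) q
  else crosses (f p) (f q).

Definition boundary_parity f n (x y s : R) : bool :=
  side_parity f n (x, y) (x + s, y) (+)
  side_parity f n (x + s, y) (x + s, y + s) (+)
  side_parity f n (x + s, y + s) (x, y + s) (+)
  side_parity f n (x, y + s) (x, y).

Fixpoint cells_parity f n (x y s : R) : bool :=
  if n is n'.+1 then
    cells_parity f n' x y (s / 2) (+)
    cells_parity f n' (x + s / 2) y (s / 2) (+)
    cells_parity f n' x (y + s / 2) (s / 2) (+)
    cells_parity f n' (x + s / 2) (y + s / 2) (s / 2)
  else boundary_parity f 0 x y s.

Lemma side_parityC f n p q : side_parity f n p q = side_parity f n q p.
Proof.
elim: n p q => [|n IH] p q /=; first exact: crossesC.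
have -> : midpoint q p = midpoint p q by rewrite /midpoint !(addrC q.1) !(addrC q.2).
by rewrite addbC (IH p) (IH q).
Qed.

(** The inner sides of the subdivision are counted twice and cancel. *)
Lemma cells_parity_boundary f n x y s :
  cells_parity f n x y s = boundary_parity f n x y s.
Proof.
elim: n x y s => [//|n IH] x y s; rewrite [LHS]/= !IH /boundary_parity /=.
rewrite /midpoint /=.
have E (t : R) : (t + (t + s)) / 2 = t + s / 2 by field.
have E' (t : R) : (t + s + t) / 2 = t + s / 2 by field.
have E'' (t : R) : (t + t) / 2 = t by field.
have H (t : R) : t + s / 2 + s / 2 = t + s by field.
rewrite !E !E' !E'' !H.
set m := (x + s / 2, y + s / 2).
rewrite (side_parityC _ _ m (x + s / 2, y)) (side_parityC _ _ m (x, y + s / 2)).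
rewrite (side_parityC _ _ m (x + s / 2, y + s)) (side_parityC _ _ m (x + s, y + s / 2)).
move: (side_parity _ _ _ m) (side_parity _ _ _ m) (side_parity _ _ _ m) (side_parity _ _ _ m).
do 8 move: (side_parity _ _ _ _).
move=> s0 s1 s2 s3 s4 s5 s6 s7 s8 s9 s10 s11.
(* [s8] to [s11] are the inner sides; the others are the halves of the four outer sides. *)
transitivity (s7 (+) s5 (+) (s4 (+) s1) (+) (s0 (+) s3) (+) (s2 (+) s6) (+)
    ((s8 (+) s8) (+) (s9 (+) s9) (+) (s10 (+) s10) (+) (s11 (+) s11))).
  by rewrite [LHS](AC ((4*4)*4*4)
    ((1*5*(6*14)*(15*11)*(12*4)) * ((10*16)*(7*13)*(3*9)*(2*8)))).
by rewrite !addbb !addbF.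
Qed.

(** By [cells_parity_boundary] only division points of the boundary matter. Each side is stable
    under midpoints, so the induction stays on it. *)
Lemma cells_parity_eq f g n x y s :
  (forall u, ccell x y s u -> u.1 = x \/ u.1 = x + s \/ u.2 = y \/ u.2 = y + s ->
    f u = g u) -> 0 <= s ->
  cells_parity f n x y s = cells_parity g n x y s.
Proof.
move=> fg s0; rewrite !cells_parity_boundary /boundary_parity.
have sideE (S : set (R * R)) p q : (forall u v, S u -> S v -> S (midpoint u v)) ->
    (forall u, S u -> f u = g u) -> S p -> S q ->
    side_parity f n p q = side_parity g n p q.
  move=> Sm SE; elim: n p q => [|k IH] p q Sp Sq /=; first by rewrite !SE.
  by rewrite !IH//; exact: Sm.
rewrite /ccell /= in fg.
rewrite (sideE [set u | x <= u.1 <= x + s /\ u.2 = y]); first 5 last.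
- rewrite (sideE [set u | u.1 = x + s /\ y <= u.2 <= y + s]); first 5 last.
  + rewrite (sideE [set u | x <= u.1 <= x + s /\ u.2 = y + s]); first 5 last.
    * rewrite (sideE [set u | u.1 = x /\ y <= u.2 <= y + s])//=.
      - by move=> u v [-> ?] [-> ?]; split; lra.
      - by move=> u [h1 h2]; apply: fg; [split; lra|left].
      - by split; lra.
      - by split; lra.
    * by move=> u v [? h1] [? h2]; rewrite /= h1 h2; split; lra.
    * by move=> u [h1 h2]; apply: fg; [split; lra|right; right; right].
    * by split => /=; lra.
    * by split => /=; lra.
  + by move=> u v [h1 ?] [h2 ?]; rewrite /= h1 h2; split; lra.
  + by move=> u [h1 h2]; apply: fg; [split; lra|right; left].
  + by split => /=; lra.
  + by split => /=; lra.
- by move=> u v [? h1] [? h2]; rewrite /= h1 h2; split; lra.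
- by move=> u [h1 h2]; apply: fg; [split; lra|right; right; left].
- by split => /=; lra.
- by split => /=; lra.
Qed.

(** Around each small cell the potentials of [crosses_halfplane] cancel in pairs. *)
Lemma cells_parity_halfplane f n x y s w : 0 <= s ->
  (forall u, ccell x y s u -> 0 < w.1 * (f u).1 + w.2 * (f u).2) ->
  cells_parity f n x y s = false.
Proof.
elim: n x y s => [|n IH] x y s s0 fw /=.
  rewrite /boundary_parity /=.
  rewrite !(@crosses_halfplane w) ?fw//; try by split => /=; lra.
  by do 4 move: (crossing_potential _ _); move=> [] [] [] [].
by rewrite !IH //; try (by lra); move=> u [? ?]; apply: fw; split; lra.
Qed.

(** [(a, b, c, d)] stands for the matrix with rows (a, b) and (c, d). *)
Definition linear_map (k : R * R * R * R) (h : R * R) : R * R :=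
  (k.1.1.1 * h.1 + k.1.1.2 * h.2, k.1.2 * h.1 + k.2 * h.2).

Definition linear_det (k : R * R * R * R) := k.1.1.1 * k.2 - k.1.1.2 * k.1.2.

(** The cross products of consecutive image vertices all have the same sign, fixed by the
    determinant: the image polygon turns about 0 in one sense. A side thus crosses the ray exactly
    when it passes the vertical axis in one particular direction, and this happens once. *)
Lemma cells_parity_linear0 k x y s z : linear_det k != 0 ->
  x < z.1 < x + s -> y < z.2 < y + s ->
  boundary_parity (fun u => linear_map k (u - z)) 0 x y s = true.
Proof.
case: k => [[[a b] c] d]; rewrite /linear_det /= => D0 zx zy.
rewrite /boundary_parity /= /linear_map /crosses /=.
have : exists p p' q q' : R, [/\ 0 < p, 0 < p', 0 < q & 0 < q'] /\
    [/\ x - z.1 = - p, x + s - z.1 = p', y - z.2 = - q & y + s - z.2 = q'].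
  exists (z.1 - x), (x + s - z.1), (z.2 - y), (y + s - z.2).
  by split; split; lra.
move=> [p [p' [q [q' [[p0 p'0 q0 q'0] [-> -> -> ->]]]]]].
pose D := a * d - b * c.
have e1 : (c * - p + d * - q) * (a * p' + b * - q) -
    (a * - p + b * - q) * (c * p' + d * - q) = - (D * (q * (p + p'))).
  by rewrite /D; ring.
have e2 : (c * p' + d * - q) * (a * p' + b * q') -
    (a * p' + b * - q) * (c * p' + d * q') = - (D * (p' * (q + q'))).
  by rewrite /D; ring.
have e3 : (c * p' + d * q') * (a * - p + b * q') -
    (a * p' + b * q') * (c * - p + d * q') = - (D * (q' * (p + p'))).
  by rewrite /D; ring.
have e4 : (c * - p + d * q') * (a * - p + b * - q) -
    (a * - p + b * q') * (c * - p + d * - q) = - (D * (p * (q + q'))).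
  by rewrite /D; ring.
have swap (s1 s2 t1 t2 e : R) : s2 * t1 - s1 * t2 = - e -> t2 * s1 - t1 * s2 = e.
  by move=> h; rewrite -[e]opprK -h; ring.
rewrite e1 e2 e3 e4 (swap _ _ _ _ _ e1) (swap _ _ _ _ _ e2) (swap _ _ _ _ _ e3).
rewrite (swap _ _ _ _ _ e4) {e1 e2 e3 e4 swap}.
have m1 : 0 < q * (p + p') by rewrite mulr_gt0 ?addr_gt0.
have m2 : 0 < p' * (q + q') by rewrite mulr_gt0 ?addr_gt0.
have m3 : 0 < q' * (p + p') by rewrite mulr_gt0 ?addr_gt0.
have m4 : 0 < p * (q + q') by rewrite mulr_gt0 ?addr_gt0.
rewrite !oppr_gt0 !(pmulr_llt0 _ m1) !(pmulr_llt0 _ m2) !(pmulr_llt0 _ m3) !(pmulr_llt0 _ m4).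
rewrite !(pmulr_lgt0 _ m1) !(pmulr_lgt0 _ m2) !(pmulr_lgt0 _ m3) !(pmulr_lgt0 _ m4).
have ab0 : ~ (a = 0 /\ b = 0) by move=> [a0 b0]; move: D0; rewrite a0 b0 !mul0r subrr eqxx.
rewrite !mulrN.
have Dn0 : (0 < D) || (D < 0) by rewrite orbC -neq_lt.
have sg (e r r' : R) : 0 < r -> 0 < r' -> [\/ [/\ e = 0, e * r = 0 & e * r' = 0],
    0 < e * r /\ 0 < e * r' | e * r < 0 /\ e * r' < 0].
  move=> r0 r'0; case: (ltrgt0P e) => e0.
  - by apply: Or32; rewrite !mulr_gt0.
  - by apply: Or33; rewrite !nmulr_rlt0.
  - by apply: Or31; rewrite e0 !mul0r.
have a0 := sg a _ _ p0 p'0; have b0 := sg b _ _ q0 q'0.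
have nn : [/\ a = 0, a * p = 0 & a * p' = 0] -> [/\ b = 0, b * q = 0 & b * q' = 0] -> False.
  by move=> [? _ _] [? _ _]; exact: ab0.
move: a0 b0 nn Dn0; rewrite -/D.
move: (a * p) (a * p') (b * q) (b * q') => P P' Q Q' a0 b0 nn Dn0.
(* The first coordinates of the four image vertices are not all negative, not all nonnegative and
   not alternating; going round, the sign changes exactly twice, once in each direction. *)
have : [/\ ~~ [&& - P - Q < 0, P' - Q < 0, P' + Q' < 0 & - P + Q' < 0],
    ~~ [&& 0 <= - P - Q, 0 <= P' - Q, 0 <= P' + Q' & 0 <= - P + Q'],
    ~~ [&& - P - Q < 0, 0 <= P' - Q, P' + Q' < 0 & 0 <= - P + Q'] &
    ~~ [&& 0 <= - P - Q, P' - Q < 0, 0 <= P' + Q' & - P + Q' < 0]].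
  move=> {D0 m1 m2 m3 m4 p0 p'0 q0 q'0 zx zy Dn0 sg ab0}.
  case: a0 => [[? ? ?]|[? ?]|[? ?]]; case: b0 => [[? ? ?]|[? ?]|[? ?]];
    try (by exfalso; apply: nn); split; apply/negP => /and4P[? ? ? ?]; lra.
rewrite !leNgt.
case/orP: Dn0 => D1; rewrite D1 (lt_gtF D1) !andbT !andbF /=;
  by case: (- P - Q < 0); case: (P' - Q < 0); case: (P' + Q' < 0);
    case: (- P + Q' < 0); case.
Qed.
End crossing_parity.

(** * Comparison with the linear part at a regular zero *)

Section regular_zeros.
Context {R : realType}.
Implicit Types (a b c d p q u v w z : R * R) (f g : R * R -> R * R) (k : R * R * R * R).

Lemma pair_norm1 a : `|a.1| <= `|a|.
Proof. by rewrite [X in _ <= X]prod_normE/= le_max lexx. Qed.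

Lemma pair_norm2 a : `|a.2| <= `|a|.
Proof. by rewrite [X in _ <= X]prod_normE/= le_max lexx orbT. Qed.

Lemma pair_norm_le a (e : R) : `|a.1| <= e -> `|a.2| <= e -> `|a| <= e.
Proof. by move=> h1 h2; rewrite prod_normE/= ge_max h1. Qed.

Definition linear_norm k : R := `|k.1.1.1| + `|k.1.1.2| + `|k.1.2| + `|k.2| + 1.

Lemma linear_norm_gt0 k : 0 < linear_norm k.
Proof. by rewrite ltr_wpDl// !addr_ge0. Qed.

Lemma linear_map_le k h : `|linear_map k h| <= linear_norm k * `|h|.
Proof.
case: k => [[[a b] c] d]; have h1 := pair_norm1 h; have h2 := pair_norm2 h.
have M (s t : R) : `|t| <= `|h| -> `|s * t| <= `|s| * `|h|.
  by move=> th; rewrite normrM ler_wpM2l.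
have [? ? ? ?] : [/\ 0 <= `|a| * `|h|, 0 <= `|b| * `|h|, 0 <= `|c| * `|h| & 0 <= `|d| * `|h|].
  by split; rewrite mulr_ge0.
have := normr_ge0 h => ?.
apply: pair_norm_le; rewrite /linear_map /linear_norm /= !mulrDl mul1r.
  by apply: (le_trans (ler_normD _ _)); have := M a _ h1; have := M b _ h2; lra.
by apply: (le_trans (ler_normD _ _)); have := M c _ h1; have := M d _ h2; lra.
Qed.

(** The adjugate of [k] sends [linear_map k h] to the determinant times [h], and its entries are
    those of [k] up to sign and order. *)
Lemma linear_map_ge k h :
  `|linear_det k| * `|h| <= linear_norm k * `|linear_map k h|.
Proof.
case: k => [[[a b] c] d]; set z := linear_map _ h.
have h1 := pair_norm1 z; have h2 := pair_norm2 z.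
have M (s t : R) : `|t| <= `|z| -> `|s * t| <= `|s| * `|z|.
  by move=> th; rewrite normrM ler_wpM2l.
have [? ? ? ?] : [/\ 0 <= `|a| * `|z|, 0 <= `|b| * `|z|, 0 <= `|c| * `|z| & 0 <= `|d| * `|z|].
  by split; rewrite mulr_ge0.
have := normr_ge0 z => ?.
rewrite (_ : `|linear_det _| * _ = `|linear_det (a, b, c, d) *: h|); last by rewrite normrZ.
apply: pair_norm_le; rewrite /linear_norm /= !mulrDl mul1r.
  rewrite (_ : _ *: _ = d * z.1 - b * z.2); last first.
    by rewrite /z /linear_map /linear_det /= /GRing.scale/=; ring.
  apply: (le_trans (ler_normB _ _)).
  by have := M d _ h1; have := M b _ h2; lra.
rewrite (_ : _ *: _ = a * z.2 - c * z.1); last first.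
  by rewrite /z /linear_map /linear_det /= /GRing.scale/=; ring.
apply: (le_trans (ler_normB _ _)).
by have := M a _ h2; have := M c _ h1; lra.
Qed.

Lemma linear_mapB k u v : linear_map k (u - v) = linear_map k u - linear_map k v.
Proof. by rewrite /linear_map /=; congr pair => /=; ring. Qed.

(** [t] is no dyadic division point of [x, x + s], at any depth. A zero in the square whose
    coordinates are both off the grid lies in exactly one cell of each subdivision. *)
Definition offgrid (x s t : R) := forall m j : nat, t != x + s * j%:R / 2 ^+ m.

Lemma offgrid_left x s t : offgrid x s t -> offgrid x (s / 2) t.
Proof.
move=> h m j; apply: contra (h m.+1 j) => /eqP ->; apply/eqP.
by rewrite exprS; field; rewrite expf_neq0.
Qed.

Lemma offgrid_right x s t : offgrid x s t -> offgrid (x + s / 2) (s / 2) t.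
Proof.
move=> h m j; apply: contra (h m.+1 (2 ^ m + j)%N) => /eqP ->; apply/eqP.
by rewrite exprS natrD natrX; field; rewrite expf_neq0.
Qed.

Lemma offgrid_mid x s t : offgrid x s t -> t != x + s / 2.
Proof. by move=> /(_ 1%N 1%N); rewrite expr1 mulr1. Qed.

Lemma offgrid_lt x s t : offgrid x s t -> x <= t <= x + s -> x < t < x + s.
Proof.
move=> h; have := h 0%N 0%N; have := h 0%N 1%N.
rewrite expr0 !divr1 mulr0 addr0 mulr1 => h1 h0.
by rewrite !le_eqVlt eq_sym (negbTE h0) (negbTE h1).
Qed.

(** One quarter contains [z] in its interior and is treated by induction. Each of the other three
    lies on one side of a coordinate line through [z]; the form [w] that detects this side after
    applying [k] is a row of the adjugate, times plus or minus the determinant. *)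
Lemma cells_parity_linear k n (x y s : R) z : linear_det k != 0 -> 0 < s ->
  x <= z.1 <= x + s -> y <= z.2 <= y + s -> offgrid x s z.1 -> offgrid y s z.2 ->
  cells_parity (fun u => linear_map k (u - z)) n x y s = true.
Proof.
move=> D0; elim: n x y s => [|n IH] x y s s0 zx zy gx gy.
  by apply: cells_parity_linear0 => //; exact: offgrid_lt.
have far (a b r : R) : 0 <= r -> (a + r < z.1 \/ z.1 < a) \/ (b + r < z.2 \/ z.2 < b) ->
    cells_parity (fun u => linear_map k (u - z)) n a b r = false.
  move=> r0.
  have D2 : 0 < linear_det k ^+ 2 by rewrite lt_neqAle sqr_ge0 eq_sym sqrf_eq0 D0.
  move=> [[h|h]|[h|h]].
  - apply: (@cells_parity_halfplane _ _ _ _ _ _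
      (- linear_det k * k.2, linear_det k * k.1.1.2)) => // u [u1 u2] /=.
    rewrite (_ : _ + _ = linear_det k ^+ 2 * (z.1 - u.1)); first by rewrite mulr_gt0//; lra.
    by rewrite /linear_map /linear_det /=; ring.
  - apply: (@cells_parity_halfplane _ _ _ _ _ _
      (linear_det k * k.2, - linear_det k * k.1.1.2)) => // u [u1 u2] /=.
    rewrite (_ : _ + _ = linear_det k ^+ 2 * (u.1 - z.1)); first by rewrite mulr_gt0//; lra.
    by rewrite /linear_map /linear_det /=; ring.
  - apply: (@cells_parity_halfplane _ _ _ _ _ _
      (linear_det k * k.1.2, - linear_det k * k.1.1.1)) => // u [u1 u2] /=.
    rewrite (_ : _ + _ = linear_det k ^+ 2 * (z.2 - u.2)); first by rewrite mulr_gt0//; lra.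
    by rewrite /linear_map /linear_det /=; ring.
  - apply: (@cells_parity_halfplane _ _ _ _ _ _
      (- linear_det k * k.1.2, linear_det k * k.1.1.1)) => // u [u1 u2] /=.
    rewrite (_ : _ + _ = linear_det k ^+ 2 * (u.2 - z.2)); first by rewrite mulr_gt0//; lra.
    by rewrite /linear_map /linear_det /=; ring.
rewrite /=; have r0 : 0 <= s / 2 by rewrite divr_ge0// ltW.
have r1 : 0 < s / 2 by rewrite divr_gt0.
have := offgrid_mid gx; have := offgrid_mid gy.
rewrite !neq_lt => /orP[y1|y1] /orP[x1|x1].
- rewrite IH//; try (by lra); try exact: offgrid_left.
  by rewrite !far//; first [by left; left|by left; right|by right; left|by right; right].
- rewrite (IH (x + s / 2) y)//; try (by lra); try exact: offgrid_left; try exact: offgrid_right.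
  by rewrite !far//; first [by left; left|by left; right|by right; left|by right; right].
- rewrite (IH x (y + s / 2))//; try (by lra); try exact: offgrid_left; try exact: offgrid_right.
  by rewrite !far//; first [by left; left|by left; right|by right; left|by right; right].
- rewrite (IH (x + s / 2) (y + s / 2))//; try (by lra); try exact: offgrid_right.
  by rewrite !far//; first [by left; left|by left; right|by right; left|by right; right].
Qed.

(** For close [u], [v] the quadrilateral [f u], [f v], [g v], [g u] has even parity. Glued along the
    side, these quadrilaterals share their rungs, which cancel but for the two at the ends. *)
Lemma side_parity_close (S : set (R * R)) f g (r : R) n p q :
  (forall u v, S u -> S v -> S (midpoint u v)) ->
  (forall u v, S u -> S v -> `|u - v| <= r ->
    crosses (f u) (f v) (+) crosses (g u) (g v) =
    crosses (f u) (g u) (+) crosses (f v) (g v)) ->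
  S p -> S q -> `|p - q| <= 2 ^+ n * r ->
  side_parity f n p q (+) side_parity g n p q =
  crosses (f p) (g p) (+) crosses (f q) (g q).
Proof.
move=> Sm fg; elim: n p q => [|n IH] p q Sp Sq pq /=.
  by apply: fg => //; rewrite expr0 mul1r in pq.
have E1 : p - midpoint p q = 2^-1 *: (p - q).
  by rewrite /midpoint; congr pair; rewrite /= /GRing.scale /=; field.
have E2 : midpoint p q - q = 2^-1 *: (p - q).
  by rewrite /midpoint; congr pair; rewrite /= /GRing.scale /=; field.
have h : `|2^-1 *: (p - q)| <= 2 ^+ n * r.
  by rewrite normrZ gtr0_norm ?invr_gt0// mulrC ler_pdivrMr// mulrAC -exprSr.
set m := midpoint p q.
have Em : S m by exact: Sm.
rewrite (AC (2*2) ((1*3)*(2*4))) /= IH// ?E1// IH// ?E2//.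
by rewrite (AC (2*2) ((1*4)*(2*3))) /= addbb addbF.
Qed.

(** On the boundary of the square [f] is closer to the linear map than the linear map is to 0, so
    both boundary polygons have the same parity, as in Rouche's theorem. *)
Lemma cells_parity_regular_zero f k (x y s : R) z : linear_det k != 0 -> 0 < s ->
  x <= z.1 <= x + s -> y <= z.2 <= y + s -> offgrid x s z.1 -> offgrid y s z.2 ->
  (forall u, ccell x y s u ->
    8 * `|f u - linear_map k (u - z)| <= `|linear_map k (u - z)|) ->
  exists n0, forall n, (n0 <= n)%N -> cells_parity f n x y s = true.
Proof.
move=> D0 s0 zx zy gx gy fL.
have zx' := offgrid_lt gx zx; have zy' := offgrid_lt gy zy.
have [rho [rho0 r1 r2 r3 r4]] : exists rho : R, [/\ 0 < rho, rho <= z.1 - x,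
    rho <= x + s - z.1, rho <= z.2 - y & rho <= y + s - z.2].
  exists (Num.min (Num.min (z.1 - x) (x + s - z.1)) (Num.min (z.2 - y) (y + s - z.2))).
  split; last 4 first; rewrite ?ge_min ?lexx ?orbT//.
  by rewrite !lt_min; apply/andP; split; apply/andP; split; lra.
set L := fun u => linear_map k (u - z).
set N := linear_norm k; have N0 : 0 < N by exact: linear_norm_gt0.
(* Points of the boundary are at least [rho] away from [z], so [mu] bounds the linear map from below
   there. Below, [r] is such that the linear map moves by at most [mu / 8] over a distance [r]. *)
pose mu := `|linear_det k| * rho / N.
have D0' : 0 < `|linear_det k| by rewrite normr_gt0.
have mu0 : 0 < mu by rewrite !mulr_gt0 ?invr_gt0.
have Lmu u : rho <= `|u - z| -> mu <= `|L u|.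
  move=> h; rewrite ler_pdivrMr// [leRHS]mulrC; apply: le_trans (linear_map_ge _ _).
  by rewrite ler_wpM2l.
pose r := mu / (8 * N).
have r0 : 0 < r by rewrite divr_gt0// mulr_gt0.
pose T (S : set (R * R)) := (forall u v, S u -> S v -> S (midpoint u v)) /\
  (forall u, S u -> ccell x y s u /\ rho <= `|u - z|).
have TP S : T S -> forall u v, S u -> S v -> `|u - v| <= r ->
    crosses (f u) (f v) (+) crosses (L u) (L v) =
    crosses (f u) (L u) (+) crosses (f v) (L v).
  move=> [_ SP] u v Su Sv uv.
  have [Cu zu] := SP _ Su; have [Cv zv] := SP _ Sv.
  have Lu := Lmu _ zu; have fu := fL _ Cu; have fv := fL _ Cv.
  have Luv : 8 * `|L v - L u| <= `|L u|.
    apply: le_trans Lu; rewrite /L -linear_mapB.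
    rewrite (_ : v - z - (u - z) = - (u - v)); last by rewrite (opprB u z) (opprB u v) addrA subrK.
    have := linear_map_le k (- (u - v)); rewrite normrN.
    have : N * `|u - v| <= N * r by rewrite ler_wpM2l// ltW.
    have -> : N * r = mu / 8 by rewrite /r; field; rewrite gt_eqF.
    by rewrite -/N; lra.
  have LuN0 : 0 < `|L u| by exact: lt_le_trans Lu.
  (* With errors of one eighth, [L v], [f u] and [f v] are all closer to [L u] than 0 is, so one
     half-plane contains the four points. *)
  have [|w wP] := @ball_halfplane _ (L u); first by rewrite -normr_gt0.
  have w1 : 0 < w.1 * (L u).1 + w.2 * (L u).2 by apply: wP; rewrite subrr normr0.
  have w2 : 0 < w.1 * (L v).1 + w.2 * (L v).2 by apply: wP; lra.
  have w3 : 0 < w.1 * (f u).1 + w.2 * (f u).2 by apply: wP; rewrite -/(L u) in fu; lra.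
  have w4 : 0 < w.1 * (f v).1 + w.2 * (f v).2.
    apply: wP; have := ler_normD (f v - L v) (L v - L u).
    rewrite addrA subrK; have := ler_normD (L v - L u) (L u); rewrite subrK.
    by rewrite -/(L v) in fv; lra.
  rewrite !(@crosses_halfplane _ w)//.
  by do 4 move: (crossing_potential _ _); move=> [] [] [] [].
have [n0 n0P] : exists n0, s <= 2 ^+ n0 * r.
  have /archi_boundP : 0 <= s / r by rewrite divr_ge0// ltW.
  set n := Num.bound _ => nP'; exists n; rewrite -ler_pdivrMr//.
  by apply/ltW/(lt_trans nP'); rewrite -natrX ltr_nat ltn_expl.
exists n0 => n n0n.
have side p q S : T S -> S p -> S q -> `|p - q| <= s ->
    side_parity f n p q (+) side_parity L n p q =
    crosses (f p) (L p) (+) crosses (f q) (L q).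
  move=> TS Sp Sq pq; apply: (@side_parity_close S _ _ r) => //; first exact: TS.1.
    exact: TP.
  apply: (le_trans pq); apply: (le_trans n0P); apply: (ler_wpM2r (ltW r0)).
  by rewrite ler_eXn2l// ltr1n.
have dist1 u : rho <= `|u.1 - z.1| -> rho <= `|u - z|.
  by move=> h; exact: le_trans (pair_norm1 (u - z)).
have dist2 u : rho <= `|u.2 - z.2| -> rho <= `|u - z|.
  by move=> h; exact: le_trans (pair_norm2 (u - z)).
have nle (t : R) : rho <= t \/ rho <= - t -> rho <= `|t|.
  move=> [h|h]; first exact: le_trans (ler_norm _).
  by rewrite -normrN; exact: le_trans (ler_norm _).
have e1 : side_parity f n (x, y) (x + s, y) (+) side_parity L n (x, y) (x + s, y) = 
    crosses (f (x, y)) (L (x, y)) (+) crosses (f (x + s, y)) (L (x + s, y)).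
  apply: (side _ _ [set u | x <= u.1 <= x + s /\ u.2 = y]).
  - clear -s0 r1 r2 r3 r4 dist1 dist2 nle.
    split => [u v [? h1] [? h2]|u [h1 h2]]; first by rewrite /= h1 h2; split; lra.
    by split; [split; lra|apply: dist2; apply: nle; right; lra].
  - by clear -s0; split => /=; lra.
  - by clear -s0; split => /=; lra.
  - by clear -s0; apply: pair_norm_le => /=; rewrite ler_norml; lra.
have e2 : side_parity f n (x + s, y) (x + s, y + s) (+)
    side_parity L n (x + s, y) (x + s, y + s) =
    crosses (f (x + s, y)) (L (x + s, y)) (+) crosses (f (x + s, y + s)) (L (x + s, y + s)).
  apply: (side _ _ [set u | u.1 = x + s /\ y <= u.2 <= y + s]).
  - clear -s0 r1 r2 r3 r4 dist1 dist2 nle.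
    split => [u v [h1 ?] [h2 ?]|u [h1 h2]]; first by rewrite /= h1 h2; split; lra.
    by split; [split; lra|apply: dist1; apply: nle; left; lra].
  - by clear -s0; split => /=; lra.
  - by clear -s0; split => /=; lra.
  - by clear -s0; apply: pair_norm_le => /=; rewrite ler_norml; lra.
have e3 : side_parity f n (x + s, y + s) (x, y + s) (+)
    side_parity L n (x + s, y + s) (x, y + s) =
    crosses (f (x + s, y + s)) (L (x + s, y + s)) (+) crosses (f (x, y + s)) (L (x, y + s)).
  apply: (side _ _ [set u | x <= u.1 <= x + s /\ u.2 = y + s]).
  - clear -s0 r1 r2 r3 r4 dist1 dist2 nle.
    split => [u v [? h1] [? h2]|u [h1 h2]]; first by rewrite /= h1 h2; split; lra.
    by split; [split; lra|apply: dist2; apply: nle; left; lra].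
  - by clear -s0; split => /=; lra.
  - by clear -s0; split => /=; lra.
  - by clear -s0; apply: pair_norm_le => /=; rewrite ler_norml; lra.
have e4 : side_parity f n (x, y + s) (x, y) (+) side_parity L n (x, y + s) (x, y) =
    crosses (f (x, y + s)) (L (x, y + s)) (+) crosses (f (x, y)) (L (x, y)).
  apply: (side _ _ [set u | u.1 = x /\ y <= u.2 <= y + s]).
  - clear -s0 r1 r2 r3 r4 dist1 dist2 nle.
    split => [u v [h1 ?] [h2 ?]|u [h1 h2]]; first by rewrite /= h1 h2; split; lra.
    by split; [split; lra|apply: dist1; apply: nle; right; lra].
  - by clear -s0; split => /=; lra.
  - by clear -s0; split => /=; lra.
  - by clear -s0; apply: pair_norm_le => /=; rewrite ler_norml; lra.
rewrite -(cells_parity_linear n D0 s0 zx zy gx gy).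
rewrite !cells_parity_boundary /boundary_parity -/L.
have mv (b1 b2 b3 b4 : bool) : b1 (+) b2 = b3 (+) b4 -> b1 = b2 (+) b3 (+) b4.
  by case: b1; case: b2; case: b3; case: b4.
rewrite (mv _ _ _ _ e1) (mv _ _ _ _ e2) (mv _ _ _ _ e3) (mv _ _ _ _ e4).
do 4 move: (side_parity L n _ _).
do 4 move: (crosses _ _).
move=> c4 c3 c2 c1 l4 l3 l2 l1.
transitivity (l1 (+) l2 (+) l3 (+) l4 (+)
    ((c1 (+) c1) (+) (c2 (+) c2) (+) (c3 (+) c3) (+) (c4 (+) c4))).
  by rewrite [LHS](AC (3*3*3*3) ((1*4*7*10) * ((2*12)*(3*5)*(6*8)*(9*11)))).
by rewrite !addbb !addbF.
Qed.

End regular_zeros.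

(** * Parity of the number of regular zeros *)

Section zeros_parity.
Context {R : realType}.
Implicit Types (u v w z : R * R) (f g : R * R -> R * R) (k : R * R * R * R).

Definition has_linear_part f z k := forall e : R, 0 < e ->
  exists2 d : R, 0 < d &
    forall u, `|u - z| < d -> `|f u - f z - linear_map k (u - z)| <= e * `|u - z|.

Lemma ccell_norm (x y s : R) u v : ccell x y s u -> ccell x y s v -> `|u - v| <= s.
Proof.
by move=> [u1 u2] [v1 v2]; apply: pair_norm_le; rewrite /= ler_norml; lra.
Qed.

Lemma ccell_children (x y s : R) z : 0 < s -> ccell x y s z <->
  [\/ ccell x y (s / 2) z, ccell (x + s / 2) y (s / 2) z,
      ccell x (y + s / 2) (s / 2) z | ccell (x + s / 2) (y + s / 2) (s / 2) z].
Proof.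
move=> s0; split.
  move=> [z1 z2]; case: (leP z.1 (x + s / 2)) => h1; case: (leP z.2 (y + s / 2)) => h2.
  - by apply: Or41; split; lra.
  - by apply: Or43; split; lra.
  - by apply: Or42; split; lra.
  - by apply: Or44; split; lra.
by case=> [] [? ?]; split; lra.
Qed.

Definition zeros_enum f (x y s : R) (t : seq (R * R)) :=
  uniq t /\ forall z, z \in t <-> ccell x y s z /\ f z = 0.

(** By bisection. Near a point where [f] is nonzero it stays in a half-plane: no zero, even parity.
    Near a regular zero the comparison with the linear part gives one zero and odd parity. Zeros off
    the grid belong to one quarter only, so the counts add up. Finiteness of the zero set comes out
    at the same time. *)
Lemma zeros_parity f (x y s : R) : 0 < s ->
  (forall z, ccell x y s z -> {for z, continuous f}) ->
  (forall z, ccell x y s z -> f z = 0 -> [/\ offgrid x s z.1, offgrid y s z.2 &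
    exists2 k, linear_det k != 0 & has_linear_part f z k]) ->
  exists2 t, zeros_enum f x y s t &
    exists n0, forall n, (n0 <= n)%N -> cells_parity f n x y s = odd (size t).
Proof.
move=> s0 cf zf.
pose P (a b r : R) := ccell a b r `<=` ccell x y s ->
  (forall z, ccell a b r z -> f z = 0 -> offgrid a r z.1 /\ offgrid b r z.2) ->
  exists2 t, zeros_enum f a b r t &
    exists n0, forall n, (n0 <= n)%N -> cells_parity f n a b r = odd (size t).
suff : P x y s by apply => // z zx fz0; have [? ? _] := zf _ zx fz0.
apply: bisection => //; rewrite {}/P.
- move=> a b r r0 P1 P2 P3 P4 sub grid.
  have S z := ccell_children a b z r0.
  have [||t1 [u1 E1] [n1 H1]] := P1.
  + by move=> z Cz; apply: sub; apply/S; exact: Or41.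
  + move=> z Cz fz; have [|g1 g2] := grid z _ fz; first by apply/S; exact: Or41.
    by split; exact: offgrid_left.
  have [||t2 [u2 E2] [n2 H2]] := P2.
  + by move=> z Cz; apply: sub; apply/S; exact: Or42.
  + move=> z Cz fz; have [|g1 g2] := grid z _ fz; first by apply/S; exact: Or42.
    by split; [exact: offgrid_right|exact: offgrid_left].
  have [||t3 [u3 E3] [n3 H3]] := P3.
  + by move=> z Cz; apply: sub; apply/S; exact: Or43.
  + move=> z Cz fz; have [|g1 g2] := grid z _ fz; first by apply/S; exact: Or43.
    by split; [exact: offgrid_left|exact: offgrid_right].
  have [||t4 [u4 E4] [n4 H4]] := P4.
  + by move=> z Cz; apply: sub; apply/S; exact: Or44.
  + move=> z Cz fz; have [|g1 g2] := grid z _ fz; first by apply/S; exact: Or44.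
    by split; exact: offgrid_right.
  exists (t1 ++ t2 ++ t3 ++ t4).
  + split.
      have mid z : ccell a b r z -> f z = 0 -> z.1 != a + r / 2 /\ z.2 != b + r / 2.
        by move=> Cz fz; have [? ?] := grid z Cz fz; split; exact: offgrid_mid.
      have dis z : [/\ z \in t1 -> [/\ z \notin t2, z \notin t3 & z \notin t4],
          z \in t2 -> z \notin t3 /\ z \notin t4 & z \in t3 -> z \notin t4].
        have c1 := E1 z; have c2 := E2 z; have c3 := E3 z; have c4 := E4 z.
        have m := mid z.
        split.
        * move=> /c1[C1 fz]; have [||/eqP m1 /eqP m2] := m; [by apply/S/Or41|by []|].
          case: C1 => ? ?.
          split; apply/negP; first [move=> /c2|move=> /c3|move=> /c4];
            move=> [[? ?] _]; first [apply: m1; lra|apply: m2; lra].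
        * move=> /c2[C1 fz]; have [||/eqP m1 /eqP m2] := m; [by apply/S/Or42|by []|].
          case: C1 => ? ?.
          split; apply/negP; first [move=> /c3|move=> /c4];
            move=> [[? ?] _]; first [apply: m1; lra|apply: m2; lra].
        * move=> /c3[C1 fz]; have [||/eqP m1 /eqP m2] := m; [by apply/S/Or43|by []|].
          case: C1 => ? ?.
          apply/negP => /c4 [[? ?] _]; first [apply: m1; lra|apply: m2; lra].
      rewrite !cat_uniq u1 u2 u3 u4 /= !andbT; apply/and3P; split.
      * apply/hasPn => z; rewrite /= !mem_cat => z234; apply/negP => /(let: And3 h _ _ := dis z in h).
        by case=> /negbTE h2 /negbTE h3 /negbTE h4; rewrite h2 h3 h4 in z234.
      * apply/hasPn => z; rewrite /= !mem_cat => z34; apply/negP => /(let: And3 _ h _ := dis z in h).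
        by case=> /negbTE h3 /negbTE h4; rewrite h3 h4 in z34.
      * apply/hasPn => z z4; apply/negP => /(let: And3 _ _ h := dis z in h).
        by rewrite z4.
    move=> z; rewrite !mem_cat; split.
      by move=> /or4P[/E1|/E2|/E3|/E4] [Cz fz]; split => //; apply/S;
        [exact: Or41|exact: Or42|exact: Or43|exact: Or44].
    move=> [/S Cz fz]; apply/or4P; case: Cz => Cz.
    - by apply: Or41; apply/E1.
    - by apply: Or42; apply/E2.
    - by apply: Or43; apply/E3.
    - by apply: Or44; apply/E4.
  (* One level of subdivision is spent on passing to the quarters. *)
  + exists (maxn (maxn n1 n2) (maxn n3 n4)).+1 => -[//|n].
    rewrite ltnS !geq_max => /andP[/andP[m1 m2] /andP[m3 m4]].
    by rewrite /= H1// H2// H3// H4// !size_cat !oddD !addbA.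
- move=> z Cz; have [fz|fz] := eqVneq (f z) 0; last first.
    have [w wP] := ball_halfplane fz.
    have /cvgrPdist_lt /(_ `|f z|) := cf _ Cz; rewrite normr_gt0 => /(_ fz).
    move=> /nbhs_normP[d /= d0 dP]; exists d => // a b r r0 rd Czr _ _ grid.
    have pos u : ccell a b r u -> 0 < w.1 * (f u).1 + w.2 * (f u).2.
      move=> Cu; apply: wP; rewrite distrC; apply: dP => /=.
      exact: le_lt_trans (ccell_norm Czr Cu) rd.
    exists [::].
      split => // u; rewrite in_nil; split => // -[/pos + fu].
      by rewrite fu !mulr0 addr0 ltxx.
    by exists 0%N => n _; apply: (cells_parity_halfplane n (ltW r0) pos).
  have [gx gy [k k0 fk]] := zf _ Cz fz.
  have N0 := linear_norm_gt0 k.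
  have D0 : 0 < `|linear_det k| by rewrite normr_gt0.
  (* By [linear_map_ge] this tolerance keeps the error below one eighth of the linear part. *)
  have [|d d0 dP] := fk (`|linear_det k| / (8 * linear_norm k)).
    by rewrite divr_gt0// mulr_gt0.
  exists d => // a b r r0 rd Czr _ _ grid.
  have close u : ccell a b r u ->
      8 * `|f u - linear_map k (u - z)| <= `|linear_map k (u - z)|.
    move=> Cu; have /dP : `|u - z| < d := le_lt_trans (ccell_norm Cu Czr) rd.
    rewrite fz subr0 => h; rewrite -(ler_pM2l N0); apply: le_trans (linear_map_ge _ _).
    apply: (@le_trans _ _ (linear_norm k * (8 * (`|linear_det k| / (8 * linear_norm k) * `|u - z|)))).
      by rewrite (ler_pM2l N0) ler_pM2l//.
    by rewrite le_eqVlt; apply/orP; left; apply/eqP; field; rewrite gt_eqF.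
  have [g1 g2] := grid _ Czr fz.
  exists [:: z].
    split => // u; rewrite inE; split=> [/eqP ->//|[Cu fu]].
    have := close _ Cu; rewrite fu sub0r normrN => h.
    have h0 : `|linear_map k (u - z)| = 0.
      by have := normr_ge0 (linear_map k (u - z)); lra.
    have := linear_map_ge k (u - z); rewrite h0 mulr0 pmulr_rle0// normr_le0.
    by rewrite subr_eq0.
  have [z1 z2] := Czr.
  have [n0 n0P] := cells_parity_regular_zero k0 r0 z1 z2 g1 g2 close.
  by exists n0.
Qed.

(** Both counts are read off the same boundary polygon, at a level fine enough for [f] and for
    [g]. *)
Lemma zeros_parity_eq f g (x y s : R) t t' : 0 < s ->
  (forall z, ccell x y s z -> {for z, continuous f}) ->
  (forall z, ccell x y s z -> {for z, continuous g}) ->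
  (forall z, ccell x y s z -> f z = 0 -> [/\ offgrid x s z.1, offgrid y s z.2 &
    exists2 k, linear_det k != 0 & has_linear_part f z k]) ->
  (forall z, ccell x y s z -> g z = 0 -> [/\ offgrid x s z.1, offgrid y s z.2 &
    exists2 k, linear_det k != 0 & has_linear_part g z k]) ->
  (forall u, ccell x y s u -> u.1 = x \/ u.1 = x + s \/ u.2 = y \/ u.2 = y + s ->
    f u = g u) ->
  zeros_enum f x y s t -> zeros_enum g x y s t' -> odd (size t) = odd (size t').
Proof.
move=> s0 cf cg zf zg fg [u1 E1] [u2 E2].
have [t1 [v1 F1] [n1 H1]] := zeros_parity s0 cf zf.
have [t2 [v2 F2] [n2 H2]] := zeros_parity s0 cg zg.
have -> : size t = size t1.
  by apply/perm_size/uniq_perm => // z; apply/idP/idP => [/E1/F1|/F1/E1].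
have -> : size t' = size t2.
  by apply/perm_size/uniq_perm => // z; apply/idP/idP => [/E2/F2|/F2/E2].
rewrite -(H1 (maxn n1 n2)) ?leq_maxl// -(H2 (maxn n1 n2)) ?leq_maxr//.
exact: cells_parity_eq fg (ltW s0).
Qed.

End zeros_parity.

(** * Plane measure and linear maps *)

Section plane_measure_theory.
Context {R : realType}.

Local Notation leb := (@lebesgue_measure R).
Local Notation mu := (@plane_measure R).

HB.instance Definition _ := Measure.copy mu (leb \x leb)%E.

Lemma lebesgue_measure_translation (c : R) (A : set R) : measurable A ->
  leb ((fun x => x + c) @^-1` A) = leb A.
Proof.
move=> mA.
have mc : measurable_fun setT ((fun x => x + c) : R -> measurableTypeR R).
  by apply: measurable_funD => //; exact: measurable_cst.
apply/esym/(@lebesgue_measure_unique _ (pushforward leb ((fun x => x + c) : R -> measurableTypeR R))) => //.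
move=> _ [[a b]] _ <-.
rewrite [RHS](_ : _ = leb `]a - c, b - c]%classic); last first.
  congr lebesgue_measure.
  by apply/seteqP; split => x /=; rewrite !in_itv/=; lra.
by rewrite !lebesgue_measure_itv/= !lte_fin ltrD2r; case: ifP => // _; rewrite -!EFinD; congr EFin; ring.
Qed.

Lemma plane_measure_xsection (A : set (R * R)) : measurable A ->
  mu A = (\int[leb]_x leb (xsection A x))%E.
Proof. by []. Qed.

Lemma plane_measure_ysection (A : set (R * R)) : measurable A ->
  mu A = (\int[leb]_y leb (ysection A y))%E.
Proof.
move=> mA; rewrite plane_measure_xsection//.
have := @indic_fubini_tonelli _ _ _ _ R leb leb A mA.
by rewrite indic_fubini_tonelli_FE// indic_fubini_tonelli_GE.
Qed.

Lemma measurable_shear1 (k : R) :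
  measurable_fun setT ((fun z => (z.1, z.2 + k * z.1)) : R * R -> R * R).
Proof.
apply/measurable_fun_pairP; split; first exact: measurable_fst.
apply: measurable_funD; first exact: measurable_snd.
by apply: measurable_funM; [exact: measurable_cst|exact: measurable_fst].
Qed.

Lemma measurable_shear2 (k : R) :
  measurable_fun setT ((fun z => (z.1 + k * z.2, z.2)) : R * R -> R * R).
Proof.
apply/measurable_fun_pairP; split; last exact: measurable_snd.
apply: measurable_funD; first exact: measurable_fst.
by apply: measurable_funM; [exact: measurable_cst|exact: measurable_snd].
Qed.

(** On each vertical section the shear is a translation. *)
Lemma plane_measure_shear1 (k : R) (A : set (R * R)) : measurable A ->
  mu ((fun z => (z.1, z.2 + k * z.1)) @^-1` A) = mu A.
Proof.
move=> mA.
have mS : measurable ((fun z : R * R => (z.1, z.2 + k * z.1)) @^-1` A).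
  by rewrite -[X in measurable X]setTI; exact: measurable_shear1.
rewrite !plane_measure_xsection//; apply: eq_integral => x _.
rewrite -[RHS](lebesgue_measure_translation (k * x)); last exact: measurable_xsection.
by congr lebesgue_measure; apply/seteqP; split => y; rewrite /xsection/= => /set_mem h; exact/mem_set.
Qed.

Lemma plane_measure_shear2 (k : R) (A : set (R * R)) : measurable A ->
  mu ((fun z => (z.1 + k * z.2, z.2)) @^-1` A) = mu A.
Proof.
move=> mA.
have mS : measurable ((fun z : R * R => (z.1 + k * z.2, z.2)) @^-1` A).
  by rewrite -[X in measurable X]setTI; exact: measurable_shear2.
rewrite !plane_measure_ysection//; apply: eq_integral => y _.
rewrite -[RHS](lebesgue_measure_translation (k * y)); last exact: measurable_ysection.
by congr lebesgue_measure; apply/seteqP; split => x; rewrite /ysection/= => /set_mem h; exact/mem_set.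
Qed.

Lemma plane_measure_translation (q : R * R) (A : set (R * R)) : measurable A ->
  measurable ((fun z => z + q) @^-1` A) /\ mu ((fun z => z + q) @^-1` A) = mu A.
Proof.
move=> mA.
pose f1 (z : R * R) : R * R := (z.1, z.2 + q.2).
pose f2 (z : R * R) : R * R := (z.1 + q.1, z.2).
have mf1 : measurable (f1 @^-1` A).
  rewrite -[X in measurable X]setTI; apply: (_ : measurable_fun setT f1) => //.
  apply/measurable_fun_pairP; split; first exact: measurable_fst.
  by apply: measurable_funD; [exact: measurable_snd|exact: measurable_cst].
have mf2 : measurable (f2 @^-1` (f1 @^-1` A)).
  rewrite -[X in measurable X]setTI; apply: (_ : measurable_fun setT f2) => //.
  apply/measurable_fun_pairP; split; last exact: measurable_snd.
  by apply: measurable_funD; [exact: measurable_fst|exact: measurable_cst].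
rewrite (_ : _ @^-1` A = f2 @^-1` (f1 @^-1` A))//; split => //.
transitivity (mu (f1 @^-1` A)).
  rewrite (plane_measure_ysection mf2) (plane_measure_ysection mf1).
  apply: eq_integral => y _.
  rewrite -[RHS](lebesgue_measure_translation q.1); last exact: measurable_ysection.
  by congr lebesgue_measure; apply/seteqP; split => x; rewrite /ysection/= => /set_mem h;
    exact/mem_set.
rewrite (plane_measure_xsection mf1) (plane_measure_xsection mA).
apply: eq_integral => x _.
rewrite -[RHS](lebesgue_measure_translation q.2); last exact: measurable_xsection.
by congr lebesgue_measure; apply/seteqP; split => y; rewrite /xsection/= => /set_mem h;
  exact/mem_set.
Qed.

Definition box (a b c d : R) : set (R * R) := `[a, b]%classic `*` `[c, d]%classic.

Lemma measurable_box a b c d : measurable (box a b c d).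
Proof. exact: measurableX. Qed.

Lemma plane_measure_box a b c d : a <= b -> c <= d ->
  mu (box a b c d) = ((b - a) * (d - c))%:E.
Proof.
move=> ab cd.
have itvE t u : t <= u -> leb `[t, u]%classic = (u - t)%:E.
  move=> tu; rewrite lebesgue_measure_itv/= lte_fin; move: tu.
  by rewrite le_eqVlt => /orP[/eqP ->|->//]; rewrite ltxx subrr.
transitivity (leb `[a, b]%classic * leb `[c, d]%classic)%E.
  exact: product_measure1E.
by rewrite !itvE.
Qed.

End plane_measure_theory.

(** * Area of images of squares under linear and nearly linear maps *)

Section linear_covers.
Context {R : realType}.
Local Notation mu := (@plane_measure R).
Implicit Types (k : R * R * R * R) (h p q z : R * R).

Lemma in_box (a b : R) z : `|z.1| <= a -> `|z.2| <= b -> box (- a) a (- b) b z.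
Proof. by rewrite !ler_norml => h1 h2; split => /=; rewrite in_itv. Qed.

(** Gaussian elimination: two shears carry the image into a box whose half-sides are [r] times the
    pivots [a] and [D / a] in absolute value. A zero corner entry is avoided by exchanging the
    columns. *)
Lemma linear_image_square k (r : R) : linear_det k != 0 -> 0 <= r ->
  exists2 H, measurable H & (forall h, `|h| <= r -> H (linear_map k h)) /\
    (mu H <= (`|linear_det k| * (2 * r) ^+ 2)%:E)%E.
Proof.
move=> k0 r0.
wlog a0 : k k0 / k.1.1.1 != 0.
  move=> W; have [a0|] := eqVneq k.1.1.1 0; last exact: W.
  have [|| H mH [HL muH]] := W (k.1.1.2, k.1.1.1, k.2, k.1.2).
  - by move: k0; apply: contra => /eqP; rewrite /linear_det/= => k0; apply/eqP; lra.
  - by apply: contra k0 => /eqP /= b0; rewrite /linear_det a0 b0 !mul0r subrr.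
  exists H => //; split.
    move=> h hr; have -> : linear_map k h =
        linear_map (k.1.1.2, k.1.1.1, k.2, k.1.2) (h.2, h.1).
      by rewrite /linear_map /=; congr pair; rewrite addrC.
    apply: HL; apply: pair_norm_le => /=; apply: le_trans hr; last exact: pair_norm1.
    exact: pair_norm2.
  by move: muH; rewrite /linear_det /= -[in X in X -> _]normrN opprB.
case: k k0 a0 => [[[a b] c] d]; rewrite /linear_det /= => D0 a0.
set D := a * d - b * c in D0 *.
pose S1 (z : R * R) : R * R := (z.1, z.2 + - (c / a) * z.1).
pose S2 (z : R * R) : R * R := (z.1 + - (b * a / D) * z.2, z.2).
pose B := box (- (`|a| * r)) (`|a| * r) (- (`|D / a| * r)) (`|D / a| * r).
have mB : measurable B by exact: measurable_box.
have mS2 : measurable (S2 @^-1` B).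
  by rewrite -[X in measurable X]setTI; exact: measurable_shear2.
exists (S1 @^-1` (S2 @^-1` B)).
  by rewrite -[X in measurable X]setTI; exact: measurable_shear1.
split.
  move=> h hr; rewrite /preimage /= /S1 /S2 /linear_map /=.
  have -> : c * h.1 + d * h.2 + - (c / a) * (a * h.1 + b * h.2) = D / a * h.2.
    by rewrite /D; field.
  have -> : a * h.1 + b * h.2 + - (b * a / D) * (D / a * h.2) = a * h.1.
    by field; rewrite ?a0 ?D0 ?andbT.
  apply: in_box; rewrite /= normrM ler_wpM2l//; apply: le_trans hr;
    [exact: pair_norm1|exact: pair_norm2].
rewrite plane_measure_shear1// plane_measure_shear2// plane_measure_box.
- rewrite lee_fin le_eqVlt; apply/orP; left; apply/eqP.
  by rewrite normrM normfV; field; rewrite normr_eq0.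
- by have := mulr_ge0 (normr_ge0 a) r0; lra.
- by have := mulr_ge0 (normr_ge0 (D / a)) r0; lra.
Qed.

(* A singular map collapses a square to a segment, whose neighbourhood of
   width rho is a sheared thin box. *)
Lemma linear_image_singular k : linear_det k = 0 ->
  exists2 C : R, 0 < C & forall r rho : R, 0 <= r -> 0 <= rho ->
    exists2 H, measurable H &
    (forall h p, `|h| <= r -> `|p - linear_map k h| <= rho -> H p) /\
    (mu H <= (C * rho * (linear_norm k * r + rho))%:E)%E.
Proof.
move=> k0; have N0 := linear_norm_gt0 k.
have bound h p (r rho : R) : `|h| <= r -> `|p - linear_map k h| <= rho ->
    `|p| <= linear_norm k * r + rho.
  move=> hr pr; apply: (@le_trans _ _ (`|linear_map k h| + `|p - linear_map k h|)).
    by rewrite (le_trans _ (ler_normD _ _))// addrC subrK.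
  apply: lerD => //.
  by apply: (le_trans (linear_map_le _ _)); rewrite ler_pM2l.
(* Dependent rows: the first is a multiple of the second, or the second is zero. *)
have [[t [t1 t2]]|[c0 d0]] : (exists t, k.1.1.1 + t * k.1.2 = 0 /\ k.1.1.2 + t * k.2 = 0) \/
    (k.1.2 = 0 /\ k.2 = 0).
  case: k k0 {N0 bound} => [[[a b] c] d]; rewrite /linear_det /= => D0.
  have [c0|c0] := eqVneq c 0; last first.
    left; exists (- (a / c)); split; first by field.
    by apply: (mulfI c0); rewrite mulr0 -[RHS]oppr0 -D0; field.
  have [d0|d0] := eqVneq d 0; first by right.
  left; exists (- (b / d)); split; last by field.
  rewrite c0 mulr0 addr0; apply: (mulIf d0); rewrite mul0r.
  by move: D0; rewrite c0 mulr0 subr0.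
- have C0 : 0 < 4 * (1 + `|t|) :> R by rewrite mulr_gt0// ltr_pwDl.
  exists (4 * (1 + `|t|)) => // r rho r0 rho0.
  pose S (z : R * R) : R * R := (z.1 + t * z.2, z.2).
  set M := linear_norm k * r + rho.
  have M0 : 0 <= M by rewrite addr_ge0// mulr_ge0// ltW.
  pose B := box (- ((1 + `|t|) * rho)) ((1 + `|t|) * rho) (- M) M.
  have tr0 : 0 <= (1 + `|t|) * rho by rewrite mulr_ge0// addr_ge0.
  have mB : measurable B by exact: measurable_box.
  exists (S @^-1` B); first by rewrite -[X in measurable X]setTI; exact: measurable_shear2.
  split.
    move=> h p hr pr; apply: in_box => /=; last first.
      exact: (le_trans (pair_norm2 p)) (bound _ _ _ _ hr pr).
    have -> : p.1 + t * p.2 = (p - linear_map k h).1 + t * (p - linear_map k h).2.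
      rewrite /linear_map /= -[LHS]subr0.
      rewrite -[in LHS](mul0r h.1) -{1}t1 -[X in X - _]subr0 -(mul0r h.2) -{1}t2.
      by ring.
    apply: (le_trans (ler_normD _ _)); rewrite mulrDl mul1r; apply: lerD.
      exact: le_trans (pair_norm1 _) pr.
    by rewrite normrM ler_wpM2l//; exact: le_trans (pair_norm2 _) pr.
  rewrite plane_measure_shear2// plane_measure_box; [|lra|lra].
  by rewrite lee_fin; lra.
- exists 4 => // r rho r0 rho0.
  set M := linear_norm k * r + rho.
  have M0 : 0 <= M by rewrite addr_ge0// mulr_ge0// ltW.
  exists (box (- M) M (- rho) rho); first exact: measurable_box.
  split.
    move=> h p hr pr; apply: in_box.
      exact: (le_trans (pair_norm1 p)) (bound _ _ _ _ hr pr).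
    apply: le_trans pr; apply: le_trans (pair_norm2 _).
    by rewrite /linear_map /= c0 d0 !mul0r addr0 subr0.
  rewrite plane_measure_box; [|lra|lra].
  by rewrite lee_fin; lra.
Qed.

(** For a regular [k] an error of size [eta * r] is itself the image of a vector of norm at most
    [theta * r], so the image of a slightly larger square is a cover. A singular [k] uses the thin
    boxes of [linear_image_singular]. *)
Lemma linear_image_cover k (e : R) : 0 < e -> exists2 eta : R, 0 < eta &
  forall (r : R) q, 0 < r -> exists2 H, measurable H &
    (forall h p, `|h| <= r -> `|p - q - linear_map k h| <= eta * r -> H p) /\
    (mu H <= ((`|linear_det k| + e) * (2 * r) ^+ 2)%:E)%E.
Proof.
move=> e0; have N0 := linear_norm_gt0 k.
suff : exists2 eta : R, 0 < eta & forall r : R, 0 < r -> exists2 H, measurable H &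
    (forall h p, `|h| <= r -> `|p - linear_map k h| <= eta * r -> H p) /\
    (mu H <= ((`|linear_det k| + e) * (2 * r) ^+ 2)%:E)%E.
  move=> [eta eta0 W]; exists eta => // r q r0; have [H mH [HL muH]] := W r r0.
  have [mT muT] := plane_measure_translation (- q) mH.
  by exists ((fun z => z - q) @^-1` H); rewrite // muT; split => // h p; exact: HL.
have [k0|k0] := eqVneq (linear_det k) 0.
  have [C C0 CP] := linear_image_singular k0.
  pose eta := Num.min 1 (e / (C * (linear_norm k + 1))).
  have N1 : 0 < linear_norm k + 1 by rewrite addr_gt0.
  have eta0 : 0 < eta by rewrite lt_min ltr01 divr_gt0// mulr_gt0.
  have eta1 : eta <= 1 by rewrite ge_min lexx.
  have etae : eta * (C * (linear_norm k + 1)) <= e.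
    by rewrite -ler_pdivlMr ?mulr_gt0// ge_min lexx orbT.
  exists eta => // r r0; have er0 : 0 <= eta * r by rewrite mulr_ge0// ltW.
  have [H mH [HL muH]] := CP r (eta * r) (ltW r0) er0.
  exists H => //; split=> //; apply: (le_trans muH); rewrite lee_fin k0 normr0 add0r.
  have -> : C * (eta * r) * (linear_norm k * r + eta * r) =
    eta * (C * (linear_norm k + eta)) * r ^+ 2 by ring.
  apply: (@le_trans _ _ (e * r ^+ 2)); last first.
    by rewrite ler_pM2l// ler_sqr ?nnegrE; lra.
  rewrite ler_pM2r ?exprn_gt0//; apply: le_trans etae.
  by rewrite ler_pM2l// ler_pM2l// lerD2l.
have D0 : 0 < `|linear_det k| by rewrite normr_gt0.
(* For [theta <= 1], (1 + theta)^2 is at most 1 + 3 theta, whence the factor 3. *)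
pose theta := Num.min 1 (e / (3 * `|linear_det k|)).
have th0 : 0 < theta by rewrite lt_min ltr01 divr_gt0// mulr_gt0.
have th1 : theta <= 1 by rewrite ge_min lexx.
have the : theta * (3 * `|linear_det k|) <= e.
  by rewrite -ler_pdivlMr ?mulr_gt0// ge_min lexx orbT.
exists (theta * `|linear_det k| / linear_norm k).
  by rewrite divr_gt0// mulr_gt0.
move=> r r0; have [|H mH [HL muH]] := @linear_image_square k (r + theta * r) k0.
  by rewrite addr_ge0 ?mulr_ge0// ltW.
exists H => //; split.
  move=> h p hr; set w := p - linear_map k h => wr.
  have [g gE] : exists g, linear_map k g = w.
    exists ((k.2 * w.1 - k.1.1.2 * w.2) / linear_det k,
            (k.1.1.1 * w.2 - k.1.2 * w.1) / linear_det k).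
    rewrite [RHS]surjective_pairing /linear_map /=; move: k0; rewrite /linear_det => k0.
    by congr pair; field.
  have gr : `|g| <= theta * r.
    rewrite -(ler_pM2l D0); apply: (le_trans (linear_map_ge _ _)); rewrite gE.
    have -> : `|linear_det k| * (theta * r) =
        linear_norm k * (theta * `|linear_det k| / linear_norm k * r).
      by field; rewrite gt_eqF.
    by rewrite ler_pM2l.
  have -> : p = linear_map k (h + g).
    have -> : linear_map k (h + g) = linear_map k h + linear_map k g.
      by rewrite /linear_map /=; congr pair => /=; ring.
    by rewrite gE addrC subrK.
  by apply: HL; apply: (le_trans (ler_normD _ _)); exact: lerD.
apply: (le_trans muH); rewrite lee_fin.
have -> : `|linear_det k| * (2 * (r + theta * r)) ^+ 2 =
  (`|linear_det k| * (1 + theta) ^+ 2) * (2 * r) ^+ 2 by ring.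
rewrite ler_pM2r ?exprn_gt0 ?mulr_gt0//.
have : `|linear_det k| * theta ^+ 2 <= `|linear_det k| * theta.
  by rewrite ler_pM2l// expr2 ler_piMr// ltW.
by lra.
Qed.

(** Bounds the outer measure; it will be applied to images of Borel sets, which need not be
    Borel. *)
Definition outer_le (A : set (R * R)) (m : \bar R) :=
  exists2 H, measurable H & A `<=` H /\ (mu H <= m)%E.

(** The square contains [z] but need not be centred there, so the expansion at [z] is moved to the
    centre [c], with target point [f z + linear_map k (c - z)]. *)
Lemma outer_le_cell (f : R * R -> R * R) z k (e : R) : 0 < e ->
  has_linear_part f z k -> exists2 d : R, 0 < d & forall x y s : R,
    0 < s -> s < d -> ccell x y s z ->
    outer_le (f @` ccell x y s) ((`|linear_det k| + e) * s ^+ 2)%:E.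
Proof.
move=> e0 fk; have [eta eta0 cov] := linear_image_cover k e0.
(* Points of the square are within [s] of [z], twice the half-side in which the cover is stated. *)
have [|d d0 dP] := fk (eta / 2); first by rewrite divr_gt0.
exists d => // x y s s0 sd Cz.
have s20 : 0 < s / 2 by rewrite divr_gt0.
pose c := (x + s / 2, y + s / 2).
have [H mH [HL muH]] := cov (s / 2) (f z + linear_map k (c - z)) s20.
exists H => //; split; last by move: muH; rewrite (_ : 2 * (s / 2) = s)//; field.
move=> _ [u Cu <-]; apply: (HL (u - c)).
  have [? ?] := Cu; apply: pair_norm_le; rewrite /c /= ler_norml; lra.
have uz := ccell_norm Cu Cz.
have -> : f u - (f z + linear_map k (c - z)) - linear_map k (u - c) =
    f u - f z - linear_map k (u - z).
  have -> : linear_map k (u - z) = linear_map k (u - c) + linear_map k (c - z).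
    by rewrite !linear_mapB addrA subrK.
  move: (f u) (f z) (linear_map k (u - c)) (linear_map k (c - z)) => a b g h.
  by rewrite opprD (opprD g) !addrA [RHS]addrAC.
apply: (le_trans (dP _ _)); first exact: le_lt_trans uz sd.
rewrite (_ : eta * (s / 2) = eta / 2 * s); last by field.
by rewrite ler_pM2l// divr_gt0.
Qed.

End linear_covers.

(** * Outer bounds of images *)

Section monotone_class.
Context {T : Type}.
Implicit Types (A B E : set T) (C G : set (set T)).

Definition monotone_closed C := (forall F : (set T)^nat, (forall n, F n `<=` F n.+1) ->
    (forall n, C (F n)) -> C (\bigcup_n F n)) /\
  (forall F : (set T)^nat, (forall n, F n.+1 `<=` F n) ->
    (forall n, C (F n)) -> C (\bigcap_n F n)).

(** A monotone class rather than a Dynkin system: the outer bounds to be proved pass to increasing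
    unions and decreasing intersections, but not to differences. The smallest monotone class [M]
    over the algebra is stable under complements and, by extending one factor at a time, under
    intersections. *)
Lemma monotone_class_theorem G C : G set0 -> setC_closed G -> setI_closed G ->
  G `<=` C -> monotone_closed C -> <<s G >> `<=` C.
Proof.
move=> G0 GC GI GleC mC.
pose M : set (set T) := [set A | forall D, G `<=` D -> monotone_closed D -> D A].
have GM : G `<=` M by move=> A GA D GD _; exact: GD.
have mM : monotone_closed M.
  split=> F Fm MF D GD mD; [apply: mD.1 => // n|apply: mD.2 => // n]; exact: MF.
have MC A : M A -> M (~` A).
  move=> MA; apply: (MA [set A | M (~` A)]); first by move=> B GB; apply: (GM (~` B)); exact: GC.
  split=> F Fm MF /=.
    by rewrite setC_bigcup; apply: (mM.2 (fun n => ~` F n)) => n; [move=> x h Fx; by apply: h; apply: Fm|exact: MF].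
  by rewrite setC_bigcap; apply: (mM.1 (fun n => ~` F n)) => n; [move=> x h Fx; by apply: h; apply: Fm|exact: MF].
have mI A : monotone_closed [set B | M (A `&` B)].
  split=> F Fm MF /=.
    by rewrite setI_bigcupr; apply: (mM.1 (fun n => A `&` F n)) => n; [exact: setIS|exact: MF].
  rewrite (_ : A `&` _ = \bigcap_n (A `&` F n)); first by apply: (mM.2 (fun n => A `&` F n)) => n; [exact: setIS|exact: MF].
  apply/seteqP; split => [x [Ax Fx] n _|x h]; first by split => //; exact: Fx.
  by split => [|n _]; [have [] := h 0%N I|have [] := h n I].
have MI A B : M A -> M B -> M (A `&` B).
  have h D E : G D -> M E -> M (D `&` E).
    move=> GD ME; apply: (ME [set E | M (D `&` E)] _ (mI D)).
    by move=> F GF; apply: (GM (D `&` F)); exact: GI.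
  move=> MA MB; apply: (MB [set E | M (A `&` E)] _ (mI A)).
  move=> D GD.
  by rewrite /= setIC; exact: h.
apply: (@subset_trans _ M); last by move=> A MA; exact: MA.
apply: smallest_sub => //; split.
- exact: GM.
- by move=> A MA; rewrite setTD; exact: MC.
- move=> F MF; rewrite (_ : \bigcup_n F n = \bigcup_n (\big[setU/set0]_(i < n) F i)).
    apply: (mM.1 (fun n => \big[setU/set0]_(i < n) F i)) => n;
      first by rewrite big_ord_recr; exact: subsetUl.
    elim: n => [|n IH]; first by rewrite big_ord0; exact: GM.
    rewrite big_ord_recr /= -[_ `|` _]setCK setCU.
    by apply: (MC (_ `&` _)); apply: (MI (~` _) (~` _)); [exact: (MC _ IH)|exact: (MC _ (MF n))].
  apply/seteqP; split => x.
    by move=> [n _ Fn]; exists n.+1 => //; rewrite big_ord_recr; right.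
  by move=> [n _]; rewrite -bigcup_mkord => -[i _ Fi]; exists i.
Qed.

End monotone_class.

(** * Dyadic cells and the algebra they generate *)

Section dyadic_cells.
Context {R : realType}.
Implicit Types (z w : R * R) (c : int * int).

(** Half-open, so that the four quarters are disjoint. *)
Definition hcell (x y s : R) : set (R * R) :=
  [set z | x <= z.1 < x + s /\ y <= z.2 < y + s].

Lemma hcellE x y s : hcell x y s = `[x, (x + s)[%classic `*` `[y, (y + s)[%classic.
Proof. by apply/seteqP; split => z; rewrite /hcell /= !in_itv. Qed.

Lemma measurable_hcell x y s : measurable (hcell x y s).
Proof. by rewrite hcellE; exact: measurableX. Qed.

Lemma hcell_sub x y s : hcell x y s `<=` ccell x y s.
Proof. by move=> z [h1 h2]; split; lra. Qed.

Definition dyadic (n : nat) z : int * int :=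
  (Num.floor (2 ^+ n * z.1), Num.floor (2 ^+ n * z.2)).

Definition dcell n c : set (R * R) :=
  hcell (c.1%:~R / 2 ^+ n) (c.2%:~R / 2 ^+ n) (2 ^+ n)^-1.

Lemma floor_eqP (t : R) (i : int) : Num.floor t = i <-> i%:~R <= t < i%:~R + 1.
Proof.
rewrite (_ : i%:~R + 1 = (i + 1)%:~R :> R); last by rewrite intrD.
rewrite -floor_ge_int -floor_lt_int; split => [->|]; first by rewrite lexx ltzD1 lexx.
by rewrite ltzD1 => h; apply/eqP; rewrite eq_le andbC.
Qed.

Lemma dcellP n c z : dcell n c z <-> dyadic n z = c.
Proof.
have n0 : 0 < 2 ^+ n :> R by rewrite exprn_gt0.
have E (i : int) (t : R) : (i%:~R / 2 ^+ n <= t < i%:~R / 2 ^+ n + (2 ^+ n)^-1) =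
    (i%:~R <= 2 ^+ n * t < i%:~R + 1).
  rewrite -[X in _ < _ + X]mul1r -mulrDl ler_pdivrMr// ltr_pdivlMr//.
  by rewrite mulrC.
rewrite /dcell /hcell /= !E; split=> [[/floor_eqP h1 /floor_eqP h2]|<-].
  by rewrite /dyadic h1 h2; case: c {h1 h2}.
by split; apply/floor_eqP.
Qed.

Lemma dyadic_refine n m z w : dyadic (n + m) z = dyadic (n + m) w ->
  dyadic n z = dyadic n w.
Proof.
elim: m => [|m IH]; first by rewrite addn0.
move=> h; apply: IH; move: h; rewrite addnS; move: (n + m)%N => k.
have F (t u : R) : Num.floor (2 * t) = Num.floor (2 * u) -> Num.floor t = Num.floor u.
  have /floor_eqP := erefl (Num.floor u); set i := Num.floor u => hi.
  have /floor_eqP := erefl (Num.floor (2 * u)); set j := Num.floor (2 * u) => hj.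
  move=> /floor_eqP hj'; apply/floor_eqP.
  have j1 : i * 2 <= j.
    by rewrite -ltzD1 -(ltr_int R) intrM intrD; move: hi hj => /andP[? _] /andP[_ ?]; lra.
  have j2 : j + 1 <= i * 2 + 2.
    rewrite -ltzD1 ltrD2r -(ltr_int R) intrD intrM.
    by move: hi hj => /andP[_ ?] /andP[? _]; lra.
  move: j1 j2; rewrite -!(ler_int R) !intrD !intrM => j1 j2.
  by move: hj' => /andP[? ?]; lra.
by rewrite /dyadic !exprS -!mulrA => -[/F -> /F ->].
Qed.

End dyadic_cells.

Section dyadic_algebra.
Context {R : realType}.
Implicit Types (z w : R * R) (c : int * int).

Lemma dyadic_small (e : R) : 0 < e -> exists n, (2 ^+ n)^-1 < e.
Proof.
move=> e0; have /archi_boundP : 0 <= e^-1 by rewrite invr_ge0 ltW.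
set n := Num.bound _ => nP; exists n.
rewrite -[e]invrK ltf_pV2 ?posrE ?invr_gt0 ?exprn_gt0//.
by apply: (lt_trans nP); rewrite -natrX ltr_nat ltn_expl.
Qed.

(** Unions of dyadic cells of one common size; refinement to a common level makes them an
    algebra. *)
Definition dyadic_sets : set (set (R * R)) :=
  [set E | exists n S, E = @dyadic R n @^-1` S].

Lemma dyadic_sets_refine n m (S : set (int * int)) :
  @dyadic R n @^-1` S = @dyadic R (n + m) @^-1`
    [set c | exists2 z : R * R, dyadic (n + m) z = c & S (dyadic n z)].
Proof.
apply/seteqP; split => [z Sz|z [w /dyadic_refine wz]]; first by exists z.
by rewrite wz.
Qed.

Lemma dyadic_sets0 : dyadic_sets set0.
Proof. by exists 0%N, set0; rewrite preimage_set0. Qed.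

Lemma dyadic_setsC : setC_closed dyadic_sets.
Proof. by move=> _ [n [S ->]]; exists n, (~` S); rewrite preimage_setC. Qed.

Lemma dyadic_setsI : setI_closed dyadic_sets.
Proof.
move=> _ _ [n [S ->]] [m [S' ->]].
rewrite (dyadic_sets_refine n m S) (dyadic_sets_refine m n S') (addnC m).
by eexists _, _; rewrite -preimage_setI.
Qed.

(** It is enough to treat the half-planes [p z < a] for the two coordinates [p]: each is the union
    over [n] of the strips of width 2^-n that end at or before [a]. *)
Lemma measurable_dyadic_sets (A : set (R * R)) : measurable A -> <<s dyadic_sets >> A.
Proof.
set G := <<s dyadic_sets >>.
have G0 : G set0 by exact: sigma_algebra0.
have GC E : G E -> G (~` E) by rewrite -setTD; exact: sigma_algebraCD.
have GU (F : (set (R * R))^nat) : (forall n, G (F n)) -> G (\bigcup_n F n).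
  exact: sigma_algebra_bigcup.
have GI E F : G E -> G F -> G (E `&` F).
  move=> GE GF; rewrite -[E `&` F]setCK setCI; apply: (GC).
  rewrite (_ : _ `|` _ = \bigcup_n (if n == 0%N then ~` E else ~` F)).
    by apply: (GU) => n; case: ifP => _; exact: GC.
  apply/seteqP; split => z; first by case=> h; [exists 0%N|exists 1%N].
  by move=> [n _]; case: ifP => _ h; [left|right].
have pre (p : R * R -> R) : (forall a, G [set z | p z < a]) ->
    forall B : set R, measurable B -> G (p @^-1` B).
  move=> Gp B mB.
  suff : (@measurable _ (measurableTypeR R)) `<=` [set B | G (p @^-1` B)] by apply.
  rewrite [X in X `<=` _]RGenCInfty.measurableE; apply: smallest_sub.
    split => /=.
    - by rewrite preimage_set0.
    - by move=> E GE; rewrite setTD preimage_setC; exact: GC.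
    - by move=> F GF; rewrite preimage_bigcup; exact: GU.
  move=> _ [a ->] /=; rewrite (_ : _ @^-1` _ = ~` [set z | p z < a]); first exact: (GC _ (Gp a)).
  by apply/seteqP; split => z /=; rewrite in_itv/= andbT leNgt => /negP.
have ray (p : R * R -> R) (q : int * int -> int) :
    (forall n z, q (dyadic n z) = Num.floor (2 ^+ n * p z)) ->
    forall a, G [set z | p z < a].
  move=> pq a.
  rewrite (_ : [set z | _] = \bigcup_n @dyadic R n @^-1`
      [set c | ((q c)%:~R + 1) / 2 ^+ n <= a]).
    by apply: GU => n; apply: sub_sigma_algebra; exists n; eexists.
  apply/seteqP; split => [z /= za|z [n _] /=].
    have [n nP] := @dyadic_small (a - p z) ltac:(by rewrite subr_gt0).
    exists n => //=; rewrite pq; have := floor_le (2 ^+ n * p z).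
    have n0 : 0 < 2 ^+ n :> R by rewrite exprn_gt0.
    have h : 1 < (a - p z) * 2 ^+ n by rewrite -ltr_pdivrMr// div1r.
    by rewrite ler_pdivrMr//; lra.
  rewrite pq => h; apply: lt_le_trans h.
  rewrite ltr_pdivlMr ?exprn_gt0// mulrC.
  by have /floor_eqP/andP[] := erefl (Num.floor (2 ^+ n * p z)).
rewrite measurable_prod_measurableType => mA; move: A mA; apply: smallest_sub.
  exact: smallest_sigma_algebra.
move=> _ [A mA [B mB <-]]; rewrite (_ : A `*` B = fst @^-1` A `&` snd @^-1` B)//.
apply: GI.
  by apply: pre mA; apply: (ray _ fst).
by apply: pre mB; apply: (ray _ snd).
Qed.

Lemma measurable_dyadic n (S : set (int * int)) : measurable (@dyadic R n @^-1` S).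
Proof.
rewrite (_ : _ @^-1` _ = \bigcup_c (if c \in S then dcell n c else set0)).
  apply: countable_bigcupT_measurable => [|c]; first exact: countableP.
  by case: ifP => _; [exact: measurable_hcell|exact: measurable0].
apply/seteqP; split => z.
  by move=> Sz; exists (dyadic n z) => //; rewrite mem_set//; apply/dcellP.
by move=> [c _]; case: ifP => // /set_mem Sc /dcellP zc; rewrite /preimage /= zc.
Qed.

Lemma dyadic_cell_in_open (U : set (R * R)) z : open U -> U z ->
  exists n, ccell ((dyadic n z).1%:~R / 2 ^+ n) ((dyadic n z).2%:~R / 2 ^+ n)
    (2 ^+ n)^-1 `<=` U.
Proof.
move=> oU Uz.
have /nbhs_normP[d /= d0 dU] : nbhs z U by exact: open_nbhs_nbhs.
have [n nd] := dyadic_small d0; exists n => w Cw; apply: dU => /=.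
apply: le_lt_trans nd; apply: ccell_norm Cw.
by apply: hcell_sub; exact: (dcellP n (dyadic n z) z).2.
Qed.

Definition cell_of (j : nat) : nat * (int * int) :=
  odflt (0%N, (0, 0)) (unpickle j).

(** The cells range over all levels and overlap across levels; one counts only if its closure lies
    in [U]. Integers that code nothing fall back on the unit cell at 0, which undergoes the same
    test. *)
Definition inner_cell (U : set (R * R)) (j : nat) : set (R * R) :=
  [set z | [/\ ccell ((cell_of j).2.1%:~R / 2 ^+ (cell_of j).1)
      ((cell_of j).2.2%:~R / 2 ^+ (cell_of j).1) (2 ^+ (cell_of j).1)^-1 `<=` U &
    dcell (cell_of j).1 (cell_of j).2 z]].

Lemma open_bigcup_cells (U : set (R * R)) : open U ->
  U = \bigcup_j inner_cell U j.
Proof.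
move=> oU; apply/seteqP; split => z.
  move=> Uz; have [n nU] := dyadic_cell_in_open oU Uz.
  exists (pickle (n, dyadic n z)) => //; rewrite /inner_cell /cell_of pickleK /=.
  by split => //; apply/dcellP.
by move=> [j _ [sU]] /hcell_sub /sU.
Qed.

Lemma inner_cellP (U : set (R * R)) j : inner_cell U j = set0 \/
  exists n c, inner_cell U j = dcell n c /\
    ccell (c.1%:~R / 2 ^+ n) (c.2%:~R / 2 ^+ n) (2 ^+ n)^-1 `<=` U.
Proof.
case: (pselect (ccell ((cell_of j).2.1%:~R / 2 ^+ (cell_of j).1)
      ((cell_of j).2.2%:~R / 2 ^+ (cell_of j).1) (2 ^+ (cell_of j).1)^-1 `<=` U)) => h.
  by right; exists (cell_of j).1, (cell_of j).2; split => //;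
    apply/seteqP; split => [z []|z].
by left; apply/seteqP; split => // z [].
Qed.

Lemma measurable_inner_cell U j : measurable (inner_cell U j).
Proof.
have [->|[n [c [-> _]]]] := inner_cellP U j; first exact: measurable0.
exact: measurable_hcell.
Qed.

Lemma open_plane_measurable (U : set (R * R)) : open U -> measurable U.
Proof.
move=> /open_bigcup_cells ->; apply: bigcupT_measurable => j.
exact: measurable_inner_cell.
Qed.

End dyadic_algebra.

(** * Stability of outer bounds *)

Section outer_bounds.
Context {R : realType}.
Local Notation mu := (@plane_measure R).
Implicit Types (A B H : set (R * R)) (m : \bar R).

Lemma outer_leS A B m m' : A `<=` B -> outer_le B m -> (m <= m')%E -> outer_le A m'.
Proof.
move=> AB [H mH [BH muH]] mm'; exists H => //; split; first exact: subset_trans BH.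
exact: le_trans mm'.
Qed.

Lemma outer_le_setU A B m m' : outer_le A m -> outer_le B m' ->
  outer_le (A `|` B) (m + m')%E.
Proof.
move=> [H mH [AH muH]] [K mK [BK muK]]; exists (H `|` K); first exact: measurableU.
split; first exact: setUSS.
by apply: le_trans (leeD muH muK); exact: measureU2.
Qed.

Lemma outer_le_bigcup (A : (set (R * R))^nat) (m : (\bar R)^nat) :
  (forall n, outer_le (A n) (m n)) -> outer_le (\bigcup_n A n) (\sum_(0 <= n <oo) m n)%E.
Proof.
move=> h; have /choice[H HP] : forall n, exists H, [/\ measurable H, A n `<=` H & (mu H <= m n)%E].
  by move=> n; have [H mH [? ?]] := h n; exists H.
have mH n : measurable (H n) by have [] := HP n.
exists (\bigcup_n H n); first exact: bigcupT_measurable.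
split; first by move=> z [n _ Az]; exists n => //; have [_ + _] := HP n; apply.
have mU : measurable (\bigcup_n H n) by exact: bigcupT_measurable.
apply: le_trans (measure_sigma_subadditive mu mH mU (@subset_refl _ _)) _.
by apply: lee_nneseries => n _ //; have [] := HP n.
Qed.

(** Covers of increasing sets need not increase. The intersections [K n] of all covers from the
    [n]-th on do, they still cover, and their measure is at most [m]. *)
Lemma outer_le_nondecreasing (A : (set (R * R))^nat) m :
  (forall n, A n `<=` A n.+1) -> (forall n, outer_le (A n) m) ->
  outer_le (\bigcup_n A n) m.
Proof.
move=> Am h; have /choice[H HP] : forall n, exists H, [/\ measurable H, A n `<=` H & (mu H <= m)%E].
  by move=> n; have [H mH [? ?]] := h n; exists H.
have Amono n k : (n <= k)%N -> A n `<=` A k.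
  elim: k => [|k IH]; first by rewrite leqn0 => /eqP ->.
  rewrite leq_eqVlt => /orP[/eqP -> //|]; rewrite ltnS => /IH h'.
  exact: subset_trans (Am k).
pose K n := \bigcap_(k in [set k | (n <= k)%N]) H k.
have mK n : measurable (K n).
  by apply: bigcap_measurable => [|k _]; [exists n => /=|have [] := HP k].
have mU : measurable (\bigcup_n K n) by exact: bigcupT_measurable.
exists (\bigcup_n K n) => //; split.
  move=> z [n _ Az]; exists n => // k /= nk; have [_ + _] := HP k; apply.
  exact: Amono Az.
have Kmono : {homo K : n k / (n <= k)%N >-> (n <= k)%O}.
  move=> n k nk; apply/subsetPset => z Kz j /= kj; apply: Kz => /=.
  exact: leq_trans kj.
have cK := @nondecreasing_cvg_mu _ _ _ mu _ mK mU Kmono.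
rewrite -(cvg_lim _ cK)//; apply: lime_le; first by apply/cvg_ex; eexists; exact: cK.
apply: nearW => n /=; have [mHn _] := HP n; apply: le_trans.
by apply: le_measure; rewrite ?inE; [exact: mK|exact: mHn|move=> z; apply => /=].
Qed.

Lemma outer_le_cvg A (m : (\bar R)^nat) l : m @ \oo --> l ->
  (forall n, outer_le A (m n)) -> outer_le A l.
Proof.
move=> ml h; have /choice[H HP] : forall n, exists H, [/\ measurable H, A `<=` H & (mu H <= m n)%E].
  by move=> n; have [H mH [? ?]] := h n; exists H.
have mI : measurable (\bigcap_n H n).
  by apply: bigcapT_measurable => n; have [] := HP n.
exists (\bigcap_n H n) => //; split.
  by move=> z Az n _; have [_ + _] := HP n; apply.
rewrite -(cvg_lim _ ml)//; apply: lime_ge; first by apply/cvg_ex; exists l.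
apply: nearW => n; have [mHn _] := HP n; apply: le_trans.
by apply: le_measure; rewrite ?inE; [exact: mI|exact: mHn|move=> z; apply].
Qed.

Lemma outer_le0 m : (0 <= m)%E -> outer_le set0 m.
Proof. by move=> m0; exists set0 => //; split => //; rewrite measure0. Qed.

End outer_bounds.

Section hcell.
Context {R : realType}.

Lemma hcell_children (x y s : R) : 0 < s -> hcell x y s =
  ((hcell x y (s / 2) `|` hcell (x + s / 2) y (s / 2)) `|`
  (hcell x (y + s / 2) (s / 2) `|` hcell (x + s / 2) (y + s / 2) (s / 2))).
Proof.
move=> s0; apply/seteqP; split => z.
  move=> [z1 z2]; case: (ltP z.1 (x + s / 2)) => h1; case: (ltP z.2 (y + s / 2)) => h2.
  - by left; left; split; lra.
  - by right; left; split; lra.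
  - by left; right; split; lra.
  - by right; right; split; lra.
by case=> -[] [? ?]; split; lra.
Qed.

End hcell.

(** * From squares to measurable sets *)

Section outer_bound_by_measure.
Context {R : realType}.
Variables (f : R * R -> R * R) (nu : {measure set (R * R) -> \bar R}) (U : set (R * R)).
Hypotheses (oU : open U)
  (cellP : forall x y s, 0 < s -> ccell x y s `<=` U ->
    outer_le (f @` ccell x y s) (nu (hcell x y s)))
  (cell_fin : forall x y s, 0 < s -> ccell x y s `<=` U -> (nu (hcell x y s) < +oo)%E).

Let bound (x y s : R) (E : set (R * R)) :=
  outer_le (f @` (E `&` hcell x y s)) (nu (E `&` hcell x y s)).

Let ccell_child (x y s a b : R) : 0 < s -> a = x \/ a = x + s / 2 ->
  b = y \/ b = y + s / 2 -> ccell a b (s / 2) `<=` ccell x y s.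
Proof. by move=> s0 [->|->] [->|->] z [? ?]; split; lra. Qed.

Lemma boundU (E A B : set (R * R)) : measurable E -> measurable A -> measurable B ->
  [disjoint A & B] ->
  outer_le (f @` (E `&` A)) (nu (E `&` A)) -> outer_le (f @` (E `&` B)) (nu (E `&` B)) ->
  outer_le (f @` (E `&` (A `|` B))) (nu (E `&` (A `|` B))).
Proof.
move=> mE mA mB AB hA hB; rewrite setIUr image_setU measureU; last 3 first.
- exact: measurableI.
- exact: measurableI.
- apply/seteqP; split => // z [[_ Az] [_ Bz]].
  by move/disj_setPS : AB => /(_ z); apply.
exact: outer_le_setU.
Qed.

Let dyadic_corner n (a : R) := exists i : int, a = i%:~R / 2 ^+ n.

(** [d] is the number of generations between the square and the cells indexed by [S]. *)
Let bound_dyadic d n x y (S : set (int * int)) : dyadic_corner n x -> dyadic_corner n y ->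
  ccell x y (2 ^+ n)^-1 `<=` U -> bound x y (2 ^+ n)^-1 (@dyadic R (n + d) @^-1` S).
Proof.
elim: d n x y => [|d IH] n x y [i xi] [j yj] sub.
  rewrite addn0 /bound.
  have hE : hcell x y (2 ^+ n)^-1 = dcell n (i, j) by rewrite /dcell xi yj.
  have [Sij|nSij] := pselect (S (i, j)).
    rewrite (_ : _ `&` _ = hcell x y (2 ^+ n)^-1).
      have s0 : 0 < (2 ^+ n)^-1 :> R by rewrite invr_gt0 exprn_gt0.
      apply: outer_leS (cellP s0 sub) _ => //.
      by apply: image_subset; exact: hcell_sub.
    apply: setIidr; rewrite hE => z /dcellP /= zij.
    by rewrite /preimage /= zij.
  rewrite (_ : _ `&` _ = set0).
    by rewrite image_set0 measure0; exact: outer_le0.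
  apply/seteqP; split => // z []; rewrite hE => + /dcellP zij.
  by rewrite /preimage /= zij.
have s0 : 0 < (2 ^+ n)^-1 :> R by rewrite invr_gt0 exprn_gt0.
have sE : (2 ^+ n)^-1 / 2 = (2 ^+ n.+1)^-1 :> R by rewrite exprSr invfM.
have c1 (a : R) : dyadic_corner n a -> dyadic_corner n.+1 a.
  move=> [k ->]; exists (k * 2); rewrite intrM exprSr; field.
  by rewrite expf_neq0.
have c2 (a : R) : dyadic_corner n a -> dyadic_corner n.+1 (a + (2 ^+ n)^-1 / 2).
  move=> [k ->]; exists (k * 2 + 1); rewrite intrD intrM exprSr; field.
  by rewrite expf_neq0.
have dx : dyadic_corner n x by exists i.
have dy : dyadic_corner n y by exists j.
have IH' a b : a = x \/ a = x + (2 ^+ n)^-1 / 2 -> b = y \/ b = y + (2 ^+ n)^-1 / 2 ->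
    bound a b ((2 ^+ n)^-1 / 2) (@dyadic R (n + d.+1) @^-1` S).
  move=> ha hb; rewrite addnS -addSn sE; apply: IH.
  - by case: ha => ->; [exact: c1|exact: c2].
  - by case: hb => ->; [exact: c1|exact: c2].
  - rewrite -sE; apply: subset_trans sub; exact: ccell_child.
have mS : measurable (@dyadic R (n + d.+1) @^-1` S).
  exact: measurable_dyadic.
rewrite /bound hcell_children//.
have dis A B : (forall z, A z -> B z -> False) -> [disjoint A & B].
  by move=> h; apply/disj_setPS => z [Az Bz]; exact: h Az Bz.
have mh := @measurable_hcell R.
apply: boundU => //; try exact: measurableU.
- by apply: dis => z [] [? ?] [] [? ?]; lra.
- apply: boundU => //; first by apply: dis => z [? ?] [? ?]; lra.
  + by apply: IH'; left.
  + by apply: IH'; [right|left].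
- apply: boundU => //; first by apply: dis => z [? ?] [? ?]; lra.
  + by apply: IH'; [left|right].
  + by apply: IH'; right.
Qed.

(** A monotone class argument over the dyadic sets, confined to one square because continuity of
    [nu] from above requires finite measure. *)
Let bound_cell n (i j : int) (E : set (R * R)) : measurable E ->
  ccell (i%:~R / 2 ^+ n) (j%:~R / 2 ^+ n) (2 ^+ n)^-1 `<=` U ->
  bound (i%:~R / 2 ^+ n) (j%:~R / 2 ^+ n) (2 ^+ n)^-1 E.
Proof.
move=> mE sub; rewrite /bound; set Q := hcell _ _ _.
have mQ : measurable Q by exact: measurable_hcell.
have Qfin : (nu Q < +oo)%E by apply: cell_fin => //; rewrite invr_gt0 exprn_gt0.
suff : [set E | measurable E /\ outer_le (f @` (E `&` Q)) (nu (E `&` Q))] E by case.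
suff : <<s @dyadic_sets R >> `<=` [set E | measurable E /\ outer_le (f @` (E `&` Q)) (nu (E `&` Q))].
  by apply; exact: measurable_dyadic_sets.
apply: monotone_class_theorem => {E mE}.
- exact: dyadic_sets0.
- exact: dyadic_setsC.
- exact: dyadic_setsI.
- move=> _ [m [S ->]] /=; split; last first.
    (* The level is raised to at least [n], so that the square is a union of cells. *)
    rewrite (dyadic_sets_refine m n S) addnC; apply: bound_dyadic => //; last 2 first.
    by exists i.
    by exists j.
  exact: measurable_dyadic.
- split=> F Fm FP /=; have mF k : measurable (F k) by have [] := FP k.
    split; first exact: bigcupT_measurable.
    rewrite setI_bigcupl image_bigcup; apply: outer_le_nondecreasing => [k|k].
      by apply: image_subset; exact: setSI.
    apply: outer_leS (FP k).2 _ => //; apply: le_measure; rewrite ?inE.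
    + exact: measurableI.
    + by apply: bigcupT_measurable => l; exact: measurableI.
    + by move=> z Fz; exists k.
  split; first exact: bigcapT_measurable.
  have IE : (\bigcap_k F k) `&` Q = \bigcap_k (F k `&` Q).
    apply/seteqP; split => [z [Fz Qz] k _|z h]; first by split => //; exact: Fz.
    by split => [k _|]; [have [] := h k I|have [] := h 0%N I].
  have mI k : measurable (F k `&` Q) by exact: measurableI.
  have mono : {homo (fun k => F k `&` Q) : k l / (k <= l)%N >-> (l <= k)%O}.
    move=> k l kl; apply/subsetPset; apply: setSI; elim: l kl => [|l IHl].
      by rewrite leqn0 => /eqP ->.
    rewrite leq_eqVlt => /orP[/eqP -> //|]; rewrite ltnS => /IHl h.
    exact: subset_trans (Fm l) h.
  have F0 : (nu (F 0%N `&` Q) < +oo)%E.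
    by apply: le_lt_trans Qfin; apply: le_measure; rewrite ?inE//; exact: subIsetr.
  rewrite IE; apply: (outer_le_cvg (@nonincreasing_cvg_mu _ _ _ nu _ F0 mI (bigcapT_measurable mI) mono)).
  move=> k /=; apply: outer_leS (FP k).2 _ => //.
  by apply: image_subset => z; apply.
Qed.

(** [seqDU] makes the overlapping inner cells disjoint, so that the measures of the pieces add up to
    [nu E]. *)
Lemma outer_le_measure (E : set (R * R)) : measurable E -> E `<=` U ->
  outer_le (f @` E) (nu E).
Proof.
move=> mE EU; pose C := seqDU (inner_cell U).
have mC j : measurable (C j).
  rewrite /C /seqDU; apply: measurableD; first exact: measurable_inner_cell.
  by apply: bigsetU_measurable => i _; exact: measurable_inner_cell.
have EE : E = \bigcup_j (E `&` C j).
  by rewrite -setI_bigcupr /C -seqDU_bigcup_eq -open_bigcup_cells// setIidl.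
have -> : nu E = (\sum_(0 <= j <oo) nu (E `&` C j))%E.
  rewrite {1}EE measure_bigcup//.
  - by apply: eq_eseriesl => // n; rewrite in_setT.
  - by move=> j _; exact: measurableI.
  - by apply: trivIset_setIl; exact: trivIset_seqDU.
rewrite {1}EE image_bigcup; apply: outer_le_bigcup => j.
have CQ : C j `<=` inner_cell U j by exact: subDsetl.
have [Q0|[n [c [Qc sub]]]] := inner_cellP U j.
  have -> : E `&` C j = set0.
    by apply/seteqP; split => // z [_ /CQ]; rewrite Q0.
  by rewrite image_set0 measure0; exact: outer_le0.
have := @bound_cell n c.1 c.2 (E `&` C j) (measurableI _ _ mE (mC j)) sub.
rewrite /bound -/(dcell n c) -Qc setIidl//.
by move=> z [_ /CQ].
Qed.

End outer_bound_by_measure.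

(** * The area inequality for C^1 plane maps *)

Section plane_C1.
Context {R : realType}.
Local Notation mu := (@plane_measure R).
Implicit Types (g h : R * R -> R) (U : set (R * R)) (z u v : R * R).

Lemma open_continuous_plane_measurable_fun U h : open U ->
  (forall z, U z -> {for z, continuous h}) -> measurable_fun U h.
Proof.
move=> oU ch; apply: (measurability (@RGenOInfty.G R)).
  exact: RGenOInfty.measurableE.
move=> _ [_ [a ->] <-]; apply: open_plane_measurable.
rewrite openE => z [Uz]; rewrite /= in_itv /= andbT => az.
have N1 : \forall w \near z, U w by exact: open_nbhs_nbhs.
have N2 : \forall w \near z, a < h w by exact: (cvgr_gt (h z) (ch _ Uz)).
by apply: filterS2 N1 N2 => w ? ?; split => //=; rewrite in_itv /= andbT.
Qed.

Lemma differentiable_expansion g z : differentiable g z -> forall e : R, 0 < e ->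
  exists2 d : R, 0 < d & forall u, `|u - z| < d ->
    `|g u - g z - ('D_(1, 0) g z * (u - z).1 + 'D_(0, 1) g z * (u - z).2)| <= e * `|u - z|.
Proof.
move=> dg e e0; have [_ /eqaddoP E] := (diff_locallyP z g).1 dg.
move: (E e e0) => {}E.
have {E} : \forall x \near (0 : R * R), `|g (x + z) - (g z + 'd g z x)| <= e * `|x| by [].
move=> /nbhs_normP[d /= d0 dP]; exists d => // u uz.
have /dP : ball_ (fun x : R * R => `|x|) 0 d (u - z) by rewrite /ball_ /= sub0r normrN.
rewrite subrK /= !deriveE//; congr (`|_| <= _).
have -> : 'd g z (u - z) = (u - z).1 * 'd g z (1, 0) + (u - z).2 * 'd g z (0, 1).
  have {1}-> : u - z = (u - z).1 *: (1, 0) + (u - z).2 *: (0, 1) :> R * R.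
    by congr pair; rewrite /= /GRing.scale /= !(mulr1, mulr0, addr0, add0r).
  by rewrite linearD !linearZ.
by ring.
Qed.

Definition C1_at g z := differentiable g z /\ forall v, {for z, continuous ('D_v g)}.

Lemma class_C1P U g : class_C 1 U g <-> forall z, U z -> C1_at g z.
Proof.
rewrite /class_C; split=> [[dg cg] z Uz|h].
  by split; [exact: dg|move=> v; apply: cg; rewrite inE].
by split => [z /h[]//|v z]; rewrite inE => /h[_]; apply.
Qed.

Definition jac_coef (g1 g2 : R * R -> R) z : R * R * R * R :=
  ('D_(1, 0) g1 z, 'D_(0, 1) g1 z, 'D_(1, 0) g2 z, 'D_(0, 1) g2 z).

Lemma linear_det_jac g1 g2 z : linear_det (jac_coef g1 g2 z) = wedge g1 g2 z.
Proof. by []. Qed.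

Lemma pair_has_linear_part g1 g2 z : differentiable g1 z -> differentiable g2 z ->
  has_linear_part (fun u => (g1 u, g2 u)) z (jac_coef g1 g2 z).
Proof.
move=> d1 d2 e e0; have [a a0 aP] := differentiable_expansion d1 e0.
have [b b0 bP] := differentiable_expansion d2 e0.
exists (Num.min a b) => [|u]; first by rewrite lt_min a0.
rewrite lt_min => /andP[/aP ha /bP hb].
by apply: pair_norm_le; rewrite /linear_map /jac_coef /=.
Qed.

Lemma wedge_continuous g1 g2 z : C1_at g1 z -> C1_at g2 z ->
  {for z, continuous (wedge g1 g2)}.
Proof.
move=> [_ c1] [_ c2]; rewrite /wedge; apply: continuousB; apply: continuousM;
  [exact: c1|exact: c2|exact: c1|exact: c2].
Qed.

Lemma plane_measure_hcell (x y s : R) : 0 < s -> mu (hcell x y s) = (s ^+ 2)%:E.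
Proof.
move=> s0; rewrite hcellE.
have itvE (t : R) : lebesgue_measure `[t, t + s[%classic = s%:E.
  by rewrite lebesgue_measure_itv/= lte_fin ltrDl s0 -EFinD addrC addKr.
transitivity (lebesgue_measure `[x, (x + s)%R[%classic * lebesgue_measure `[y, (y + s)%R[%classic)%E.
  exact: product_measure1E.
by rewrite !itvE -EFinM expr2.
Qed.

(** * Measures with a continuous density *)

Section density.
Variables (U : set (R * R)) (j : R * R -> R).
Hypotheses (oU : open U) (cj : forall z, U z -> {for z, continuous j})
  (j0 : forall z, 0 <= j z).

(** Cut off outside [U], so that the density is measurable on the whole plane. *)
Let jU : R * R -> \bar R := EFin \o (j \_ U).

Let mjU : measurable_fun setT jU.
Proof.
apply/measurable_EFinP; apply: (measurable_restrictT j (open_plane_measurable oU)).1.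
exact: open_continuous_plane_measurable_fun.
Qed.

Let jU0 z : (0 <= jU z)%E.
Proof. by rewrite /jU /= lee_fin patchE; case: ifP. Qed.

Let nu (E : set (R * R)) : \bar R := (\int[mu]_(x in E) jU x)%E.

Let nu0 : nu set0 = 0%E. Proof. exact: integral_set0. Qed.

Let nu_ge0 E : (0 <= nu E)%E. Proof. exact: integral_ge0. Qed.

Let nu_sigma : semi_sigma_additive nu.
Proof.
move=> F mF tF mUF; rewrite /nu ge0_integral_bigcup//; last exact: measurable_funTS.
by apply: is_cvg_ereal_nneg_natsum_cond => n _ _; exact: nu_ge0.
Qed.

Definition density_measure : {measure set (R * R) -> \bar R} :=
  HB.pack nu (isMeasure.Build _ _ _ nu nu0 nu_ge0 nu_sigma).

Lemma density_measureE E : measurable E -> E `<=` U ->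
  density_measure E = (\int[mu]_(x in E) (j x)%:E)%E.
Proof.
move=> mE EU; apply: eq_integral => x /set_mem /EU Ux.
by rewrite /jU /= patchE mem_set.
Qed.

Lemma density_measure_le (c : R) E : measurable E -> 0 <= c ->
  (forall z, E z -> U z -> j z <= c) -> (density_measure E <= c%:E * mu E)%E.
Proof.
move=> mE c0 jc; rewrite -integral_cst//; apply: ge0_le_integral => //.
  exact: measurable_funTS.
by move=> x Ex; rewrite /jU /= lee_fin patchE; case: ifP => // /set_mem; exact: jc.
Qed.

Lemma density_measure_ge (c : R) E : measurable E -> E `<=` U -> 0 <= c ->
  (forall z, E z -> c <= j z) -> (c%:E * mu E <= density_measure E)%E.
Proof.
move=> mE EU c0 jc; rewrite -integral_cst//; apply: ge0_le_integral => //.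
  exact: measurable_funTS.
by move=> x Ex; rewrite /jU /= lee_fin patchE mem_set ?jc//; exact: EU.
Qed.

Let hcell_childrenE (x y s : R) : 0 < s -> density_measure (hcell x y s) =
  (density_measure (hcell x y (s / 2)) + density_measure (hcell (x + s / 2) y (s / 2)) +
  (density_measure (hcell x (y + s / 2) (s / 2)) +
   density_measure (hcell (x + s / 2) (y + s / 2) (s / 2))))%E.
Proof.
move=> s0; rewrite hcell_children// !measureU//;
  try (by apply/seteqP; split => // z [[? ?] [? ?]]; lra);
  try exact: measurable_hcell; try (by apply: measurableU; exact: measurable_hcell).
by apply/seteqP; split => // z [[] [? ?] [] [? ?]]; lra.
Qed.

Lemma density_measure_cell_fin x y s : 0 < s -> ccell x y s `<=` U ->
  (density_measure (hcell x y s) < +oo)%E.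
Proof.
move=> s0 sU; apply: (@bisection _ (fun x y s => (density_measure (hcell x y s) < +oo)%E)) => //.
  move=> a b r r0 h1 h2 h3 h4; rewrite hcell_childrenE//.
  by apply: lte_add_pinfty; apply: lte_add_pinfty.
move=> z /sU Uz; have /cvgrPdist_lt /(_ 1 ltr01) /nbhs_normP[d /= d0 dP] := cj Uz.
exists d => // a b r r0 rd Cz Cs.
have c0 : 0 <= j z + 1 by rewrite addr_ge0.
apply: (le_lt_trans (density_measure_le (measurable_hcell a b r) c0 _)).
  move=> w /hcell_sub Cw _.
  have /dP /= : `|z - w| < d by exact: le_lt_trans (ccell_norm Cz Cw) rd.
  by rewrite ltr_norml => /andP[? ?]; lra.
by rewrite plane_measure_hcell// -EFinM ltry.
Qed.

(** On squares, bisection with an allowance of [e] per unit of area, which adds up exactly over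
    quarters: a small square around [z] has an image of outer area at most [(j z + e / 2) * r ^+ 2],
    while [j] is at least [j z - e / 2] on it. Then [e] tends to 0. Neither injectivity nor a change
    of variables formula enters. *)
Lemma outer_le_density (f : R * R -> R * R) :
  (forall z, U z -> exists2 k, has_linear_part f z k & `|linear_det k| = j z) ->
  forall E, measurable E -> E `<=` U ->
  outer_le (f @` E) (\int[mu]_(x in E) (j x)%:E)%E.
Proof.
move=> fk E mE EU; rewrite -density_measureE//.
apply: (outer_le_measure oU) => // [x y s s0 sU|x y s s0 sU]; last first.
  exact: density_measure_cell_fin.
suff W (e : R) : 0 < e -> outer_le (f @` ccell x y s)
    (density_measure (hcell x y s) + (e * s ^+ 2)%:E)%E.
  apply: (@outer_le_cvg _ _ (fun n => (density_measure (hcell x y s) + (n.+1%:R^-1 * s ^+ 2)%:E)%E)).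
    rewrite -[X in _ --> X]adde0; apply: cvgeD; [exact: fin_num_adde_defl|exact: cvg_cst|].
    apply/fine_cvgP; split; first by apply: nearW.
    rewrite -[X in _ --> X](mul0r (s ^+ 2)); apply: cvgM; last exact: cvg_cst.
    exact: cvg_harmonic.
  by move=> n; apply: W; rewrite invr_gt0.
move=> e0; apply: (@bisection _ (fun x y s => outer_le (f @` ccell x y s)
    (density_measure (hcell x y s) + (e * s ^+ 2)%:E)%E)) => //.
  move=> a b r r0 h1 h2 h3 h4.
  have := outer_le_setU (outer_le_setU h1 h2) (outer_le_setU h3 h4).
  rewrite -!image_setU => h; apply: outer_leS h _.
    apply: image_subset => z /(ccell_children _ _ _ r0).
    by case=> ?; [left; left|left; right|right; left|right; right].
  rewrite (hcell_childrenE a b r0).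
  have -> : (e * r ^+ 2)%:E = ((e * (r / 2) ^+ 2)%:E + (e * (r / 2) ^+ 2)%:E +
      ((e * (r / 2) ^+ 2)%:E + (e * (r / 2) ^+ 2)%:E))%E.
    by rewrite -!EFinD; congr EFin; field.
  have AC (p q u v t : \bar R) : (p + t + (q + t) + (u + t + (v + t)) =
      p + q + (u + v) + (t + t + (t + t)))%E.
    by rewrite (addeACA p) (addeACA u) (addeACA (p + q)%E).
  by rewrite -AC.
move=> z /sU Uz; have [k fzk kE] := fk _ Uz.
have e2 : 0 < e / 2 by rewrite divr_gt0.
have [d1 d10 d1P] := outer_le_cell e2 fzk.
have /cvgrPdist_lt /(_ _ e2) /nbhs_normP[d2 /= d20 d2P] := cj Uz.
exists (Num.min d1 d2) => [|a b r r0]; first by rewrite lt_min d10.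
rewrite lt_min => /andP[rd1 rd2] Cz Cs.
apply: outer_leS (d1P _ _ _ r0 rd1 Cz) _ => //; rewrite kE.
have -> : ((j z + e / 2) * r ^+ 2)%:E = (((j z - e / 2) * r ^+ 2)%:E + (e * r ^+ 2)%:E)%E.
  by rewrite -EFinD; congr EFin; field.
(* The lower bound may be negative; then nonnegativity of the measure suffices. *)
apply: leeD => //; have [c0|c0] := leP (j z - e / 2) 0.
  apply: (@le_trans _ _ 0%E) => //; rewrite lee_fin mulr_le0_ge0//.
  by rewrite exprn_ge0// ltW.
rewrite EFinM -(plane_measure_hcell a b r0); apply: density_measure_ge.
- exact: measurable_hcell.
- by move=> w /hcell_sub /Cs /sU.
- exact: ltW.
move=> w /hcell_sub Cw.
have /d2P /= : `|z - w| < d2 by exact: le_lt_trans (ccell_norm Cz Cw) rd2.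
by rewrite ltr_norml => /andP[? ?]; lra.
Qed.

End density.

Lemma outer_le_C1 U g1 g2 : open U -> (forall z, U z -> C1_at g1 z) ->
  (forall z, U z -> C1_at g2 z) -> forall E, measurable E -> E `<=` U ->
  outer_le ((fun z => (g1 z, g2 z)) @` E) (\int[mu]_(x in E) (`|wedge g1 g2 x|)%:E)%E.
Proof.
move=> oU c1 c2 E mE EU; apply: (@outer_le_density U (fun x => `|wedge g1 g2 x|)) => //.
  move=> z Uz; apply: (@continuous_comp _ _ _ (wedge g1 g2) (fun t => `|t|)).
    by apply: wedge_continuous; [exact: c1|exact: c2].
  exact: norm_continuous.
move=> z Uz; exists (jac_coef g1 g2 z) => //.
by apply: pair_has_linear_part; [exact: (c1 _ Uz).1|exact: (c2 _ Uz).1].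
Qed.

End plane_C1.

(** * C^1 functions and bumps *)

Section C1_calculus.
Context {R : realType}.
Implicit Types (f g : R * R -> R) (U V : set (R * R)) (z v w : R * R).

Lemma near_eq_differentiable f g z : (\forall w \near z, f w = g w) ->
  differentiable f z -> differentiable g z.
Proof.
move=> fg df; have [cd /eqaddoP E] := (diff_locallyP z f).1 df.
have fgz : f z = g z by exact: nbhs_singleton fg.
have Eg : g \o shift z = cst (g z) + 'd f z +o_ (0 : R * R) id.
  apply/eqaddoP => e e0; have := E e e0.
  have : \forall x \near (0 : R * R), f (x + z) = g (x + z).
    have sz : shift z x @[x --> (0 : R * R)] --> z.
      by rewrite -[X in _ --> X](add0r z); apply: cvgD; [exact: cvg_id|exact: cvg_cst].
    exact: (sz _ fg).
  by apply: filterS2 => x fgx; rewrite /= !fctE /= fgx fgz.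
have dE := diff_unique cd Eg.
by apply/diff_locallyP; rewrite dE; split.
Qed.

Definition C1_on U f := forall z, U z -> C1_at f z.

Lemma near_eq_continuous_at (T : topologicalType) (f g : T -> R) (z : T) : (\forall w \near z, f w = g w) ->
  {for z, continuous f} -> {for z, continuous g}.
Proof.
move=> fg cf; rewrite /prop_for /continuous_at -(nbhs_singleton fg).
by apply: cvg_trans cf; apply: near_eq_cvg; move: fg; apply: filterS => w ->.
Qed.

Lemma pair_continuous_at (T : topologicalType) (f g : T -> R) (p : T) :
  {for p, continuous f} -> {for p, continuous g} ->
  {for p, continuous (fun q => (f q, g q))}.
Proof.
move=> cf cg A /= nA.
exact: (@cvg_pair _ _ _ (nbhs p) (nbhs (f p)) (nbhs (g p)) _ _ _ f g cf cg A nA).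
Qed.

Lemma C1_at_near f g z : (\forall w \near z, f w = g w) -> C1_at f z -> C1_at g z.
Proof.
move=> fg [df cf]; split; first exact: near_eq_differentiable df.
move=> v; apply: near_eq_continuous_at (cf v).
by have /nbhs_interior := fg; apply: filterS => w fgw; exact: near_eq_derive.
Qed.

Let C1_on_derive U f (D : R * R -> R * R -> R) : open U ->
  (forall z, U z -> differentiable f z) ->
  (forall z, U z -> forall v, 'D_v f z = D v z) ->
  (forall z, U z -> forall v, {for z, continuous (D v)}) -> C1_on U f.
Proof.
move=> oU df dE cD z Uz; split; first exact: df.
move=> v; apply: near_eq_continuous_at (cD z Uz v).
have : \forall w \near z, U w by exact: open_nbhs_nbhs.
by apply: filterS => w Uw; rewrite dE.
Qed.

Lemma C1_on_continuous U f z : C1_on U f -> U z -> {for z, continuous f}.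
Proof. by move=> cf Uz; apply: differentiable_continuous; exact: (cf z Uz).1. Qed.

Lemma C1_on_cst U (c : R) : open U -> C1_on U (fun=> c).
Proof.
move=> oU; apply: (C1_on_derive (D := fun _ _ => 0)) => // z Uz v.
- exact: derive_cst.
- exact: cst_continuous.
Qed.

Lemma C1_onD U f g : open U -> C1_on U f -> C1_on U g -> C1_on U (fun z => f z + g z).
Proof.
move=> oU cf cg.
apply: (C1_on_derive (D := fun v z => 'D_v f z + 'D_v g z)) => // z Uz.
- by apply: differentiableD; [exact: (cf z Uz).1|exact: (cg z Uz).1].
- by move=> v; apply: deriveD; apply: diff_derivable; [exact: (cf z Uz).1|exact: (cg z Uz).1].
- by move=> v; apply: continuousD; [exact: (cf z Uz).2|exact: (cg z Uz).2].
Qed.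

Lemma C1_onM U f g : open U -> C1_on U f -> C1_on U g -> C1_on U (fun z => f z * g z).
Proof.
move=> oU cf cg.
apply: (C1_on_derive (D := fun v z => f z * 'D_v g z + g z * 'D_v f z)) => // z Uz.
- by apply: differentiableM; [exact: (cf z Uz).1|exact: (cg z Uz).1].
- by move=> v; apply: deriveM; apply: diff_derivable; [exact: (cf z Uz).1|exact: (cg z Uz).1].
- move=> v; apply: continuousD; apply: continuousM.
  + exact: C1_on_continuous Uz.
  + exact: (cg z Uz).2.
  + exact: C1_on_continuous Uz.
  + exact: (cf z Uz).2.
Qed.

Lemma derive_comp_plane (h : R * R -> R) (tau : R * R -> R * R) z v :
  differentiable (fst \o tau) z -> differentiable (snd \o tau) z ->
  differentiable h (tau z) ->
  differentiable (h \o tau) z /\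
  'D_v (h \o tau) z = 'D_v (fst \o tau) z * 'D_(1, 0) h (tau z) +
                      'D_v (snd \o tau) z * 'D_(0, 1) h (tau z).
Proof.
move=> d1 d2 dh.
have tauE : tau = (fun z => ((fst \o tau) z, (snd \o tau) z)).
  by apply/funext => w /=; case: (tau w).
have dtau : differentiable tau z by rewrite tauE; exact: differentiable_pair.
have dht : differentiable (h \o tau) z by exact: differentiable_comp.
split => //; rewrite (deriveE _ dht).
have -> : 'd (h \o tau) z v = 'd h (tau z) ('d tau z v).
  exact: (congr1 (@^~ v) (diff_comp dtau dh)).
have -> : 'd tau z v = ('D_v (fst \o tau) z, 'D_v (snd \o tau) z).
  rewrite [in LHS]tauE (deriveE _ d1) (deriveE _ d2).
  exact: (congr1 (@^~ v) (diff_pair d1 d2)).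
rewrite (deriveE _ dh) (deriveE _ dh); move: ('D_v _ z) ('D_v _ z) => b a.
have -> : (a, b) = a *: (1, 0) + b *: (0, 1) :> R * R.
  by congr pair; rewrite /= /GRing.scale /= ?mulr1 ?mulr0 ?addr0 ?add0r.
by rewrite linearD !linearZ.
Qed.

Lemma C1_on_comp U V f (tau : R * R -> R * R) : open U -> C1_on V f ->
  C1_on U (fst \o tau) -> C1_on U (snd \o tau) -> (forall z, U z -> V (tau z)) ->
  C1_on U (f \o tau).
Proof.
move=> oU cf c1 c2 UV.
apply: (C1_on_derive (D := fun v z => 'D_v (fst \o tau) z * 'D_(1, 0) f (tau z) +
   'D_v (snd \o tau) z * 'D_(0, 1) f (tau z))) => // z Uz.
- by have [] := derive_comp_plane 0 (c1 z Uz).1 (c2 z Uz).1 (cf _ (UV z Uz)).1.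
- by move=> v; have [] := derive_comp_plane v (c1 z Uz).1 (c2 z Uz).1 (cf _ (UV z Uz)).1.
have ct : {for z, continuous tau}.
  rewrite (_ : tau = fun z => ((fst \o tau) z, (snd \o tau) z)).
    apply: differentiable_continuous; apply: differentiable_pair;
      [exact: (c1 z Uz).1|exact: (c2 z Uz).1].
  by apply/funext => w /=; case: (tau w).
move=> v; apply: continuousD; apply: continuousM.
- exact: (c1 z Uz).2.
- exact: (@continuous_comp _ _ _ tau ('D_(1, 0) f) z ct ((cf _ (UV z Uz)).2 (1, 0))).
- exact: (c2 z Uz).2.
- exact: (@continuous_comp _ _ _ tau ('D_(0, 1) f) z ct ((cf _ (UV z Uz)).2 (0, 1))).
Qed.

Lemma C1_on_comp1 U f (phi : R -> R) : open U -> C1_on U f ->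
  (forall t, differentiable phi t) -> continuous (phi^`())%classic -> C1_on U (phi \o f).
Proof.
move=> oU cf dphi cphi.
apply: (C1_on_derive (D := fun v z => 'D_v f z * (phi^`())%classic (f z))) => // z Uz.
- by apply: differentiable_comp; [exact: (cf z Uz).1|exact: dphi].
- move=> v; have df := (cf z Uz).1.
  have dc : differentiable (phi \o f) z by apply: differentiable_comp.
  rewrite (deriveE _ dc) (deriveE _ df).
  rewrite (_ : 'd (phi \o f) z v = 'd phi (f z) ('d f z v)).
    by rewrite diff1E.
  exact: (congr1 (@^~ v) (diff_comp df (dphi _))).
- move=> v; apply: continuousM; first exact: (cf z Uz).2.
  exact: (@continuous_comp _ _ _ f (phi^`())%classic z (C1_on_continuous cf Uz) (cphi _)).
Qed.

Lemma C1_on_fst : C1_on setT (fst : R * R -> R).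
Proof.
have cfst : continuous (fst : R * R -> R) by move=> z; exact: cvg_fst.
have dfst z : differentiable (fst : R * R -> R) z by exact: linear_differentiable.
apply: (C1_on_derive (D := fun v _ => v.1)).
- exact: openT.
- by move=> z _; exact: dfst.
- by move=> z _ v; rewrite (deriveE _ (dfst z)) (diff_lin z cfst).
- by move=> z _ v; exact: cst_continuous.
Qed.

Lemma C1_on_snd : C1_on setT (snd : R * R -> R).
Proof.
have csnd : continuous (snd : R * R -> R) by move=> z; exact: cvg_snd.
have dsnd z : differentiable (snd : R * R -> R) z by exact: linear_differentiable.
apply: (C1_on_derive (D := fun v _ => v.2)).
- exact: openT.
- by move=> z _; exact: dsnd.
- by move=> z _ v; rewrite (deriveE _ (dsnd z)) (diff_lin z csnd).
- by move=> z _ v; exact: cst_continuous.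
Qed.

(** Twice the square of the positive part, hence C^1. *)
Definition sqpos (s : R) : R := s * `|s| + s * s.

(** The first-order expansion of [a] times its absolute value has an error of at most h^2, whatever
    the signs of [a] and [a + h]. *)
Lemma sqpos_derive (t : R) : is_derive t 1 sqpos (2 * (`|t| + t)).
Proof.
have est (a h : R) : `|(a + h) * `|a + h| - a * `|a| - 2 * `|a| * h| <= h ^+ 2.
  rewrite ler_norml; have h2 := sqr_ge0 h; have a2 := sqr_ge0 a; have ah := sqr_ge0 (a + h).
  case: (ger0P a) => a0; case: (ger0P (a + h)) => ah0; apply/andP; split; nra.
suff cv : h^-1 *: ((sqpos \o shift t) (h *: 1) - sqpos t) @[h --> 0^'] --> 2 * (`|t| + t).
  apply: DeriveDef; first by apply/cvg_ex; exists (2 * (`|t| + t)).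
  exact: cvg_lim cv.
apply/cvgrPdist_le => e e0.
have N1 : \forall h \near (0 : R)^', h != 0 by exact: nbhs_dnbhs_neq.
have N2 : \forall h \near (0 : R)^', `|h| < e / 2 by apply: dnbhs0_lt; rewrite divr_gt0.
apply: filterS2 N1 N2 => h h0 he.
rewrite /= [h *: 1]mulr1 (addrC h t) /sqpos.
have -> : 2 * (`|t| + t) - h^-1 *: ((t + h) * `|t + h| + (t + h) * (t + h) - (t * `|t| + t * t)) =
    - (h^-1 * ((t + h) * `|t + h| - t * `|t| - 2 * `|t| * h) + h).
  by rewrite /GRing.scale /=; field.
rewrite normrN (le_trans (ler_normD _ _))//.
have : `|h^-1 * ((t + h) * `|t + h| - t * `|t| - 2 * `|t| * h)| <= `|h|.
  rewrite normrM normfV mulrC ler_pdivrMr ?normr_gt0//.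
  by apply: le_trans (est _ _) _; rewrite -normrM -expr2 ger0_norm ?sqr_ge0.
by lra.
Qed.

Lemma sqpos_ge0 (s : R) : 0 <= sqpos s.
Proof.
rewrite /sqpos -mulrDr; case: (ger0P s) => s0; first by rewrite mulr_ge0// addr_ge0.
by rewrite addNr mulr0.
Qed.

Lemma sqpos_gt0 (s : R) : 0 < s -> 0 < sqpos s.
Proof. by move=> s0; rewrite /sqpos addr_gt0// mulr_gt0// normr_gt0 gt_eqF. Qed.

Lemma sqpos_eq0 (s : R) : s <= 0 -> sqpos s = 0.
Proof. by move=> s0; rewrite /sqpos ler0_norm// mulrN addNr. Qed.

Lemma C1_on_sqpos U f : open U -> C1_on U f -> C1_on U (sqpos \o f).
Proof.
move=> oU cf; apply: C1_on_comp1 => // [t|].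
  by apply/derivable1_diffP; have [] := sqpos_derive t.
rewrite (_ : _^`()%classic = fun t => 2 * (`|t| + t)).
  move=> t; apply: cvgM; first exact: cvg_cst.
  by apply: cvgD; [exact: norm_continuous|exact: cvg_id].
by apply/funext => t; rewrite derive1E; have [] := sqpos_derive t.
Qed.

Definition bump (x y s : R) (z : R * R) : R :=
  sqpos ((z.1 - x) * (x + s - z.1)) * sqpos ((z.2 - y) * (y + s - z.2)).

Lemma bump_ge0 x y s z : 0 <= bump x y s z.
Proof. by rewrite mulr_ge0// sqpos_ge0. Qed.

Lemma bump_gt0 (x y s : R) z : x < z.1 < x + s -> y < z.2 < y + s -> 0 < bump x y s z.
Proof.
move=> /andP[? ?] /andP[? ?]; rewrite mulr_gt0// sqpos_gt0// mulr_gt0//; lra.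
Qed.

Lemma bump_eq0 (x y s : R) z : 0 < s ->
  ~ (x < z.1 < x + s /\ y < z.2 < y + s) -> bump x y s z = 0.
Proof.
have key (a t : R) : 0 < s -> ~~ (a < t < a + s) -> sqpos ((t - a) * (a + s - t)) = 0.
  move=> s0; rewrite negb_and -!leNgt => h; apply: sqpos_eq0.
  case/orP: h => h; [apply: mulr_le0_ge0|apply: mulr_ge0_le0]; lra.
move=> s0 /not_andP[/negP|/negP] /(key _ _ s0) h; rewrite /bump h ?mul0r ?mulr0//.
Qed.

Lemma C1_on_bump x y s : C1_on setT (bump x y s).
Proof.
have oT : open [set: R * R] by exact: openT.
have cq (p : R * R -> R) (a : R) : C1_on setT p ->
    C1_on setT (fun z => sqpos ((p z - a) * (a + s - p z))).
  move=> cp; apply: (C1_on_sqpos (f := fun z => (p z - a) * (a + s - p z))) => //.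
  apply: (C1_onM oT); apply: (C1_onD oT); try exact: C1_on_cst; try exact: cp.
  rewrite (_ : (fun z => - p z) = (fun z => -1 * p z)); last by apply/funext => z; rewrite mulN1r.
  by apply: (C1_onM oT) => //; exact: C1_on_cst.
by apply: (C1_onM oT); apply: cq; [exact: C1_on_fst|exact: C1_on_snd].
Qed.

End C1_calculus.

(** * Fibers on a surface *)

Section compact_spaces.
Context {T : topologicalType}.
Hypothesis cT : compact [set: T].

(** Properties that hold for all lists containing some given list form a filter; near-covering
    compactness along this filter provides one list that works for all points. *)
Lemma finite_subcover (U : T -> set T) : (forall p, nbhs p (U p)) ->
  exists s : seq T, forall q, exists2 p, p \in s & U p q.
Proof.
move=> nU.
pose F : set_system (seq T) := [set S | exists s0 : seq T,
  forall s : seq T, {subset s0 <= s} -> S s].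
have FF : Filter F.
  split.
  - by exists [::].
  - move=> P Q [s0 Ps0] [s1 Qs1]; exists (s0 ++ s1) => s ss; split.
      by apply: Ps0 => x xs; apply: ss; rewrite mem_cat xs.
    by apply: Qs1 => x xs; apply: ss; rewrite mem_cat xs orbT.
  - by move=> P Q PQ [s0 Ps0]; exists s0 => s /Ps0 /PQ.
have /compact_near_coveringP/(_ _ F (fun s q => exists2 p, p \in s & U p q) FF) := cT.
case=> [p _|s0 h]; last by exists s0 => q; apply: (h s0).
exists (U p, [set s : seq T | p \in s]) => /=.
  by split; [exact: nU|exists [:: p] => s; apply; rewrite inE].
by move=> [q s] [/= Uq ps]; exists p.
Qed.

Lemma compact_bounded_fun (R : realType) (f : T -> R) : continuous f ->
  exists2 B : R, 0 < B & forall p, `|f p| <= B.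
Proof.
move=> cf.
have [p|s sP] := @finite_subcover (fun p => [set q | `|f q| < `|f p| + 1]).
  have : `|f x| @[x --> p] --> `|f p| by apply: cvg_norm; exact: cf.
  by move/cvgr_lt; apply; rewrite ltrDl.
exists (\sum_(p <- s) (`|f p| + 1) + 1).
  by rewrite ltr_wpDl// sumr_ge0// => p _; rewrite addr_ge0.
move=> q; have [p ps /ltW h] := sP q; apply: (le_trans h).
by rewrite (big_rem p)//= -addrA lerDl addr_ge0// sumr_ge0.
Qed.

Lemma compact_positive_min (R : realType) (f : T -> R) : continuous f ->
  (forall p, 0 < f p) -> exists2 d : R, 0 < d & forall p, d <= f p.
Proof.
move=> cf f0.
have [p|B B0 BP] := @compact_bounded_fun R (fun p => (f p)^-1).
  by apply: cvgV; [rewrite gt_eqF|exact: cf].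
exists B^-1; first by rewrite invr_gt0.
move=> p; rewrite -[leRHS]invrK lef_pV2 ?posrE ?invr_gt0//.
exact: le_trans (ler_norm _) (BP p).
Qed.

End compact_spaces.

(** * Null sets of the plane and their images *)

Section null_sets.
Context {R : realType}.
Local Notation mu := (@plane_measure R).
Implicit Types (A B : set (R * R)).

Definition null_plane A := outer_le A 0%E.

Lemma null_planeS A B : A `<=` B -> null_plane B -> null_plane A.
Proof. by move=> AB nB; exact: outer_leS nB _. Qed.

Lemma null_plane0 : null_plane set0.
Proof. exact: outer_le0. Qed.

Lemma null_planeU A B : null_plane A -> null_plane B -> null_plane (A `|` B).
Proof. by move=> nA nB; have := outer_le_setU nA nB; rewrite adde0. Qed.

Lemma null_plane_bigcup (A : (set (R * R))^nat) : (forall n, null_plane (A n)) ->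
  null_plane (\bigcup_n A n).
Proof. by move=> /outer_le_bigcup; rewrite eseries0. Qed.

Lemma null_plane_seq (I : eqType) (s : seq I) (A : I -> set (R * R)) :
  (forall i, null_plane (A i)) -> null_plane [set z | exists2 i, i \in s & A i z].
Proof.
move=> nA; elim: s => [|i s IH].
  by apply: null_planeS null_plane0 => z [].
apply: null_planeS (null_planeU (nA i) IH) => z [k]; rewrite inE => /orP[/eqP ->|ks] Az.
  by left.
by right; exists k.
Qed.

Lemma null_plane_line1 (t : R) : null_plane [set z | z.1 = t].
Proof.
have mA : measurable ([set z | z.1 = t] : set (R * R)).
  rewrite (_ : [set z | _] = [set t] `*` setT); first exact: measurableX.
  by apply/seteqP; split => z //= [].
exists [set z | z.1 = t] => //; split=> //.
rewrite plane_measure_ysection// integral0_eq// => y _.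
rewrite (_ : ysection _ _ = [set t]); first exact: lebesgue_measure_set1.
by apply/seteqP; split => x; rewrite /ysection/=; [by move/set_mem|by move=> xt; exact/mem_set].
Qed.

Lemma null_plane_line2 (t : R) : null_plane [set z | z.2 = t].
Proof.
have mA : measurable ([set z | z.2 = t] : set (R * R)).
  rewrite (_ : [set z | _] = setT `*` [set t]); first exact: measurableX.
  by apply/seteqP; split => z //= [].
exists [set z | z.2 = t] => //; split=> //.
rewrite plane_measure_xsection// integral0_eq// => x _.
rewrite (_ : xsection _ _ = [set t]); first exact: lebesgue_measure_set1.
by apply/seteqP; split => y; rewrite /xsection/=; [by move/set_mem|by move=> xt; exact/mem_set].
Qed.

Definition grid (x y s : R) : set (R * R) :=
  [set z | ~ (offgrid x s z.1 /\ offgrid y s z.2)].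

Lemma null_plane_grid x y s : null_plane (grid x y s).
Proof.
apply: (@null_planeS _ (\bigcup_m \bigcup_j ([set z | z.1 = x + s * j%:R / 2 ^+ m] `|`
    [set z | z.2 = y + s * j%:R / 2 ^+ m]))); last first.
  apply: null_plane_bigcup => m; apply: null_plane_bigcup => j.
  by apply: null_planeU; [exact: null_plane_line1|exact: null_plane_line2].
move=> z; rewrite /grid /offgrid /= => /not_andP[] /existsNP[m] /existsNP[j] /negP/negPn/eqP h.
  by exists m => //; exists j => //; left.
by exists m => //; exists j => //; right.
Qed.

(** The integral of the Jacobian over a null set is 0. *)
Lemma null_plane_image (U : set (R * R)) g1 g2 A : open U -> C1_on U g1 -> C1_on U g2 ->
  null_plane A -> null_plane ((fun z => (g1 z, g2 z)) @` (A `&` U)).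
Proof.
move=> oU c1 c2 [H mH [AH muH]].
have mU := open_plane_measurable oU.
apply: (@outer_leS _ _ ((fun z => (g1 z, g2 z)) @` (H `&` U))
  (\int[mu]_(x in H `&` U) (`|wedge g1 g2 x|)%:E)%E).
- by apply: image_subset; exact: setSI.
- by apply: (outer_le_C1 oU) => //; first [exact: measurableI|exact: subIsetr].
- rewrite null_set_integral//; first exact: measurableI.
    apply/measurable_EFinP; apply: (measurable_funS mU (@subIsetr _ _ _)).
    apply: open_continuous_plane_measurable_fun => // z Uz.
    apply: (@continuous_comp _ _ _ (wedge g1 g2) (fun t => `|t|)).
      by apply: wedge_continuous; [exact: c1|exact: c2].
    exact: norm_continuous.
  apply/eqP; rewrite -measure_le0; apply: le_trans muH; apply: le_measure; rewrite ?inE//.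
  exact: measurableI.
Qed.

(** Sard's theorem in equal dimensions: the integral of the Jacobian over its own zero set is 0. *)
Lemma null_plane_critical (U : set (R * R)) g1 g2 : open U -> C1_on U g1 -> C1_on U g2 ->
  null_plane ((fun z => (g1 z, g2 z)) @` (U `&` [set z | wedge g1 g2 z = 0])).
Proof.
move=> oU c1 c2; set Z := U `&` _.
have mZ : measurable Z.
  have mU := open_plane_measurable oU.
  have mw : measurable_fun U (wedge g1 g2).
    apply: open_continuous_plane_measurable_fun => // z Uz.
    by apply: wedge_continuous; [exact: c1|exact: c2].
  by apply: (mw mU [set 0]); exact: measurable_set1.
apply: outer_leS (outer_le_C1 oU c1 c2 mZ _) _ => //; first exact: subIsetl.
by rewrite integral0_eq// => z [_ /= ->]; rewrite normr0.
Qed.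

End null_sets.

(** * C^1 functions and bumps on the surface *)

Section surface_functions.
Context {R : realType} (M : closedSurface R).
Local Notation chart_ := (@surface_chart R M).
Implicit Types (i j : surface_index M) (p q : M) (F G : M -> R).

Lemma chart_inv_dom i z : chart_image i z ->
  chart_dom (chart_ i) (chart_inv (chart_ i) z) /\ chart_ i (chart_inv (chart_ i) z) = z.
Proof. by move=> [p dp <-]; rewrite (chart_mapK (c := chart_ i)) ?inE. Qed.

Lemma chart_invK i p : chart_dom (chart_ i) p -> chart_inv (chart_ i) (chart_ i p) = p.
Proof. by move=> dp; apply: (chart_mapK (c := chart_ i)); rewrite inE. Qed.

Lemma in_chartE i F p : chart_dom (chart_ i) p -> in_chart i F (chart_ i p) = F p.
Proof. by move=> dp; rewrite /in_chart /= chart_invK. Qed.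

Lemma chart_image_open i : open (chart_image i).
Proof. exact: chart_img_open. Qed.

Lemma chart_cts i p : chart_dom (chart_ i) p -> {for p, continuous (chart_ i)}.
Proof. by move=> dp; apply: (chart_map_continuous (c := chart_ i)); rewrite inE. Qed.

Lemma chart_inv_cts i z : chart_image i z -> {for z, continuous (chart_inv (chart_ i))}.
Proof. by move=> iz; apply: (chart_inv_continuous (c := chart_ i)); rewrite inE. Qed.

Lemma chart_dom_nbhs i p : chart_dom (chart_ i) p -> \forall q \near p, chart_dom (chart_ i) q.
Proof. by move=> dp; apply: open_nbhs_nbhs; split => //; exact: chart_dom_open. Qed.

Lemma C1P F : C1 F <-> forall i, C1_on (chart_image i) (in_chart i F).
Proof. by split => h i; apply/class_C1P; exact: h. Qed.

Lemma C1_continuous F : C1 F -> continuous F.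
Proof.
move=> /C1P cF p; have [i dp] := surface_cover p.
have iz : chart_image i (chart_ i p) by exists p.
apply: (@near_eq_continuous_at _ _ (in_chart i F \o chart_ i)).
  by have := chart_dom_nbhs dp; apply: filterS => q dq; exact: in_chartE.
apply: (@continuous_comp _ _ _ (chart_ i) (in_chart i F)); first exact: chart_cts.
exact: C1_on_continuous (cF i) iz.
Qed.

Lemma C1_cst (a : R) : C1 ((fun=> a) : M -> R).
Proof. by apply/C1P => i; apply: C1_on_cst; exact: chart_image_open. Qed.

Lemma C1D F G : C1 F -> C1 G -> C1 (fun p => F p + G p).
Proof.
move=> /C1P cF /C1P cG; apply/C1P => i.
exact: (C1_onD (@chart_image_open i) (cF i) (cG i)).
Qed.

Lemma C1M F G : C1 F -> C1 G -> C1 (fun p => F p * G p).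
Proof.
move=> /C1P cF /C1P cG; apply/C1P => i.
exact: (C1_onM (@chart_image_open i) (cF i) (cG i)).
Qed.

Definition square i (x y s : R) : set M :=
  [set p | chart_dom (chart_ i) p /\ ccell x y s (chart_ i p)].

Definition chart_bump i (x y s : R) p : R :=
  if p \in chart_dom (chart_ i) then bump x y s (chart_ i p) else 0.

Lemma chart_bump_ge0 i x y s p : 0 <= chart_bump i x y s p.
Proof. by rewrite /chart_bump; case: ifP => // _; exact: bump_ge0. Qed.

Lemma chart_bump_gt0 i (x y s : R) p : chart_dom (chart_ i) p ->
  x < (chart_ i p).1 < x + s -> y < (chart_ i p).2 < y + s -> 0 < chart_bump i x y s p.
Proof. by move=> dp h1 h2; rewrite /chart_bump mem_set//; exact: bump_gt0. Qed.

Lemma chart_bump_eq0 i (x y s : R) p : 0 < s -> ~ square i x y s p ->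
  chart_bump i x y s p = 0.
Proof.
move=> s0 np; rewrite /chart_bump; case: ifP => // /set_mem dp; apply: bump_eq0 => //.
by move=> [h1 h2]; apply: np; split => //; split; lra.
Qed.

Lemma square_closed i x y s : ccell x y s `<=` chart_image i -> closed (square i x y s).
Proof.
move=> sub; apply: compact_closed; first exact: surface_hausdorff.
rewrite (_ : square i x y s = chart_inv (chart_ i) @` ccell x y s).
  apply: continuous_compact.
    apply/subspace_continuousP => z Cz; apply: cvg_within_filter.
    exact: chart_inv_cts (sub _ Cz).
  rewrite (_ : ccell x y s = `[x, x + s]%classic `*` `[y, y + s]%classic).
    by apply: compact_setX; exact: segment_compact.
  by apply/seteqP; split => z; rewrite /ccell /= !in_itv.
apply/seteqP; split => [p [dp Cp]|_ [z Cz <-]].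
  by exists (chart_ i p) => //; exact: chart_invK.
by have [? E] := chart_inv_dom (sub _ Cz); split => //; rewrite E.
Qed.

(** A point outside the domain of the chart [i] lies off the square, which is closed in [M], so the
    bump vanishes nearby. At the other points the bump is read through the transition map. *)
Lemma C1_chart_bump i x y s : 0 < s -> ccell x y s `<=` chart_image i ->
  C1 (chart_bump i x y s).
Proof.
move=> s0 sub; apply/C1P => j z jz; have [dp cz] := chart_inv_dom jz.
set p := chart_inv (chart_ j) z in dp cz.
have zp (P : set M) : nbhs p P -> \forall w \near z, P (chart_inv (chart_ j) w).
  by move=> nP; exact: (chart_inv_cts jz nP).
have [di|ndi] := pselect (chart_dom (chart_ i) p); last first.
  apply: (@C1_at_near _ (fun=> 0)); last by apply: (C1_on_cst 0 openT).
  have np : nbhs p (~` square i x y s).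
    apply: open_nbhs_nbhs; split; last by case.
    exact/closed_openC/square_closed.
  by have := zp _ np; apply: filterS => w nw; rewrite /in_chart /= chart_bump_eq0.
have [s1 s2] := surface_smooth j i.
set U := chart_ j @` _ in s1 s2.
have Uz : U z by exists p.
have oU : open U.
  rewrite openE => w [q [qj qi] <-].
  have jw : chart_image j (chart_ j q) by exists q.
  have n1 : \forall v \near chart_ j q, chart_image j v.
    by apply: open_nbhs_nbhs; split => //; exact: chart_image_open.
  have n2 : \forall v \near chart_ j q, chart_dom (chart_ i) (chart_inv (chart_ j) v).
    by apply: (chart_inv_cts jw); rewrite chart_invK//; exact: chart_dom_nbhs.
  apply: filterS2 n1 n2 => v jv iv; exists (chart_inv (chart_ j) v); last first.
    by have [] := chart_inv_dom jv.
  by have [] := chart_inv_dom jv.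
apply: (@C1_at_near _ (bump x y s \o transition (chart_ j) (chart_ i))).
  have : \forall w \near z, U w by exact: open_nbhs_nbhs.
  apply: filterS => _ [q [qj qi] <-].
  by rewrite /in_chart /transition /= chart_invK// /chart_bump mem_set.
apply: (@C1_on_comp _ U setT) => //.
- exact: C1_on_bump.
- by apply/class_C1P; exact: (s1 1%N).
- by apply/class_C1P; exact: (s2 1%N).
Qed.

End surface_functions.

(** * Finite fibers and their parity *)

Section fibers.
Context {R : realType} (M : closedSurface R) (omega : areaForm M).
Local Notation chart_ := (@surface_chart R M).
Implicit Types (i j : surface_index M) (p q : M) (F G : M -> R) (y : R * R).

Lemma wedge_eq0 F G i p : C1 F -> C1 G -> chart_dom (chart_ i) p ->
  (wedge (in_chart i F) (in_chart i G) (chart_ i p) == 0) = (poisson omega F G p == 0).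
Proof.
move=> cF cG dp; rewrite -oppr_eq0 (poissonE omega cF cG dp) mulf_eq0.
have ip : chart_image i (chart_ i p) by exists p.
by rewrite (negbTE (area_density_neq0 omega ip)) orbF.
Qed.

(** The atlas may be uncountable; compactness leaves finitely many charts. *)
Lemma null_plane_surface (A : surface_index M -> set M) F G :
  (forall i, null_plane [set (F p, G p) | p in chart_dom (chart_ i) `&` A i]) ->
  null_plane [set (F p, G p) | p in [set p | forall i, chart_dom (chart_ i) p -> A i p]].
Proof.
move=> nA; pose idx p := projT1 (cid (@surface_cover R M p)).
have idxP p : chart_dom (chart_ (idx p)) p by rewrite /idx; case: cid.
have [p|s sP] := finite_subcover (@surface_compact R M) (U := fun p => chart_dom (chart_ (idx p))).
  by apply: open_nbhs_nbhs; split => //; exact: chart_dom_open.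
apply: null_planeS (null_plane_seq s (fun p => nA (idx p))) => _ [q Aq <-].
have [p ps dq] := sP q; exists p => //.
by exists q => //; split => //; exact: Aq.
Qed.

Lemma null_plane_critical_values F G : C1 F -> C1 G ->
  null_plane [set (F p, G p) | p in [set p | poisson omega F G p = 0]].
Proof.
move=> cF cG; apply: null_planeS (null_plane_surface (A := fun i => [set p | poisson omega F G p = 0]) _).
  by move=> _ [p Zp <-]; exists p.
move=> i; have oi := @chart_image_open _ M i.
apply: null_planeS (null_plane_critical oi ((C1P F).1 cF i) ((C1P G).1 cG i)) => _ [p [dp Zp] <-].
exists (chart_ i p); last by rewrite !in_chartE.
split; first by exists p.
by apply/eqP; rewrite wedge_eq0//; apply/eqP.
Qed.

(** The linear part of (F, G) at [p] grows at least linearly with the distance in the chart, and the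
    error at most half as fast. *)
Lemma regular_isolated F G p : C1 F -> C1 G -> poisson omega F G p != 0 ->
  \forall q \near p, F q = F p -> G q = G p -> q = p.
Proof.
move=> cF cG reg; have [i dp] := surface_cover p.
have ip : chart_image i (chart_ i p) by exists p.
have dF := ((C1P F).1 cF i _ ip).1; have dG := ((C1P G).1 cG i _ ip).1.
set k := jac_coef (in_chart i F) (in_chart i G) (chart_ i p).
have N0 := linear_norm_gt0 k.
have D0 : 0 < `|linear_det k| by rewrite normr_gt0 linear_det_jac wedge_eq0.
have [|d d0 dP] := pair_has_linear_part dF dG (e := `|linear_det k| / (2 * linear_norm k)).
  by rewrite divr_gt0// mulr_gt0.
have n1 := chart_dom_nbhs dp.
have n2 : \forall q \near p, `|chart_ i p - chart_ i q| < d.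
  by have /cvgrPdist_lt := chart_cts dp; apply.
apply: filterS2 n1 n2 => q dq pq Fq Gq.
rewrite distrC in pq; have := dP _ pq.
rewrite !in_chartE// Fq Gq subrr sub0r normrN -/k => h.
have h2 := linear_map_ge k (chart_ i q - chart_ i p).
have h3 : linear_norm k * `|linear_map k (chart_ i q - chart_ i p)| <=
    `|linear_det k| / 2 * `|chart_ i q - chart_ i p|.
  rewrite -(ler_pM2l N0) in h; apply: (le_trans h).
  by rewrite le_eqVlt; apply/orP; left; apply/eqP; field; rewrite gt_eqF.
have n0 := normr_ge0 (chart_ i q - chart_ i p).
have : `|linear_det k| * `|chart_ i q - chart_ i p| <= 0.
  have := le_trans h2 h3; rewrite mulrAC; lra.
rewrite pmulr_rle0// normr_le0 subr_eq0 => /eqP E.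
by rewrite -(chart_invK dq) E chart_invK.
Qed.

Definition fiber_enum F G y (s : seq M) :=
  uniq s /\ forall p, p \in s <-> (F p, G p) = y.

(** Each point has a neighbourhood that meets the fiber at most in that point: by [regular_isolated]
    on the fiber, by continuity off it. *)
Lemma finite_fiber F G y : C1 F -> C1 G ->
  (forall p, (F p, G p) = y -> poisson omega F G p != 0) -> exists s, fiber_enum F G y s.
Proof.
move=> cF cG reg.
have [p|s sP] := finite_subcover (@surface_compact R M)
    (U := fun p => [set q | (F q, G q) = y -> q = p]).
  have [E|nE] := pselect ((F p, G p) = y).
    have := regular_isolated cF cG (reg p E).
    by apply: filterS => q h; rewrite -E => -[? ?]; exact: h.
  have : \forall q \near p, (F q, G q) != y.
    have ne : (F p, G p) != y by apply/eqP.
    have cFG : {for p, continuous (fun q => (F q, G q))}.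
      exact: pair_continuous_at (@C1_continuous R M F cF p) (@C1_continuous R M G cG p).
    have /cvgrPdist_lt /(_ `|(F p, G p) - y|) := cFG.
    rewrite normr_gt0 subr_eq0 => /(_ ne); apply: filterS => q.
    by apply: contraTneq => ->; rewrite ltxx.
  by apply: filterS => q /eqP qy /qy.
exists (undup [seq p <- s | (F p, G p) == y]); split; first exact: undup_uniq.
move=> p; rewrite mem_undup mem_filter; split => [/andP[/eqP]//|E].
by have [q qs /(_ E) pq] := sP p; rewrite pq qs -pq E eqxx.
Qed.

(** Outside the square the two fibers coincide; inside, [zeros_parity_eq] compares the zeros of (F,
    G) - y and (F', G) - y in the chart, since these maps agree on the boundary of the square. [N]
    consists of the critical values of both maps and the images of the grid lines. *)
Lemma fiber_parity_step F G F' i (x0 y0 s0 : R) : C1 F -> C1 F' -> C1 G -> 0 < s0 ->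
  ccell x0 y0 s0 `<=` chart_image i ->
  (forall p, ~ (chart_dom (chart_ i) p /\ x0 < (chart_ i p).1 < x0 + s0 /\
     y0 < (chart_ i p).2 < y0 + s0) -> F p = F' p) ->
  exists2 N, null_plane N & forall y, ~ N y -> forall s s',
    fiber_enum F G y s -> fiber_enum F' G y s' -> odd (size s) = odd (size s').
Proof.
move=> cF cF' cG s00 sub FF'.
have oi := @chart_image_open _ M i.
pose N1 A := [set (A p, G p) | p in [set p | poisson omega A G p = 0]].
pose N2 A := (fun z => (in_chart i A z, in_chart i G z)) @` (grid x0 y0 s0 `&` chart_image i).
exists (N1 F `|` N1 F' `|` (N2 F `|` N2 F')).
  have nI A (cA : C1 A) := null_plane_image oi ((C1P A).1 cA i) ((C1P G).1 cG i)
    (null_plane_grid x0 y0 s0).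
  exact: (null_planeU (null_planeU (null_plane_critical_values cF cG)
    (null_plane_critical_values cF' cG)) (null_planeU (nI _ cF) (nI _ cF'))).
move=> y Ny s s' [us sE] [us' sE'].
have reg A : C1 A -> ~ N1 A y -> forall p, (A p, G p) = y -> poisson omega A G p != 0.
  by move=> cA nA p Ap; apply/eqP => Zp; apply: nA; exists p.
have nN1 : ~ N1 F y by move=> h; apply: Ny; left; left.
have nN1' : ~ N1 F' y by move=> h; apply: Ny; left; right.
have nN2 : ~ N2 F y by move=> h; apply: Ny; right; left.
have nN2' : ~ N2 F' y by move=> h; apply: Ny; right; right.
pose a p := p \in square i x0 y0 s0.
pose f A (z : R * R) := (in_chart i A z, in_chart i G z) - y.
have zf A : C1 A -> ~ N1 A y -> ~ N2 A y -> forall z, ccell x0 y0 s0 z -> f A z = 0 ->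
    [/\ offgrid x0 s0 z.1, offgrid y0 s0 z.2 &
    exists2 k, linear_det k != 0 & has_linear_part (f A) z k].
  move=> cA nA1 nA2 z Cz fz; have iz := sub _ Cz.
  have fzy : (in_chart i A z, in_chart i G z) = y by apply/eqP; rewrite -subr_eq0; apply/eqP.
  have [g1 g2] : offgrid x0 s0 z.1 /\ offgrid y0 s0 z.2.
    by apply: contrapT => ng; apply: nA2; exists z.
  have [dz cz] := chart_inv_dom iz.
  split => //; exists (jac_coef (in_chart i A) (in_chart i G) z).
    rewrite linear_det_jac -cz wedge_eq0//; apply: reg => //.
  have := pair_has_linear_part ((C1P A).1 cA i _ iz).1 ((C1P G).1 cG i _ iz).1.
  move=> h e /h [d d0 dP]; exists d => // u /dP.
  by rewrite /f opprB addrA subrK.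
have cf A : C1 A -> forall z, ccell x0 y0 s0 z -> {for z, continuous (f A)}.
  move=> cA z /sub iz; apply: cvgB; last exact: cvg_cst.
  exact: pair_continuous_at (C1_on_continuous ((C1P A).1 cA i) iz)
    (C1_on_continuous ((C1P G).1 cG i) iz).
have en A t : uniq t -> (forall p, p \in t <-> (A p, G p) = y) ->
    zeros_enum (f A) x0 y0 s0 [seq chart_ i p | p <- t & a p].
  move=> ut tE; split.
    rewrite map_inj_in_uniq ?filter_uniq// => p q.
    rewrite !mem_filter => /andP[/set_mem[dp _] _] /andP[/set_mem[dq _] _] E.
    by rewrite -(chart_invK dp) E chart_invK.
  move=> z; split.
    move=> /mapP[p]; rewrite mem_filter => /andP[/set_mem[dp Cp] /tE Ap ->].
    by split => //; rewrite /f !in_chartE// Ap subrr.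
  move=> [Cz fz]; have [dz cz] := chart_inv_dom (sub _ Cz).
  apply/mapP; exists (chart_inv (chart_ i) z) => //.
  rewrite mem_filter; apply/andP; split; first by apply/mem_set; split => //; rewrite cz.
  by apply/tE; apply/eqP; rewrite -subr_eq0; apply/eqP.
have eqb u : ccell x0 y0 s0 u -> u.1 = x0 \/ u.1 = x0 + s0 \/ u.2 = y0 \/ u.2 = y0 + s0 ->
    f F u = f F' u.
  move=> Cu bu; have [du cu] := chart_inv_dom (sub _ Cu).
  rewrite /f /in_chart /= FF'// => -[_]; rewrite cu.
  by case: bu => [->|[->|[->|->]]]; lra.
have := zeros_parity_eq s00 (cf F cF) (cf F' cF') (zf F cF nN1 nN2) (zf F' cF' nN1' nN2')
  eqb (en F s us sE) (en F' s' us' sE').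
rewrite !size_map !size_filter => ein.
rewrite -(count_predC a s) -(count_predC a s') !oddD ein; congr (_ (+) odd _).
rewrite -!size_filter; apply/perm_size/uniq_perm; rewrite ?filter_uniq// => p.
rewrite !mem_filter /= /predC /=; case: (boolP (a p)) => //= nap.
have FE : F p = F' p.
  apply: FF' => -[dp [h1 h2]]; move/negP : nap; apply; apply/mem_set; split => //.
  by split; lra.
by apply/idP/idP => [/sE|/sE'] E; [apply/sE'|apply/sE]; rewrite -E FE.
Qed.

End fibers.

(** * Almost every fiber is even *)

Section even_fibers.
Context {R : realType} (M : closedSurface R) (omega : areaForm M).
Local Notation chart_ := (@surface_chart R M).
Implicit Types (p q : M) (F G : M -> R) (y : R * R).

(** [b] is [(i, x, y, s)]: a chart and a square of its image, given by corner and side. *)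
Let box_at p : exists b : surface_index M * R * R * R,
  [/\ chart_dom (chart_ b.1.1.1) p, 0 < b.2,
    b.1.1.2 < (chart_ b.1.1.1 p).1 < b.1.1.2 + b.2 /\
    b.1.2 < (chart_ b.1.1.1 p).2 < b.1.2 + b.2 &
    ccell b.1.1.2 b.1.2 b.2 `<=` chart_image b.1.1.1].
Proof.
have [i dp] := surface_cover p.
have ip : chart_image i (chart_ i p) by exists p.
have /nbhs_normP[d /= d0 dU] : nbhs (chart_ i p) (chart_image i).
  by apply: open_nbhs_nbhs; split => //; exact: chart_image_open.
exists (i, (chart_ i p).1 - d / 4, (chart_ i p).2 - d / 4, d / 2) => /=; split => //.
- by rewrite divr_gt0.
- by split; lra.
- move=> w Cw; apply: dU => /=.
  apply: (@le_lt_trans _ _ (d / 2)); last by lra.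
  by apply: ccell_norm Cw; split; lra.
Qed.

Let box_of p := projT1 (cid (box_at p)).

Let bump_of p : M -> R :=
  chart_bump (box_of p).1.1.1 (box_of p).1.1.2 (box_of p).1.2 (box_of p).2.

Let C1_bump_of p : C1 (bump_of p).
Proof. by rewrite /bump_of /box_of; case: cid => b [? ? ? ?]; exact: C1_chart_bump. Qed.

Let bump_of_gt0 p : 0 < bump_of p p.
Proof.
by rewrite /bump_of /box_of; case: cid => b [? ? [? ?] ?]; exact: chart_bump_gt0.
Qed.

Let C1_scale K F : C1 F -> C1 (fun q => K * F q).
Proof. by move=> cF; exact: (C1M (@C1_cst R M K) cF). Qed.

Let C1_sum K (s : seq M) F : C1 F -> C1 (fun q => F q + \sum_(p <- s) K * bump_of p q).
Proof.
elim: s F => [|p s IH] F cF.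
  rewrite (_ : (fun q => _) = F)//; apply/funext => q.
  by rewrite big_nil addr0.
rewrite (_ : (fun q => _) =
    (fun q => (F q + K * bump_of p q) + \sum_(p <- s) K * bump_of p q)).
  exact: IH (C1D cF (C1_scale K (C1_bump_of p))).
by apply/funext => q; rewrite big_cons addrA.
Qed.

Let parity_step K p F G : C1 F -> C1 G ->
  exists2 N, null_plane N & forall y, ~ N y -> forall s s', fiber_enum F G y s ->
    fiber_enum (fun q => F q + K * bump_of p q) G y s' -> odd (size s) = odd (size s').
Proof.
move=> cF cG.
have cF' : C1 (fun q => F q + K * bump_of p q) := C1D cF (C1_scale K (C1_bump_of p)).
have : exists i (a0 b0 s0 : R), [/\ 0 < s0, ccell a0 b0 s0 `<=` chart_image i &
    bump_of p = chart_bump i a0 b0 s0].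
  rewrite /bump_of /box_of; case: cid => b /= [? ? ? ?].
  by exists b.1.1.1, b.1.1.2, b.1.2, b.2.
move=> [i [a0 [b0 [s0 [s00 sub E]]]]].
apply: (fiber_parity_step omega cF cF' cG s00 sub) => q nq.
rewrite E /chart_bump; case: ifP => [/set_mem dq|_]; last by rewrite mulr0 addr0.
by rewrite bump_eq0 ?mulr0 ?addr0// => -[h1 h2]; exact: nq.
Qed.

(** One bump at a time. The intermediate maps must have finite fibers too, so their critical values
    [N3] are discarded along the way. *)
Let parity_chain K (s : seq M) F G : C1 F -> C1 G ->
  exists2 N, null_plane N & forall y, ~ N y -> forall t t', fiber_enum F G y t ->
    fiber_enum (fun q => F q + \sum_(p <- s) K * bump_of p q) G y t' ->
    odd (size t) = odd (size t').
Proof.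
elim: s F => [|p s IH] F cF cG.
  exists set0; first exact: null_plane0.
  move=> y _ t t' [ut tE] [ut' tE']; congr (odd _).
  apply/perm_size/uniq_perm => // q.
  have E : (F q + \sum_(p <- [::]) K * bump_of p q, G q) = (F q, G q).
    by rewrite big_nil addr0.
  by apply/idP/idP => [/tE h|/tE' h]; [apply/tE'; rewrite E|apply/tE; rewrite -E].
have cF1 : C1 (fun q => F q + K * bump_of p q) := C1D cF (C1_scale K (C1_bump_of p)).
have [N1 nN1 P1] := parity_step K p cF cG.
have [N2 nN2 P2] := IH _ cF1 cG.
pose N3 := [set (F q + K * bump_of p q, G q) |
  q in [set q | poisson omega (fun q => F q + K * bump_of p q) G q = 0]].
exists (N1 `|` N2 `|` N3).
  by apply: null_planeU (null_planeU nN1 nN2) _; exact: null_plane_critical_values.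
move=> y Ny t t' tE tE'.
have [|u uE] := @finite_fiber _ _ omega _ _ y cF1 cG.
  by move=> q qE; apply/eqP => Zq; apply: Ny; right; exists q.
rewrite (P1 y _ t u)//; last by move=> h; apply: Ny; left; left.
apply: (P2 y) => //; first by move=> h; apply: Ny; left; right.
rewrite (_ : (fun q => _) = (fun q => F q + \sum_(p <- p :: s) K * bump_of p q))//.
by apply/funext => q; rewrite big_cons addrA.
Qed.

(** One perturbation serves all values: [F + K * S] stays above every value of [F], so a nonempty
    fiber of (F, G) has the parity of an empty one. *)
Lemma even_fibers F G : C1 F -> C1 G -> exists2 N, null_plane N & forall y, ~ N y ->
  (forall p, (F p, G p) = y -> poisson omega F G p != 0) /\
  forall t, fiber_enum F G y t -> ~~ odd (size t).
Proof.
move=> cF cG.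
have [p|s sP] := finite_subcover (@surface_compact R M) (U := fun p => [set q | 0 < bump_of p q]).
  by have := @C1_continuous R M _ (C1_bump_of p) p; move/cvgr_gt; apply; exact: bump_of_gt0.
pose S q := \sum_(p <- s) bump_of p q.
have S0 q : 0 < S q.
  have [p ps pq] := sP q; rewrite /S (big_rem p)//= ltr_pwDl// sumr_ge0// => r _.
  exact: chart_bump_ge0.
have cS : C1 S.
  have := C1_sum 1 s (@C1_cst R M 0); rewrite (_ : (fun q => _) = S)//.
  by apply/funext => q; rewrite add0r; apply: eq_bigr => p _; rewrite mul1r.
have [d d0 dS] := compact_positive_min (@surface_compact R M) (C1_continuous cS) S0.
have [B B0 FB] := compact_bounded_fun (@surface_compact R M) (C1_continuous cF).
(* Gives [K * S >= 2 * B + 1], hence [F + K * S >= B + 1], while [F <= B]. *)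
pose K := (2 * B + 1) / d.
have [N nN NP] := parity_chain K s cF cG.
exists (N `|` [set (F p, G p) | p in [set p | poisson omega F G p = 0]]).
  by apply: null_planeU => //; exact: null_plane_critical_values.
move=> y Ny; split => [p pE|t tE].
  by apply/eqP => Zp; apply: Ny; right; exists p.
have [t0|[p pt]] : t = [::] \/ exists p, p \in t.
  by case: t {tE} => [|p t]; [left|right; exists p; rewrite inE eqxx].
  by rewrite t0.
rewrite (NP y _ t [::])//; first by move=> h; apply: Ny; left.
split=> // q; split => //.
move=> qE; have /= Fq := congr1 fst qE; have /= Fp := congr1 fst ((tE.2 p).1 pt).
exfalso; clear qE.
have : K * d <= K * S q.
  by apply: ler_wpM2l => //; rewrite divr_ge0 ?ltW//; lra.
rewrite {1}/K divfK ?gt_eqF// => h.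
have := FB q; have := FB p; rewrite !ler_norml => /andP[_ h1] /andP[h2 _].
move: Fq; rewrite -Fp -mulr_sumr -/(S q); lra.
Qed.

End even_fibers.

(** * Multiplicity and the defect inequality *)

Section multiplicity.
Context {R : realType}.
Local Notation mu := (@plane_measure R).
Local Open Scope ereal_scope.

(* [H] is a family of sets which, at each level [m], covers [A] twice as soon
   as [m] is large (how large may depend on the point). *)
Lemma two_fold_cover (n : nat) (H : nat -> 'I_n -> nat -> set (R * R)) (A : set (R * R))
    (S : \bar R) :
  (forall m k j, measurable (H m k j)) ->
  (forall m, \sum_(k < n) \sum_(0 <= j <oo) mu (H m k j) <= S) ->
  (forall y, A y -> exists m0, forall m, (m0 <= m)%N -> exists k j k' j',
    [/\ (k, j) != (k', j'), H m k j y & H m k' j' y]) ->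
  S < +oo -> outer_le A (S * (2^-1)%:E).
Proof.
move=> mH HS HA Sfin.
pose g m (k : 'I_n) (y : R * R) : \bar R := \sum_(0 <= j <oo) (\1_(H m k j) y)%:E.
have g0 m k y : 0 <= g m k y by apply: nneseries_ge0.
have mg m k : measurable_fun setT (g m k).
  have := @ge0_emeasurable_sum _ _ R setT (fun j y => (\1_(H m k j) y)%:E) xpredT.
  rewrite (_ : (fun x => _) = g m k); first by apply => // j _; exact/measurable_EFinP.
  by apply/funext => y; rewrite /g; apply: eq_eseriesl => j.
pose G m y := \sum_(k < n) g m k y.
have mG m : measurable_fun setT (G m) by exact: emeasurable_sum.
have G0 m y : 0 <= G m y by exact: sume_ge0.
have intG m : \int[mu]_(y in setT) G m y <= S.
  have -> : \int[mu]_(y in setT) G m y = \sum_(k < n) \int[mu]_(y in setT) g m k y.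
    apply: (@ge0_integral_sum _ _ R mu setT measurableT _ (g m)) => [k|k x _].
      exact: mg.
    exact: g0.
  apply: (le_trans _ (HS m)); apply: lee_sum => k _.
  rewrite (@integral_nneseries _ _ R mu setT measurableT
    (fun j y => (\1_(H m k j) y)%:E)) => [|j|j y _]; last 2 first.
  - by apply/measurable_EFinP; apply: measurable_indic; exact: mH.
  - by rewrite lee_fin indicE.
  apply: lee_nneseries => [j _ _|j _].
    by apply: integral_ge0 => y _; rewrite lee_fin indicE.
  by rewrite integral_indic ?setIT//; exact: mH.
pose W m := setT `&` [set y | 2%:E <= G m y].
have mW m : measurable (W m) by exact: emeasurable_fun_c_infty.
have muW m : mu (W m) <= S * (2^-1)%:E.
  rewrite lee_pdivlMr//; apply: le_trans (intG m).
  apply: (@le_trans _ _ (\int[mu]_(y in W m) G m y)); last first.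
    apply: (@ge0_subset_integral _ _ R mu _ _ (mW m) measurableT _ (mG m)) => [y _|].
      exact: G0.
    by [].
  rewrite muleC -integral_cst; last exact: mW.
  apply: (@ge0_le_integral _ _ R mu _ (mW m)) => [y _|||y []//].
  - by rewrite lee_fin.
  - exact: measurable_cst.
  - exact: measurable_funTS (mG m).
have two m y k j k' j' : (k, j) != (k', j') -> H m k j y -> H m k' j' y -> 2%:E <= G m y.
  move=> ne Hk Hk'.
  have one k1 j1 : H m k1 j1 y -> (\1_(H m k1 j1) y)%:E = 1 :> \bar R.
    by move=> h; rewrite indicE mem_set.
  have ge0 k1 j1 : 0 <= (\1_(H m k1 j1) y)%:E :> \bar R by rewrite lee_fin indicE.
  have D1 k1 (P : pred nat) j1 : P j1 -> \sum_(0 <= j0 <oo | P j0) (\1_(H m k1 j0) y)%:E =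
      (\1_(H m k1 j1) y)%:E + \sum_(0 <= j0 <oo | P j0 && (j0 != j1)) (\1_(H m k1 j0) y)%:E
      :> \bar R.
    by move=> Pj; apply: nneseriesD1.
  have g1 k1 j1 : H m k1 j1 y -> 1 <= g m k1 y.
    by move=> h; rewrite /g (D1 k1 xpredT j1)// one// leeDl// nneseries_ge0.
  rewrite /G; have [kk|kk] := eqVneq k k'.
    rewrite (bigD1 k)//= (_ : 2%:E = 2%:E + 0); last by rewrite adde0.
    apply: leeD; last exact: sume_ge0.
    have jj : j' != j by apply: contraNneq ne => ->; rewrite kk.
    rewrite -kk in Hk'.
    rewrite /g (D1 k xpredT j)// one// (D1 k _ j')//.
    rewrite one// addeA (_ : 1 + 1 = 2%:E); last by rewrite -EFinD.
    by rewrite leeDl// nneseries_ge0.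
  rewrite (bigD1 k)//= (bigD1 k')/=; last by rewrite eq_sym.
  rewrite addeA (_ : 2%:E = 1 + 1 + 0); last by rewrite adde0 -EFinD.
  apply: leeD; last exact: sume_ge0.
  by apply: leeD; [exact: g1 Hk|exact: g1 Hk'].
(* The level from which a point is covered twice depends on the point; the sets of points served
   from [m0] on increase with [m0]. *)
apply: (@outer_leS _ _ (\bigcup_m0 [set y | forall m, (m0 <= m)%N -> W m y])
  (S * (2^-1)%:E)) => //.
  move=> y /HA[m0 h]; exists m0 => // m /h[k [j [k' [j' [ne Hk Hk']]]]].
  by split => //=; exact: two Hk Hk'.
apply: outer_le_nondecreasing => [m y h m' mm'|m]; first by apply: h; exact: ltnW.
by exists (W m) => //; split => // y; apply.
Qed.

End multiplicity.

(** * The area inequality with multiplicity two *)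

Section double_cover.
Context {R : realType} (M : closedSurface R).
Local Notation chart_ := (@surface_chart R M).
Local Notation mu := (@plane_measure R).
Implicit Types (p q : M) (F G : M -> R).

Let cell m (j : nat) : set (R * R) := [set z | pickle (dyadic m z) = j].

Let cellE m j : cell m j = @dyadic R m @^-1` [set c | pickle c = j].
Proof. by []. Qed.

Let measurable_cell m j : measurable (cell m j).
Proof. by rewrite cellE; exact: measurable_dyadic. Qed.

Let trivIset_cell m : trivIset setT (cell m).
Proof. by move=> j j' _ _ [z [/= <- <-]]. Qed.

Let separate (u v : R * R) : u != v -> exists m0, forall m, (m0 <= m)%N ->
  pickle (dyadic m u) != pickle (dyadic m v).
Proof.
move=> uv; have d0 : 0 < `|u - v| by rewrite normr_gt0 subr_eq0.
have [m0 h0] := dyadic_small d0; exists m0 => m mm0.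
apply/negP => /eqP /(pcan_inj pickleK) E.
have Cu : ccell ((dyadic m u).1%:~R / 2 ^+ m) ((dyadic m u).2%:~R / 2 ^+ m) (2 ^+ m)^-1 u.
  by apply: hcell_sub; exact: (dcellP m (dyadic m u) u).2.
have Cv : ccell ((dyadic m u).1%:~R / 2 ^+ m) ((dyadic m u).2%:~R / 2 ^+ m) (2 ^+ m)^-1 v.
  by apply: hcell_sub; exact: (dcellP m (dyadic m u) v).2.
have := le_lt_trans (ccell_norm Cu Cv) (_ : (2 ^+ m)^-1 < `|u - v|).
rewrite ltxx => h; suff : false by []. apply: h.
apply: le_lt_trans h0; rewrite lef_pV2 ?posrE ?exprn_gt0//.
by rewrite ler_eXn2l// ltr1n.
Qed.

(** At level [m] each piece of the partition is cut along dyadic cells, and [outer_le_C1] covers the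
    image of each fragment by a set no larger than the integral of the Jacobian over it. Two
    preimages of a value end up in different fragments, being in different pieces or separated by
    fine cells; then [two_fold_cover] applies. *)
Lemma double_cover F G n (i : 'I_n -> surface_index M) (A : 'I_n -> set M)
    (T N : set (R * R)) : C1 F -> C1 G -> chart_partition i A -> null_plane N ->
  (forall y, T y -> ~ N y -> exists p q,
    [/\ p != q, (F p, G p) = y & (F q, G q) = y]) -> measurable T ->
  (2%:E * mu T <= \sum_(k < n) \int[mu]_(x in chart_ (i k) @` A k)
     `|wedge (in_chart (i k) F) (in_chart (i k) G) x|%:E)%E.
Proof.
move=> cF cG pA nN TN mT; set S := (\sum_(k < n) _)%E.
have [Sfin|] := ltP S +oo%E; last by rewrite leye_eq => /eqP ->; rewrite leey.
pose w k x := `|wedge (in_chart (i k) F) (in_chart (i k) G) x|.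
pose B k := chart_ (i k) @` A k.
have mB k : measurable (B k) := partition_measurable pA k.
have subB k : B k `<=` chart_image (i k) by apply: image_subset; exact: (partition_sub pA).
have C1F k := (C1P F).1 cF (i k).
have C1G k := (C1P G).1 cG (i k).
have oi k := @chart_image_open _ M (i k).
have /choice[H0 HP0] : forall x : nat * 'I_n * nat, exists H, [/\ measurable H,
    (fun z => (in_chart (i x.1.2) F z, in_chart (i x.1.2) G z)) @`
      (B x.1.2 `&` cell x.1.1 x.2) `<=` H &
    (mu H <= \int[mu]_(z in B x.1.2 `&` cell x.1.1 x.2) (w x.1.2 z)%:E)%E].
  move=> [[m k] j] /=.
  have [H mH [? ?]] := outer_le_C1 (oi k) (C1F k) (C1G k)
    (measurableI _ _ (mB k) (measurable_cell m j)) (subset_trans (@subIsetl _ _ _) (subB k)).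
  by exists H.
pose H m k j := H0 (m, k, j).
have cover (p q : M) (y : R * R) : p != q -> (F p, G p) = y -> (F q, G q) = y ->
    exists m0, forall m, (m0 <= m)%N -> exists k j k' j',
    [/\ (k, j) != (k', j'), H m k j y & H m k' j' y].
  move=> pq Fp Fq.
  have [k Ak] : exists k, A k p.
    by have : [set: M] p by []; rewrite -(partition_cover pA) => -[k _ ?]; exists k.
  have [k' Ak'] : exists k, A k q.
    by have : [set: M] q by []; rewrite -(partition_cover pA) => -[l _ ?]; exists l.
  have inH m l r : A l r -> (F r, G r) = y ->
      H m l (pickle (dyadic m (chart_ (i l) r))) y.
    move=> Ar Fr; have [_ + _] := HP0 (m, l, pickle (dyadic m (chart_ (i l) r))); apply.
    exists (chart_ (i l) r) => /=; first by split => //; exists r.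
    by rewrite !in_chartE//; exact: (partition_sub pA) Ar.
  have [kk|kk] := eqVneq k k'; last first.
    exists 0%N => m _; exists k, (pickle (dyadic m (chart_ (i k) p))),
      k', (pickle (dyadic m (chart_ (i k') q))).
    by split; [rewrite xpair_eqE (negbTE kk)|exact: inH|exact: inH].
  subst k'.
  have cpq : chart_ (i k) p != chart_ (i k) q.
    apply: contra_neq pq => E.
    by rewrite -(chart_invK (partition_sub pA Ak)) E chart_invK//; exact: (partition_sub pA) Ak'.
  have [m0 h] := separate cpq; exists m0 => m /h ne.
  exists k, (pickle (dyadic m (chart_ (i k) p))), k, (pickle (dyadic m (chart_ (i k) q))).
  by split; [rewrite xpair_eqE eqxx|exact: inH|exact: inH].
have sumS m : (\sum_(k < n) \sum_(0 <= j <oo) mu (H m k j) <= S)%E.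
  apply: lee_sum => k _.
  have BE : B k = \bigcup_j (B k `&` cell m j).
    rewrite -setI_bigcupr (_ : \bigcup_j cell m j = setT) ?setIT//.
    by apply/seteqP; split => // z _; exists (pickle (dyadic m z)).
  rewrite -/(B k) [in leRHS]BE ge0_integral_bigcup//=.
  - by apply: lee_nneseries => j _ //; have [] := HP0 (m, k, j).
  - by move=> j; apply: measurableI; [exact: mB|exact: measurable_cell].
  - rewrite -BE; apply/measurable_EFinP.
    apply: (measurable_funS (open_plane_measurable (oi k)) (subB k)).
    apply: open_continuous_plane_measurable_fun => // z iz.
    apply: (@continuous_comp _ _ _ (wedge (in_chart (i k) F) (in_chart (i k) G)) (fun t => `|t|)).
      by apply: wedge_continuous; [exact: C1F|exact: C1G].
    exact: norm_continuous.
  - by apply: trivIset_setIl; exact: trivIset_cell.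
have bound : outer_le (T `\` N) (S * (2^-1)%:E)%E.
  apply: (@two_fold_cover _ n H _ S _ sumS _ Sfin).
    by move=> m k j; have [] := HP0 (m, k, j).
  by move=> y [Ty Ny]; have [p [q [pq Fp Fq]]] := TN y Ty Ny; exact: cover Fp Fq.
have [K mK [TK muK]] := outer_le_setU bound nN.
have : (mu T <= S * (2^-1)%:E)%E.
  rewrite adde0 in muK; apply: le_trans muK; apply: le_measure; rewrite ?inE//.
  move=> z Tz; apply: TK; have [Nz|Nz] := pselect (N z); first by right.
  by left.
by rewrite lee_pdivlMr// muleC.
Qed.

End double_cover.

(** * Area of the triangle *)

Section triangle_area.
Context {R : realType}.
Local Notation leb := (@lebesgue_measure R).
Local Notation mu := (@plane_measure R).
Implicit Types (a b c : R).

Definition triangle a b c : set (R * R) := [set z | [/\ a < z.1, b < z.2 & z.1 + z.2 < c]].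

Lemma triangle_open a b c : open (triangle a b c).
Proof.
have cD : continuous (fun z : R * R => z.1 + z.2).
  by move=> z; apply: cvgD; [exact: cvg_fst|exact: cvg_snd].
have -> : triangle a b c = (fst @^-1` [set x | a < x]) `&` (snd @^-1` [set x | b < x]) `&`
    ((fun z => z.1 + z.2) @^-1` [set x | x < c]).
  by apply/seteqP; split => [z [? ? ?]|z [[? ?] ?]].
apply: openI; first apply: openI; apply: open_comp; try exact: open_gt; try exact: open_lt.
- by move=> z _; exact: cvg_fst.
- by move=> z _; exact: cvg_snd.
- by move=> z _; exact: cD.
Qed.

Lemma measurable_triangle a b c : measurable (triangle a b c).
Proof. by apply: open_plane_measurable; exact: triangle_open. Qed.

(** The section over a point [x] of []a, c - b[] has length [c - b - x], which integrates to (c - a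
    - b)^2 / 2. *)
Lemma triangle_area_ge a b c : a + b < c ->
  (((c - a - b) ^+ 2)%:E <= 2%:E * mu (triangle a b c))%E.
Proof.
move=> abc; set T := triangle a b c; have mT : measurable T := measurable_triangle a b c.
pose q := c - b; have aq : a < q by rewrite /q; lra.
have mf : measurable_fun setT (leb \o xsection T) by exact: measurable_fun_xsection.
have mi : measurable (`]a, q[%classic : set R) by exact: measurable_itv.
have le1 : (\int[leb]_(x in `]a, q[) leb (xsection T x) <= mu T)%E.
  rewrite plane_measure_xsection//.
  by apply: ge0_subset_integral => //; exact: mf.
have eq1 : (\int[leb]_(x in `]a, q[) leb (xsection T x) =
    \int[leb]_(x in `]a, q[) (q - x)%:E)%E.
  apply: eq_integral => x; rewrite inE/= in_itv/= => /andP[ax xq].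
  have -> : xsection T x = `]b, (c - x)[%classic.
    apply/seteqP; split => y; rewrite /xsection /= in_itv /=.
      by move=> /set_mem [/= _ ? ?]; lra.
    by move=> h; apply/mem_set; split => /=; lra.
  rewrite lebesgue_measure_itv/= lte_fin ifT; last by rewrite /q in xq; lra.
  by rewrite -EFinD /q; congr EFin; lra.
have cf : continuous (fun x : R => q - x).
  by move=> x; apply: cvgB; [exact: cvg_cst|exact: cvg_id].
have mq D : measurable_fun D (fun x : R => (q - x)%:E).
  apply/measurable_EFinP; apply: measurable_funTS; apply: (continuous_measurable_fun cf).
have eq2 : (\int[leb]_(x in `]a, q[) (q - x)%:E = \int[leb]_(x in `[a, q]) (q - x)%:E)%E.
  by rewrite integral_itv_obnd_cbnd// integral_itv_bndo_bndc.
pose Fq (x : R) := q * x - x ^+ 2 / 2.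
have dF (x : R) : is_derive x 1 Fq (q - x).
  have -> : Fq = (q \*: id) - (2^-1 \*: (id ^+ 2)).
    by apply/funext => t; rewrite /Fq !fctE [X in _ - X]mulrC.
  by apply: is_derive_eq; rewrite /GRing.scale/=; lra.
have eq3 : (\int[leb]_(x in `[a, q]) (q - x)%:E = (Fq q)%:E - (Fq a)%:E)%E.
  apply: continuous_FTC2 => //.
  - exact: continuous_subspaceT.
  - have cF : continuous Fq.
      by move=> x; apply: differentiable_continuous; apply/derivable1_diffP; have [] := dF x.
    split => [x _||]; first by have [] := dF x.
    + exact: cvg_at_right_filter (cF a).
    + exact: cvg_at_left_filter (cF q).
  - by move=> x _; rewrite derive1E; have [_ ->] := dF x.
rewrite eq1 eq2 eq3 in le1.
apply: (@le_trans _ _ (2%:E * ((Fq q)%:E - (Fq a)%:E))%E); last exact: lee_wpmul2l.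
by rewrite -EFinD -EFinM lee_fin /Fq /q; lra.
Qed.

End triangle_area.

(** * The bracket against the area form *)

Section poisson_bound.
Context {R : realType} (M : closedSurface R) (omega : areaForm M).
Local Notation chart_ := (@surface_chart R M).
Local Notation mu := (@plane_measure R).
Implicit Types (p q : M) (F G : M -> R).

Lemma area_density_continuous i z : chart_image i z ->
  {for z, continuous (area_density omega i)}.
Proof. by move=> iz; have := area_density_smooth omega i 0%N; apply; rewrite inE. Qed.

Lemma chart_wedge_continuous F G i z : C1 F -> C1 G -> chart_image i z ->
  {for z, continuous (wedge (in_chart i F) (in_chart i G))}.
Proof.
move=> cF cG iz; apply: wedge_continuous.
  exact: ((C1P F).1 cF i z iz).
exact: ((C1P G).1 cG i z iz).
Qed.

Lemma poisson_continuous F G : C1 F -> C1 G -> continuous (poisson omega F G).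
Proof.
move=> cF cG p; have [i dp] := surface_cover p.
have iz : chart_image i (chart_ i p) by exists p.
apply: (@near_eq_continuous_at R M (fun q => - wedge (in_chart i F) (in_chart i G) (chart_ i q)
  / area_density omega i (chart_ i q))).
  have := chart_dom_nbhs dp; apply: filterS => q dq.
  rewrite (poissonE omega cF cG dq) mulfK//.
  by apply: area_density_neq0; exists q.
have cc := chart_cts dp.
have cw := continuous_comp cc (chart_wedge_continuous cF cG iz).
have cd := continuous_comp cc (area_density_continuous iz).
apply: continuousM; first by apply: continuousN; exact: cw.
by apply: continuousV; [exact: area_density_neq0|exact: cd].
Qed.

(** Continuity and compactness bound the range; on an unbounded set [sup] would be a default
    value. *)
Lemma le_sup_norm_poisson F G p : C1 F -> C1 G ->
  `|poisson omega F G p| <= sup_norm (poisson omega F G).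
Proof.
move=> cF cG; have [B _ BP] := compact_bounded_fun (@surface_compact R M) (poisson_continuous cF cG).
apply: ub_le_sup; last by exists p.
by exists B => _ [q _ <-].
Qed.

Lemma sum_integral_wedge_le F G n (i : 'I_n -> surface_index M) (A : 'I_n -> set M) :
  C1 F -> C1 G -> chart_partition i A ->
  (\sum_(k < n) \int[mu]_(x in chart_ (i k) @` A k)
     `|wedge (in_chart (i k) F) (in_chart (i k) G) x|%:E <=
   (sup_norm (poisson omega F G))%:E * partition_area omega i A)%E.
Proof.
move=> cF cG pA; set S := sup_norm _.
rewrite /partition_area ge0_sume_distrr; last first.
  by move=> k _; apply: integral_ge0 => x _; rewrite lee_fin.
apply: lee_sum => k _; set B := chart_ (i k) @` A k.
have subB : B `<=` chart_image (i k) by apply: image_subset; exact: (partition_sub pA).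
have mB : measurable B := partition_measurable pA k.
have mnorm (h : R * R -> R) : (forall z, chart_image (i k) z -> {for z, continuous h}) ->
    measurable_fun B (fun x => `|h x|%:E).
  move=> ch; apply/measurable_EFinP.
  apply: (measurable_funS (open_plane_measurable (@chart_image_open _ M (i k))) subB).
  apply: open_continuous_plane_measurable_fun => [|z iz]; first exact: chart_image_open.
  by apply: (@continuous_comp _ _ _ h (fun t => `|t|)); [exact: ch|exact: norm_continuous].
have mw := mnorm _ (fun z iz => chart_wedge_continuous cF cG iz).
have md := mnorm _ (fun z iz => area_density_continuous iz).
(* A point of [M] is wanted to see that [0 <= S]. *)
case: (pselect (exists x, B x)) => [[x0 [p0 _ _]]|nB]; last first.
  have -> : B = set0 by apply/seteqP; split => // x Bx; apply: nB; exists x.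
  by rewrite !integral_set0 mule0.
have S0 : 0 <= S by apply: le_trans (le_sup_norm_poisson p0 cF cG).
rewrite -(@ge0_integralZl _ _ R mu B mB _ md S%:E);
  [|by move=> x _; rewrite lee_fin|by rewrite lee_fin].
apply: (@ge0_le_integral _ _ R mu _ mB).
- by move=> x _; rewrite lee_fin.
- exact: mw.
- by apply: measurable_funeM; exact: md.
move=> x /subB[p dp <-]; rewrite -EFinM lee_fin -normrN (poissonE omega cF cG dp) normrM.
by apply: ler_wpM2r => //; exact: le_sup_norm_poisson.
Qed.

Lemma C1N F : C1 F -> C1 (fun p => - F p).
Proof.
move=> cF; rewrite (_ : (fun _ => _) = fun p => -1 * F p); last by apply/funext => p; rewrite mulN1r.
exact: C1M (@C1_cst R M (-1)) cF.
Qed.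

Lemma poissonNN F G : C1 F -> C1 G ->
  poisson omega (fun p => - F p) (fun p => - G p) = poisson omega F G.
Proof.
move=> cF cG; apply/funext => p; have [i dp] := surface_cover p.
have iz : chart_image i (chart_ i p) by exists p.
have d0 := area_density_neq0 omega iz.
apply: (mulIf d0).
rewrite -(poissonE omega cF cG dp) -(poissonE omega (C1N cF) (C1N cG) dp).
have DN H v : C1 H -> 'D_v (in_chart i (fun q => - H q)) (chart_ i p) =
    - 'D_v (in_chart i H) (chart_ i p).
  move=> cH; rewrite -deriveN//; apply: diff_derivable.
  exact: ((C1P H).1 cH i _ iz).1.
by rewrite /wedge !DN// !mulrNN.
Qed.

End poisson_bound.

(** * The inequality for simple quasi-states, and additivity *)

Section defect_inequality.
Context {R : realType} (M : closedSurface R) (omega : areaForm M).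
Local Notation mu := (@plane_measure R).
Implicit Types (p q : M) (F G : continuousType M R) (zeta : continuousType M R -> R).

Lemma area_ge0 : (0 <= area omega)%E.
Proof.
apply: le_ereal_inf_tmp => _ [n [i [A [_ ->]]]].
by apply: sume_ge0 => k _; apply: integral_ge0 => x _; rewrite lee_fin.
Qed.

Lemma simple_quasi_state_defect_pos zeta F G : simple_quasi_state zeta -> C1 F -> C1 G ->
  0 < zeta (F + G) - zeta F - zeta G ->
  (((zeta (F + G) - zeta F - zeta G) ^+ 2)%:E <=
    area omega * (sup_norm (poisson omega F G))%:E)%E.
Proof.
move=> sz cF cG; set d := _ - _ => d0; set S := sup_norm _.
have [N nN NP] := even_fibers omega cF cG.
pose T := triangle (zeta F) (zeta G) (zeta (F + G)).
have mT : measurable T := @measurable_triangle R _ _ _.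
have Td : ((d ^+ 2)%:E <= 2%:E * mu T)%E.
  have := @triangle_area_ge R (zeta F) (zeta G) (zeta (F + G)).
  rewrite (_ : zeta (F + G) - zeta F - zeta G = d)//; apply.
  by rewrite /d in d0; lra.
have two y : T y -> ~ N y -> exists p q, [/\ p != q, (F p, G p) = y & (F q, G q) = y].
  move=> [yF yG yFG] /NP[reg even].
  have [p [Fp Gp]] := simple_quasi_state_triangle sz (@surface_compact R M) yF yG yFG.
  have Py : (F p, G p) = y by rewrite Fp Gp; case: (y).
  have [s [us sP]] := finite_fiber cF cG reg.
  have := even s (conj us sP); have ps : p \in s by apply/sP.
  case: s us sP ps => [//|q [|r s]] //= /andP[]; rewrite inE negb_or => /andP[qr _] _ sP _ _.
  exists q, r; split => //; apply/sP; first by rewrite inE eqxx.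
  by rewrite !inE eqxx orbT.
(* If the bracket vanished identically there would be no regular points, so no value outside [N]
   would be taken and the triangle would be null. *)
have S0 : 0 < S.
  rewrite ltNge; apply/negP => S0.
  have P0 p : poisson omega F G p = 0.
    apply/eqP; rewrite -normr_le0; apply: le_trans S0.
    exact: le_sup_norm_poisson.
  have TN : T `<=` N.
    move=> y Ty; apply: contrapT => nNy; have [p [q [_ Py _]]] := two y Ty nNy.
    by have := (NP y nNy).1 p Py; rewrite P0 eqxx.
  have [H mH [NH muH]] := nN.
  have muT : (mu T <= 0)%E.
    apply: le_trans muH; apply: le_measure; rewrite ?inE//.
    exact: subset_trans NH.
  have : (2%:E * mu T <= 0)%E by rewrite mule_ge0_le0// lee_fin.
  by move=> /(le_trans Td); rewrite lee_fin leNgt exprn_gt0.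
(* [area] is an infimum over partitions: the bound is divided by [S], proved for each partition, and
   multiplied back. *)
have le_area : ((S^-1 * d ^+ 2)%:E <= area omega)%E.
  apply: le_ereal_inf_tmp => _ [n [i [A [pA ->]]]].
  rewrite EFinM lee_pdivrMl//; apply: le_trans Td _.
  apply: le_trans (double_cover cF cG pA nN two mT) _.
  exact: sum_integral_wedge_le.
rewrite (_ : d ^+ 2 = (S^-1 * d ^+ 2) * S); last by rewrite mulrC mulVKf// gt_eqF.
by rewrite EFinM; apply: lee_wpmul2r => //; rewrite lee_fin ltW.
Qed.

Lemma simple_quasi_state_defect zeta F G : simple_quasi_state zeta -> C1 F -> C1 G ->
  ((`|zeta (F + G) - zeta F - zeta G| ^+ 2)%:E <=
    area omega * (sup_norm (poisson omega F G))%:E)%E.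
Proof.
move=> sz cF cG; have [d0|d0|<-] := ltrgtP 0 (zeta (F + G) - zeta F - zeta G).
- by rewrite gtr0_norm//; exact: simple_quasi_state_defect_pos.
- have := simple_quasi_state_defect_pos sz (C1N cF : C1 (- F)) (C1N cG : C1 (- G)).
  rewrite [poisson omega _ _](poissonNN omega cF cG) -opprD !(simple_quasi_stateN sz) => h.
  have E : - (zeta (F + G) - zeta F - zeta G) = - zeta (F + G) - - zeta F - - zeta G.
    by rewrite !opprD !opprK.
  by rewrite ltr0_norm// E; apply: h; rewrite -E oppr_gt0.
- rewrite normr0 expr0n /= mule_ge0 ?area_ge0// lee_fin.
  have [p _] := simple_quasi_state_range sz F.
  exact: le_trans (le_sup_norm_poisson omega p cF cG).
Qed.

Lemma closed_eqD (T : topologicalType) (f g h : T -> R) :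
  continuous f -> continuous g -> continuous h -> closed [set t | f t = g t + h t].
Proof.
move=> cf cg ch.
rewrite (_ : [set _ | _] = (fun t => f t - (g t + h t)) @^-1` [set 0]); last first.
  apply/seteqP; split => t /=; first by move=> ->; rewrite subrr.
  by move=> /eqP; rewrite subr_eq0 => /eqP.
apply: closed_comp; last exact: closed_eq.
by move=> t _; apply: cvgB; [exact: cf|apply: cvgD; [exact: cg|exact: ch]].
Qed.

Lemma additive_functionals_closed F G : closed
  ([set zeta : continuousType M R -> R | zeta (F + G) = zeta F + zeta G]
    : set {ptws (continuousType M R) -> R}).
Proof.
pose ev (H : continuousType M R) := @proj_continuous (continuousType M R) (fun=> R) H.
exact: (@closed_eqD {ptws (continuousType M R) -> R} (fun z => z (F + G)) (fun z => z F)
  (fun z => z G) (ev _) (ev _) (ev _)).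
Qed.

Lemma additive_functionals_convex F G : convex_set
  ([set zeta : continuousType M R -> R | zeta (F + G) = zeta F + zeta G]
    : set (convex_lmodType (continuousType M R -> R))).
Proof.
move=> u v t; rewrite !inE /= => uE vE.
have E (H : continuousType M R) : (conv t u v : continuousType M R -> R) H = t%:num * u H + (1 - t%:num) * v H by [].
by rewrite !E uE vE; ring.
Qed.

End defect_inequality.

Theorem mainTheorem6 (R : realType) (M : closedSurface R) (omega : areaForm M) :
  (forall zeta : continuousType M R -> R, simple_quasi_state zeta ->
     forall F G : continuousType M R, C1 F -> C1 G ->
       ((`|zeta (F + G) - zeta F - zeta G| ^+ 2)%:E
         <= area omega * (sup_norm (poisson omega F G))%:E)%E)
  /\
  (forall zeta : continuousType M R -> R, representable zeta ->
     forall F G : continuousType M R, C1 F -> C1 G ->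
       (forall p, poisson omega F G p = 0) ->
       zeta (F + G) = zeta F + zeta G).
Proof.
split=> [zeta sz F G|zeta [_ hull] F G cF cG P0]; first exact: simple_quasi_state_defect.
apply: (hull _ (@additive_functionals_closed R M F G) (@additive_functionals_convex R M F G)).
move=> xi sxi; have := simple_quasi_state_defect omega sxi cF cG.
have -> : sup_norm (poisson omega F G) = 0.
  (* Since [xi] exists, [M] has a point, and the range is {0} instead of empty. *)
  have [p _] := simple_quasi_state_range sxi F.
  rewrite /sup_norm.
  have -> : range (fun q => `|poisson omega F G q|) = [set 0].
    by apply/seteqP; split => [_ [q _ <-]|_ ->] /=; [|exists p]; rewrite // P0 normr0.
  exact: sup1.
rewrite mule0 lee_fin => h; apply/eqP; rewrite -subr_eq0 opprD addrA -normr_le0.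
by rewrite -(@ler_pXn2r _ 2) ?nnegrE// expr0n.
Qed.
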